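(* Let $n\ge 3$ be an integer and let $k,l$ denote integers in $\{1,\dots,n\}$. (a) If $k$ divides $n$, then $\kappa_{\mathbb G_n}(0;e_k)=\rho_n(e_k)$. Therefore, if $l$ also divides $n$ (and $k\le l$), then $\kappa^{(2)}_{\mathbb G_n}(0;X)=\rho_n(X)$ for any $X\in L_{k,l}$. (b) If $k$ does not divide $n$, then $\hat\kappa_{\mathbb G_n}(0;e_k)>\rho_n(e_k)$. (c) If $X\in L_{1,n}\setminus(L_{1,1}\cup L_{n,n})$, then $\kappa_{\mathbb G_n}(0;X)>\rho_n(X)$. In particular, $k_{\mathbb G_n}(0,\cdot)\not\equiv p_{\mathbb G_n}(0,\cdot)$ and $\tilde k_{\mathbb G_n}(0,\cdot)\not\equiv k^{(2)}_{\mathbb G_n}(0,\cdot)$ as functions on $\mathbb G_n$, and $\mathbb G_n$ does not have property $(\ast)$.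
   Context: $\mathbb D$ is the open unit disc in $\mathbb C$, $\mathbb T=\partial\mathbb D$, and $\mathcal O(A,B)$ is the set of holomorphic maps $A\to B$. Symmetrized polydisc: let $\sigma_n=(\sigma_{n,1},\dots,\sigma_{n,n}):\mathbb C^n\to\mathbb C^n$ with $\sigma_{n,k}(z_1,\dots,z_n)=\sum_{1\le j_1<\dots<j_k\le n}z_{j_1}\cdots z_{j_k}$, $1\le k\le n$. Then $\mathbb G_n=\sigma_n(\mathbb D^n)$, a domain in $\mathbb C^n$ containing $0$. For a domain $D\subset\mathbb C^n$, $z,w\in D$, $X\in\mathbb C^n$: - Lempert function: $\tilde k_D(z,w)=\inf\{\tanh^{-1}|\alpha|:\alpha\in\mathbb D,\ \exists\varphi\in\mathcal O(\mathbb D,D):\varphi(0)=z,\ \varphi(\alpha)=w\}$. - Kobayashi–Royden pseudometric: $\kappa_D(z;X)=\inf\{\alpha\ge 0:\exists\varphi\in\mathcal O(\mathbb D,D):\varphi(0)=z,\ \alpha\varphi'(0)=X\}$. - Kobayashi pseudodistance $k_D$: the largest pseudodistance on $D$ not exceeding $\tilde k_D$. - Kobayashi–Buseman pseudometric $\hat\kappa_D$: for each $z$, $\hat\kappa_D(z;\cdot)$ is the largest (complex) seminorm on $\mathbb C^n$ not exceeding $\kappa_D(z;\cdot)$. - $k_D^{(2)}(z,w)=\inf\{\tilde k_D(z,z_1)+\tilde k_D(z_1,w):z_1\in D\}$. - $\kappa_D^{(2)}(z;X)=\inf\{\kappa_D(z;X_1)+\kappa_D(z;X_2):X_1,X_2\in\mathbb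 C^n,\ X_1+X_2=X\}$. The function $\rho_n$: for $X=(X_1,\dots,X_n)\in\mathbb C^n$, $$\rho_n(X)=\max_{\lambda\in\mathbb T}\left|\frac{1}{n}\sum_{j=1}^n jX_j\lambda^{j-1}\right|.$$ The function $p_{\mathbb G_n}$: for $m\ge 2$ and $\lambda\in\overline{\mathbb D}$ let $p_{m,\lambda}$ be the rational map $z=(z_1,\dots,z_m)\mapsto(\tilde z_1(\lambda),\dots,\tilde z_{m-1}(\lambda))$, where $$\tilde z_j(\lambda)=\frac{(m-j)z_j+\lambda(j+1)z_{j+1}}{m+\lambda z_1},\quad 1\le j\le m-1;$$ it maps $\mathbb G_m$ into $\mathbb G_{m-1}$ (with $\mathbb G_1=\mathbb D$). For $\lambda_1,\dots,\lambda_{n-1}\in\overline{\mathbb D}$ put $f_{\lambda_1,\dots,\lambda_{n-1}}=p_{2,\lambda_1}\circ\dots\circ p_{n,\lambda_{n-1}}$, which maps $\mathbb G_n$ into $\mathbb D$. Then, for $z,w\in\mathbb G_n$, $$p_{\mathbb G_n}(z,w)=\max_{\lambda_1,\dots,\lambda_{n-1}\in\mathbb T}p_{\mathbb D}\bigl(f_{\lambda_1,\dots,\lambda_{n-1}}(z),f_{\lambda_1,\dots,\lambda_{n-1}}(w)\bigr),$$ where $p_{\mathbb D}(a,b)=\tanh^{-1}\left|\frac{a-b}{1-\overline a b}\right|$ is the Poincaré distance of $\mathbb D$. $e_1,\dots,e_n$ is the standard basis of $\mathbb C^n$, and for $1\le k\le l\le n$, $L_{k,l}$ is the complex linear span of $e_k$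 and $e_l$ (so $L_{k,k}=\mathbb C e_k$). Property $(\ast)$ of a domain $D\subset\mathbb C^n$: $D$ can be exhausted by domains biholomorphic to convex domains, i.e. for every compact $K\subset D$ there is a domain $D'$ with $K\subset D'\subset D$ that is biholomorphic to a convex domain in $\mathbb C^n$. *)

(* Defs.v *)
From HB Require Import structures.
From mathcomp Require Import all_boot all_order all_algebra.
From mathcomp Require Import all_classical all_reals all_analysis.
From mathcomp Require Import complex.

Set Implicit Arguments.
Unset Strict Implicit.
Unset Printing Implicit Defensive.

Import Order.TTheory GRing.Theory Num.Theory.
Import numFieldNormedType.Exports.

Local Open Scope classical_set_scope.
Local Open Scope ring_scope.

(* The complex numbers R[i] as a normed space over themselves. With this
   instance 'rV[R[i]]_n also becomes a normed space over R[i] (sup norm), and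
   [differentiable] between such spaces is complex differentiability. *)
HB.instance Definition _ (R : realType) := NormedModule.copy R[i] (R[i])^o.

Section Defs.
Context {R : realType}.
Local Notation C := R[i].
(* The R-valued modulus; the norm `|z| of MathComp takes its values in C. *)
Local Notation normc := (@Normc.normc R).

Definition disc : set C := [set z | normc z < 1].

Definition circle : set C := [set z | normc z = 1].

Definition holomorphic (V W : normedModType C) (A : set V) (B : set W)
    (f : V -> W) : Prop :=
  forall z, A z -> differentiable f z /\ B (f z).

Definition biholomorphic (V W : normedModType C) (A : set V) (B : set W) :
    Prop :=
  exists (f : V -> W) (g : W -> V),
    [/\ holomorphic A B f, holomorphic B A g,
        forall z, A z -> g (f z) = z & forall w, B w -> f (g w) = w].

(* The inverse of tanh on ]-1, 1[. *)
Definition artanh (r : R) : R := ln ((1 + r) / (1 - r)) / 2.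

Definition poincare (a b : C) : R :=
  artanh (normc ((a - b) / (1 - conjc a * b))).

Section Dimension.
Context {n : nat}.
Local Notation Cn := 'rV[C]_n.

Definition domain (D : set Cn) : Prop := [/\ D !=set0, open D & connected D].

(* All the functions below take values in \bar R: an infimum over the empty
   set is +oo. *)

Definition lempert (D : set Cn) (z w : Cn) : \bar R :=
  ereal_inf [set (artanh (normc alpha))%:E | alpha in
    [set alpha | disc alpha /\ exists phi : C -> Cn,
      [/\ holomorphic disc D phi, phi 0 = z & phi alpha = w]]].

Definition kobayashi_royden (D : set Cn) (z X : Cn) : \bar R :=
  ereal_inf [set alpha%:E | alpha in
    [set alpha : R | 0 <= alpha /\ exists phi : C -> Cn,
      [/\ holomorphic disc D phi, phi 0 = z
        & alpha%:C%C *: derive1 phi 0 = X]]].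

Definition pseudodistance_on (D : set Cn) (d : Cn -> Cn -> R) : Prop :=
  [/\ forall x y, D x -> D y -> 0 <= d x y,
      forall x, D x -> d x x = 0,
      forall x y, D x -> D y -> d x y = d y x
    & forall x y z, D x -> D y -> D z -> d x z <= d x y + d y z].

Definition seminorm (N : Cn -> R) : Prop :=
  (forall X Y, N (X + Y) <= N X + N Y) /\
  (forall (a : C) X, N (a *: X) = normc a * N X).

(* The largest pseudodistance (resp. seminorm) below a given function is the
   supremum of all of them; see [kobayashi_largest] and
   [kobayashi_buseman_largest]. *)

Definition kobayashi (D : set Cn) (z w : Cn) : \bar R :=
  ereal_sup [set (d z w)%:E | d in
    [set d | pseudodistance_on D d /\
       forall x y, D x -> D y -> ((d x y)%:E <= lempert D x y)%E]].

Definition kobayashi_buseman (D : set Cn) (z X : Cn) : \bar R :=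
  ereal_sup [set (N X)%:E | N in
    [set N | seminorm N /\
       forall Y, ((N Y)%:E <= kobayashi_royden D z Y)%E]].

Definition lempert2 (D : set Cn) (z w : Cn) : \bar R :=
  ereal_inf [set (lempert D z z1 + lempert D z1 w)%E | z1 in D].

Definition kobayashi_royden2 (D : set Cn) (z X : Cn) : \bar R :=
  ereal_inf [set a | exists X1 X2 : Cn, X1 + X2 = X /\
    a = (kobayashi_royden D z X1 + kobayashi_royden D z X2)%E].

(* Property ( * ): D is exhausted by domains biholomorphic to convex ones. *)
Definition convex_exhaustible (D : set Cn) : Prop :=
  forall K : set Cn, compact K -> K `<=` D ->
    exists D' G : set Cn,
      [/\ domain D', K `<=` D' & D' `<=` D] /\
      [/\ domain G, convex_set G & biholomorphic D' G].

End Dimension.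

(* Coordinates z_1, ..., z_n of C^n are numbered from 0 in 'rV[C]_n: z_j is
   z 0 i for the i : 'I_n with j = i.+1. *)

Definition symm (n : nat) (z : 'rV[C]_n) : 'rV[C]_n :=
  \row_(k < n) \sum_(A : {set 'I_n} | #|A| == k.+1) \prod_(j in A) z 0 j.

Definition symm_polydisc (n : nat) : set 'rV[C]_n :=
  @symm n @` [set z : 'rV[C]_n | forall j, disc (z 0 j)].

Definition basis_vec (n k : nat) : 'rV[C]_n := \row_(j < n) (j.+1 == k)%:R.

Definition coordinate_span (n k l : nat) : set 'rV[C]_n :=
  [set X | exists a b : C, X = a *: basis_vec n k + b *: basis_vec n l].

(* In [rho] and [p_symm] the supremum is a maximum, by compactness. *)
Definition rho (n : nat) (X : 'rV[C]_n) : \bar R :=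
  ereal_sup [set (normc (n%:R^-1 *
      \sum_(j < n) j.+1%:R * X 0 j * lam ^+ j))%:E | lam in circle].

(* The map p_{m,lambda} for m = m'.+1. *)
Definition p_map (m' : nat) (lam : C) (z : 'rV[C]_m'.+1) : 'rV[C]_m' :=
  \row_(i < m') (((m' - i)%:R * z 0 (widen_ord (leqnSn m') i)
                  + lam * i.+2%:R * z 0 (lift ord0 i))
                 / (m'.+1%:R + lam * z 0 ord0)).

(* p_{2,lam 1} \o ... \o p_{m,lam (m-1)}, as a C-valued map; the value for
   m = 0 is irrelevant. *)
Fixpoint f_map (lam : nat -> C) (m : nat) : 'rV[C]_m -> C :=
  match m with
  | 0 => fun=> 0
  | m'.+1 => fun z =>
      if m' is 0 then z 0 ord0 else f_map lam (p_map (lam m') z)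
  end.

Definition p_symm (n : nat) (z w : 'rV[C]_n) : \bar R :=
  ereal_sup [set (poincare (f_map lam z) (f_map lam w))%:E | lam in
    [set lam : nat -> C | forall i, (1 <= i < n)%N -> circle (lam i)]].

End Defs.

Arguments symm_polydisc {R} n _ : rename.
Arguments basis_vec {R} n k.
Arguments coordinate_span {R} n k l _ : rename.

Section Largest.
Context {R : realType} {n : nat}.
Implicit Types (D : set 'rV[R[i]]_n) (z w X : 'rV[R[i]]_n).

Lemma artanh_ge0 (r : R) : 0 <= r < 1 -> 0 <= artanh r.
Proof.
case/andP=> r0 r1; rewrite /artanh divr_ge0// ln_ge0// ler_pdivlMr ?subr_gt0//.
by rewrite mul1r lerD2l (le_trans _ r0)// oppr_le0.
Qed.

Lemma normc_ge0 (a : R[i]) : 0 <= Normc.normc a.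
Proof. by case: a => a b; exact: sqrtr_ge0. Qed.

Lemma lempert_ge0 D z w : (0 <= lempert D z w)%E.
Proof.
apply: le_ereal_inf_tmp => _ [a [a1 _] <-].
by rewrite lee_fin artanh_ge0// normc_ge0.
Qed.

Lemma kobayashi_royden_ge0 D z X : (0 <= kobayashi_royden D z X)%E.
Proof. by apply: le_ereal_inf_tmp => _ [a [a0 _] <-]; rewrite lee_fin. Qed.

(* A supremum of reals containing a nonnegative one, and bounded by a finite
   bound, is a nonnegative real. *)
Let sup_fin (S : set \bar R) (b : \bar R) : S 0%E -> ubound S b -> (b < +oo)%E ->
  ereal_sup S \is a fin_num.
Proof.
move=> S0 Sb bfin; apply/fin_real/andP; split.
  by apply: (lt_le_trans (ltNyr 0)); exact: ereal_sup_ubound.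
by apply: le_lt_trans bfin; exact: ge_ereal_sup.
Qed.

Lemma kobayashi_largest D :
  (forall z w, D z -> D w -> (lempert D z w < +oo)%E) ->
  let d z w := fine (kobayashi D z w) in
  [/\ pseudodistance_on D d,
      forall z w, D z -> D w -> (d z w)%:E = kobayashi D z w,
      forall z w, D z -> D w -> ((d z w)%:E <= lempert D z w)%E
    & forall d', pseudodistance_on D d' ->
      (forall z w, D z -> D w -> ((d' z w)%:E <= lempert D z w)%E) ->
      forall z w, D z -> D w -> d' z w <= d z w].
Proof.
move=> Dfin d.
have fin z w : D z -> D w -> kobayashi D z w \is a fin_num.
  move=> Dz Dw; apply: (@sup_fin _ (lempert D z w)); last exact: Dfin.
  - exists (fun _ _ => 0) => //; split; last by move=> x y _ _; exact: (lempert_ge0 D x y).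
    by split=> // *; rewrite addr0.
  - by move=> _ [e [_ eD] <-]; exact: eD.
have dE z w : D z -> D w -> (d z w)%:E = kobayashi D z w.
  by move=> Dz Dw; rewrite /d fineK// fin.
have dmax d' : pseudodistance_on D d' ->
    (forall z w, D z -> D w -> ((d' z w)%:E <= lempert D z w)%E) ->
    forall z w, D z -> D w -> d' z w <= d z w.
  move=> pd' d'D z w Dz Dw; rewrite -lee_fin dE//.
  by apply: ereal_sup_ubound; exists d'.
have dle z w (b : R) : D z -> D w -> (forall e, pseudodistance_on D e ->
    (forall x y, D x -> D y -> ((e x y)%:E <= lempert D x y)%E) ->
    e z w <= b) -> d z w <= b.
  move=> Dz Dw eb; rewrite -lee_fin dE//; apply: ge_ereal_sup => _ [e [pe eD] <-].
  by rewrite lee_fin eb.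
have dge0 z w : D z -> D w -> 0 <= d z w.
  move=> Dz Dw; have pd0 : pseudodistance_on D (fun _ _ => 0).
    by split=> // *; rewrite addr0.
  by apply: (dmax _ pd0) => // x y _ _; exact: (lempert_ge0 D x y).
split=> //; last first.
  move=> z w Dz Dw; rewrite dE//; apply: ge_ereal_sup => _ [e [_ eD] <-].
  exact: eD.
split=> //.
- move=> x Dx; apply/eqP; rewrite eq_le dge0// andbT.
  by apply: dle => // e [_ e0 _ _] _; rewrite e0.
- move=> x y Dx Dy; apply/eqP; rewrite eq_le; apply/andP; split.
    by apply: dle => // e pe eD; case: (pe) => _ _ eC _; rewrite eC// dmax.
  by apply: dle => // e pe eD; case: (pe) => _ _ eC _; rewrite eC// dmax.
- move=> x y z Dx Dy Dz; apply: dle => // e pe eD; case: (pe) => _ _ _ eT.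
  by apply: (le_trans (eT _ y _ _ _ _)) => //; apply: lerD; apply: dmax.
Qed.

Lemma kobayashi_buseman_largest D z :
  (forall X, (kobayashi_royden D z X < +oo)%E) ->
  let N X := fine (kobayashi_buseman D z X) in
  [/\ seminorm N,
      forall X, (N X)%:E = kobayashi_buseman D z X,
      forall X, ((N X)%:E <= kobayashi_royden D z X)%E
    & forall N', seminorm N' ->
      (forall X, ((N' X)%:E <= kobayashi_royden D z X)%E) ->
      forall X, N' X <= N X].
Proof.
move=> Dfin N.
have fin X : kobayashi_buseman D z X \is a fin_num.
  apply: (@sup_fin _ (kobayashi_royden D z X)); last exact: Dfin.
  - exists (fun=> 0) => //; split; last by move=> Y; exact: (kobayashi_royden_ge0 D z Y).
    by split=> *; rewrite ?addr0 ?mulr0.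
  - by move=> _ [e [_ eD] <-]; exact: eD.
have NE X : (N X)%:E = kobayashi_buseman D z X by rewrite /N fineK.
have Nmax N' : seminorm N' ->
    (forall X, ((N' X)%:E <= kobayashi_royden D z X)%E) ->
    forall X, N' X <= N X.
  move=> sN' N'D X; rewrite -lee_fin NE.
  by apply: ereal_sup_ubound; exists N'.
have Nle X (b : R) : (forall e, seminorm e ->
    (forall Y, ((e Y)%:E <= kobayashi_royden D z Y)%E) -> e X <= b) -> N X <= b.
  move=> eb; rewrite -lee_fin NE; apply: ge_ereal_sup => _ [e [se eD] <-].
  by rewrite lee_fin eb.
split=> //; last first.
  by move=> X; rewrite NE; apply: ge_ereal_sup => _ [e [_ eD] <-]; exact: eD.
have NZ (a : R[i]) X : N (a *: X) <= Normc.normc a * N X.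
  apply: Nle => e se eD; case: (se) => _ eZ.
  by rewrite eZ ler_wpM2l ?normc_ge0// Nmax.
split=> [X Y|a X].
  apply: Nle => e se eD; case: (se) => eT _.
  by apply: (le_trans (eT _ _)); apply: lerD; apply: Nmax.
apply/eqP; rewrite eq_le NZ/=.
have [->|a0] := eqVneq a 0.
  have s0 : seminorm (fun _ : 'rV[R[i]]_n => 0 : R) by split=> *; rewrite ?addr0 ?mulr0.
  rewrite Normc.normc0 mul0r scale0r.
  exact: (Nmax _ s0 (kobayashi_royden_ge0 D z) 0).
have na0 : 0 < Normc.normc a.
  rewrite lt_neqAle normc_ge0 andbT eq_sym; apply/eqP => /Normc.eq0_normc a0'.
  by rewrite a0' eqxx in a0.
have := NZ a^-1 (a *: X).
by rewrite scalerA mulVf// scale1r Normc.normcV mulrC ler_pdivlMr// mulrC.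
Qed.

End Largest.

(* Main.v *)
Require Import Defs.
From mathcomp Require Import all_boot all_order all_algebra.
From mathcomp Require Import all_classical all_reals all_analysis.
From mathcomp Require Import complex cyclic separable cyclotomic.
From mathcomp Require Import ring lra zify.

Set Implicit Arguments.
Unset Strict Implicit.
Unset Printing Implicit Defensive.
Import Order.TTheory GRing.Theory Num.Theory.
Import numFieldNormedType.Exports.
Local Open Scope classical_set_scope.
Local Open Scope ring_scope.


(* A point of the symmetrized polydisc is the list of coefficients of a polynomial
   P = prod_j (1 + z_j t), and f_{lam, ..., lam} is P' / (n P - lam P') at lam. The
   Schwarz lemma for these functions gives rho <= kappa, and for k | n the disc
   (1 + zeta t^k)^(n/k) gives equality.

   If k does not divide n, the power sum p_k can be improved: for small a > 0 the
   function p_k - a sum_j p_j p_{k-j} is bounded on the symmetrized polydisc by some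
   M < n = max |p_k|. By the Schwarz lemma its derivative at 0, divided by M, gives a
   seminorm below kappa which exceeds rho on C e_k, and the Schwarz-Pick lemma makes it
   a pseudodistance below the Lempert function which exceeds p on C e_k near 0.

   The remaining claims rest on a rigidity property. Let phi be a disc through 0 for
   which f_{lam, ..., lam} o phi is close to zeta for all (n-1)-th roots of unity lam.
   Then phi_j is close to C(n, j) zeta^j v for j < n, with v = phi_1 / (n zeta), and the
   Schwarz lemma at lam = tau / zeta becomes Re J >= - eps on the circle
   |zeta| = |tau|, where J = v / (1 - v) (1 + tau)^(n-1) (1 - (zeta / tau)^(n-1)). As J is
   holomorphic this also holds inside, and if tau is such that Re (1 + tau)^(n-1) < 0 it
   excludes 0 < v < 1 near the origin. At zeta = 0 this is part (c). The point
   with polynomial ((1 + c t)^n + c (c + t)^n) / (1 + c^(n+1)) is joined to 0 by two discs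
   of length artanh c, and for small c rigidity forbids a single disc of length
   2 artanh c. If the domain could be exhausted by biholomorphic images of convex
   domains, averaging the discs (1 + zeta t)^n and 1 + zeta t^n there would give
   kappa(n e_1 + e_n) <= 2 = rho(n e_1 + e_n).

   The maximum principle comes from Goursat's lemma, applied to f(w + rho e^z) on
   squares of side 2 pi. *)

(** The infima defining kappa and the Lempert function are never assumed to be attained. Every
    strict inequality therefore comes from a uniform gap, and rigidity is stated with an eps that
    does not depend on the disc.

    The (n-1)-th roots of unity come from the linear form sum_j j X_j lam^(j-1) / n. On L_{1,n} it
    has two terms, whose moduli add up at n-1 values of lam, and after a rotation these are the
    solutions of lam^(n-1) = 1. The numerator of f_{lam, ..., lam} minus zeta times its denominator
    has degree n-1 in lam, so smallness at these points gives n-1 approximate equations for the n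
    coordinates of the point: the one free parameter is v.

    The values v = 1 and v = 0 cannot be excluded, as they belong to the discs (1 + zeta t)^n and 1
    + zeta t^n, for which the hypothesis of rigidity holds exactly. Only values in between lead to a
    contradiction.

    The condition n >= 3 enters twice: a tau in the unit disc with Re (1 + tau)^(n-1) < 0 exists
    only for n - 1 >= 2, and n - 1 does not divide n. *)

(** * The real-valued modulus of complex numbers *)

Section Modulus.
Context {R : realType}.
Local Notation C := R[i].
Local Notation Re := (@complex.Re R).
Local Notation Im := (@complex.Im R).
Local Notation nc := (@Normc.normc R).
Implicit Types z w : C.

Lemma normc_norm (z : C) : `|z| = (nc z)%:C%C.
Proof. by case: z. Qed.

Lemma ncM z w : nc (z * w) = nc z * nc w.
Proof. exact: Normc.normcM. Qed.

Lemma ncD z w : nc (z + w) <= nc z + nc w.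
Proof. by have := ler_normD z w; rewrite !normc_norm -rmorphD lecR. Qed.

Lemma ncN z : nc (- z) = nc z.
Proof. by have := normrN z; rewrite !normc_norm => /complexI. Qed.

Lemma ncB z w : nc (z - w) <= nc z + nc w.
Proof. by rewrite -(ncN w) ncD. Qed.

Lemma nc_distC z w : nc (z - w) = nc (w - z).
Proof. by rewrite -ncN opprB. Qed.

Lemma nc_real (x : R) : nc x%:C%C = `|x|.
Proof. by rewrite /= expr0n/= addr0 sqrtr_sqr. Qed.

Lemma nc_nat (n : nat) : nc n%:R = n%:R.
Proof. by rewrite -(rmorph_nat (real_complex R)) nc_real normr_nat. Qed.

Lemma ncX z n : nc (z ^+ n) = nc z ^+ n.
Proof.
elim: n => [|n IH]; first by rewrite !expr0 Normc.normc1.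
by rewrite !exprS ncM IH.
Qed.

Lemma nc_eq0 z : (nc z == 0) = (z == 0).
Proof.
apply/eqP/eqP => [/Normc.eq0_normc//|->]; exact: Normc.normc0.
Qed.

Lemma nc_gt0 z : (0 < nc z) = (z != 0).
Proof. by rewrite lt_def normc_ge0 andbT nc_eq0. Qed.

Lemma ncJ z : nc (conjc z) = nc z.
Proof. by case: z => a b /=; rewrite sqrrN. Qed.

Lemma nc_sqr z : nc z ^+ 2 = Re z ^+ 2 + Im z ^+ 2.
Proof. by case: z => a b /=; rewrite sqr_sqrtr// addr_ge0// sqr_ge0. Qed.

Lemma nc_ReIm z : nc z <= `|Re z| + `|Im z|.
Proof.
rewrite -(ler_pXn2r (n:=2))// ?nnegrE ?normc_ge0 ?addr_ge0//.
rewrite nc_sqr sqrrD !real_normK ?num_real// lerD2r lerDl mulrn_wge0//.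
Qed.

Lemma Re_nc z : `|Re z| <= nc z.
Proof.
rewrite -(ler_pXn2r (n:=2))// ?nnegrE ?normc_ge0//.
by rewrite nc_sqr real_normK ?num_real// lerDl sqr_ge0.
Qed.

Lemma Im_nc z : `|Im z| <= nc z.
Proof.
rewrite -(ler_pXn2r (n:=2))// ?nnegrE ?normc_ge0//.
by rewrite nc_sqr real_normK ?num_real// lerDr sqr_ge0.
Qed.

Lemma Re_le_nc z : Re z <= nc z.
Proof. exact: le_trans (ler_norm _) (Re_nc z). Qed.

Lemma nc_sum (I : Type) (r : seq I) (P : pred I) (F : I -> C) :
  nc (\sum_(i <- r | P i) F i) <= \sum_(i <- r | P i) nc (F i).
Proof.
elim/big_rec2: _ => [|i x y _ xy]; first by rewrite Normc.normc0.
by apply: (le_trans (ncD _ _)); rewrite lerD2l.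
Qed.

Lemma nc_prod (I : Type) (r : seq I) (P : pred I) (F : I -> C) :
  nc (\prod_(i <- r | P i) F i) = \prod_(i <- r | P i) nc (F i).
Proof.
elim/big_rec2: _ => [|i x y _ xy]; first by rewrite Normc.normc1.
by rewrite ncM xy.
Qed.

Lemma nc_le_sub z w : nc z - nc w <= nc (z - w).
Proof. by rewrite lerBlDr -{1}(subrK w z) ncD. Qed.

Lemma mulcJ z : z * conjc z = ((nc z) ^+ 2)%:C%C.
Proof.
by rewrite nc_sqr; case: z => a b; apply/eqP; rewrite eq_complex/=;
   apply/andP; split; apply/eqP; ring.
Qed.

Lemma Re_mul z w : Re (z * w) = Re z * Re w - Im z * Im w.
Proof. by case: z w => a b [c d]. Qed.
Lemma Im_mul z w : Im (z * w) = Re z * Im w + Im z * Re w.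
Proof. by case: z w => a b [c d]. Qed.
Lemma Re_add z w : Re (z + w) = Re z + Re w.
Proof. by case: z w => a b [c d]. Qed.
Lemma Im_add z w : Im (z + w) = Im z + Im w.
Proof. by case: z w => a b [c d]. Qed.
Lemma Re_opp z : Re (- z) = - Re z.
Proof. by case: z. Qed.
Lemma Im_opp z : Im (- z) = - Im z.
Proof. by case: z. Qed.
Lemma Re_sub z w : Re (z - w) = Re z - Re w.
Proof. by rewrite Re_add Re_opp. Qed.
Lemma Im_sub z w : Im (z - w) = Im z - Im w.
Proof. by rewrite Im_add Im_opp. Qed.
Lemma Re_conjc z : Re (conjc z) = Re z.
Proof. by case: z. Qed.
Lemma Im_conjc z : Im (conjc z) = - Im z.
Proof. by case: z. Qed.

Lemma conjcM z w : conjc (z * w) = conjc z * conjc w.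
Proof. exact: rmorphM. Qed.
Lemma conjcB z w : conjc (z - w) = conjc z - conjc w.
Proof. exact: rmorphB. Qed.
Lemma conjcN z : conjc (- z) = - conjc z.
Proof. exact: rmorphN. Qed.

End Modulus.

(** * Limits and complex differentiability in terms of the real-valued modulus *)

Section EpsDelta.
Context {R : realType}.
Local Notation C := R[i].
Local Notation Re := (@complex.Re R).
Local Notation Im := (@complex.Im R).
Local Notation nc := (@Normc.normc R).

Lemma nbhs_nc (z : C) (P : set C) :
  nbhs z P <-> exists2 d : R, 0 < d & forall w, nc (w - z) < d -> P w.
Proof.
split.
  move=> /nbhs_ballP[e /= e0 H].
  have eE : e = (Re e)%:C%C by apply/esym/RRe_real; exact: gtr0_real.
  exists (Re e); first by move: e0; rewrite eE ltcR.
  move=> w wz; apply: H; rewrite -ball_normE/=.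
  by rewrite eE normc_norm ltcR nc_distC.
move=> [d d0 H]; apply/nbhs_ballP; exists d%:C%C; first by rewrite /= ltcR.
by move=> w; rewrite -ball_normE/= normc_norm ltcR nc_distC => /H.
Qed.

Lemma cvg_nc (T : Type) (F : set_system T) {FF : Filter F} (f : T -> C) (l : C) :
  f @ F --> l <-> forall e : R, 0 < e -> \forall x \near F, nc (f x - l) < e.
Proof.
split.
  move=> fl e e0; apply: (fl [set w | nc (w - l) < e]).
  by apply/nbhs_nc; exists e.
move=> H P /nbhs_nc[d d0 dP].
by apply: filterS (H d d0) => x /dP.
Qed.

Lemma continuous_nc (f : C -> C) (z : C) :
  {for z, continuous f} <->
  forall e : R, 0 < e -> exists2 d : R, 0 < d & forall w, nc (w - z) < d -> nc (f w - f z) < e.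
Proof.
split.
  move=> /(cvg_nc (F := nbhs z)) H e e0.
  by have /nbhs_nc := H e e0.
by move=> H; apply/(cvg_nc (F := nbhs z)) => e e0; apply/nbhs_nc; exact: H.
Qed.

Lemma scaleC (a b : C) : a *: b = a * b.
Proof. by []. Qed.

Lemma differentiable_nc (f : C -> C) (z : C) :
  differentiable f z <-> exists a : C, forall e : R, 0 < e ->
    exists2 d : R, 0 < d &
      forall w, nc (w - z) < d -> nc (f w - f z - a * (w - z)) <= e * nc (w - z).
Proof.
split.
  move=> /derivable1_diffP df; exists (derive1 f z) => e e0.
  have : (h^-1 *: (f (h + z) - f z)) @[h --> 0^'] --> derive1 f z.
    move: df; rewrite /derivable /derive1.
    rewrite (_ : (fun h => h^-1 *: ((f \o shift z) (h *: 1) - f z)) = (fun h => h^-1 *: (f (h + z) - f z)))//.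
    by apply/funext => h /=; rewrite [h *: 1]mulr1.
  move=> /cvg_nc /(_ e e0) /nbhs_nc[d d0 H].
  exists d => // w wd.
  have [->|wz] := eqVneq w z; first by rewrite !subrr mulr0 subrr Normc.normc0 mulr0.
  have := H (w - z); rewrite subr0 => /(_ wd); rewrite subr_eq0 => /(_ wz).
  rewrite subrK.
  have wz0 : w - z != 0 by rewrite subr_eq0.
  have -> : f w - f z - derive1 f z * (w - z) = (w - z) * ((w - z)^-1 *: (f w - f z) - derive1 f z).
    by rewrite scaleC [RHS]mulrBr mulrA divff// mul1r [(w - z) * _]mulrC.
  by move=> /ltW h; rewrite ncM mulrC ler_wpM2r ?normc_ge0.
move=> [a H]; apply/derivable1_diffP.
apply/cvg_ex; exists a; apply/cvg_nc => e e0.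
have e20 : 0 < e / 2 by rewrite divr_gt0.
have [d d0 Hd] := H _ e20.
apply/nbhs_nc; exists d => // h; rewrite subr0 => hd h0.
have := Hd (h + z); rewrite addrK => /(_ hd) => K.
rewrite /= [h *: 1]scaleC mulr1.
have hn0 : 0 < nc h by rewrite nc_gt0.
have -> : h^-1 *: (f (h + z) - f z) - a = h^-1 * (f (h + z) - f z - a * h).
  by rewrite scaleC [RHS]mulrBr [a * h]mulrC mulrA mulVf// mul1r.
rewrite ncM Normc.normcV mulrC ltr_pdivrMr//.
by apply: (le_lt_trans K); rewrite ltr_pM2r// ltr_pdivrMr// mulr_natr mulr2n ltrDl.
Qed.

End EpsDelta.

(** * Goursat's lemma for squares *)

Section Goursat.
Context {R : realType}.
Local Notation C := R[i].
Local Notation Re := (@complex.Re R).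
Local Notation Im := (@complex.Im R).
Local Notation nc := (@Normc.normc R).
Local Open Scope complex_scope.

Lemma expr_lt_eps (q : R) (e : R) : 0 <= q < 1 -> 0 < e -> exists k : nat, q ^+ k < e.
Proof.
move=> /andP[q0 q1] e0.
have /cvgrPdist_lt/(_ e e0) : geometric 1 q x @[x --> \oo] --> (0 : R^o).
  by apply: cvg_geometric; rewrite ger0_norm.
case=> N _ /(_ N); rewrite /= leqnn => /(_ isT).
by rewrite sub0r normrN mul1r ger0_norm ?exprn_ge0// => ?; exists N.
Qed.

Definition continuous_on (h : R -> R) a b :=
  forall x, a <= x <= b -> {for x, continuous h}.

Definition itv_integral (h : R -> R) (a b : R) : R :=
  \int[lebesgue_measure]_(x in `[a, b]) h x.

Lemma continuous_integrable (h : R -> R) a b : continuous_on h a b ->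
  lebesgue_measure.-integrable `[a, b]%classic (EFin \o h).
Proof.
move=> ch; apply: continuous_compact_integrable; first exact: segment_compact.
apply: continuous_in_subspaceT => x; rewrite inE/= in_itv/=; exact: ch.
Qed.

Lemma continuous_onS (h : R -> R) a b a' b' : continuous_on h a b ->
  a <= a' -> b' <= b -> continuous_on h a' b'.
Proof.
move=> ch aa bb x /andP[ax xb]; apply: ch.
by rewrite (le_trans aa ax) (le_trans xb bb).
Qed.

Lemma itv_integral_split (h : R -> R) a m b : continuous_on h a b -> a <= m -> m <= b ->
  itv_integral h a b = itv_integral h a m + itv_integral h m b.
Proof.
move=> ch am mb; rewrite /itv_integral.
have := @Rintegral_itvB R h (BLeft a) (BRight b) m (continuous_integrable ch).
rewrite !bnd_simp => /(_ am mb).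
rewrite Rintegral_itv_obnd_cbnd; first by move=> <-; rewrite addrC subrK.
apply: (integrableS _ _ _ (continuous_integrable ch)) => //.
by apply: subset_itvr; rewrite bnd_simp.
Qed.

Lemma itv_integralB (f h : R -> R) a b : continuous_on f a b -> continuous_on h a b ->
  itv_integral (fun x => f x - h x) a b = itv_integral f a b - itv_integral h a b.
Proof. by move=> cf ch; apply: RintegralB => //; exact: continuous_integrable. Qed.

Lemma continuous_on_cst (c a b : R) : continuous_on (fun=> c) a b.
Proof. by move=> x _; exact: cst_continuous. Qed.

Lemma itv_integral_cst (c a b : R) : a <= b -> itv_integral (fun=> c) a b = c * (b - a).
Proof.
move=> ab; rewrite /itv_integral Rintegral_cst//; congr (_ * _).
have := @lebesgue_measure_itv R `[a, b]; rewrite /= lte_fin => mE.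
transitivity (fine (if a < b then (b%:E - a%:E)%E else 0%E)); first by rewrite -mE.
by case: ltP => //= ba; apply/eqP; rewrite eq_sym subr_eq0 eq_le ba ab.
Qed.

Lemma le_itv_integral (f h : R -> R) a b : continuous_on f a b -> continuous_on h a b ->
  (forall x, a <= x <= b -> f x <= h x) -> itv_integral f a b <= itv_integral h a b.
Proof.
by move=> cf ch fh; apply: le_Rintegral => //; exact: continuous_integrable.
Qed.

Lemma itv_integral_near_cst (h : R -> R) a b K E : a <= b -> continuous_on h a b ->
  (forall x, a <= x <= b -> `|h x - K| <= E) ->
  `|itv_integral h a b - K * (b - a)| <= E * (b - a).
Proof.
move=> ab ch hK.
have hle x : a <= x <= b -> K - E <= h x <= K + E.
  by move=> /hK; rewrite ler_norml => /andP[H1 H2]; apply/andP; split; lra.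
have H1 : (K - E) * (b - a) <= itv_integral h a b.
  rewrite -itv_integral_cst//; apply: le_itv_integral => //; first exact: continuous_on_cst.
  by move=> x /hle/andP[].
have H2 : itv_integral h a b <= (K + E) * (b - a).
  rewrite -itv_integral_cst//; apply: le_itv_integral => //; first exact: continuous_on_cst.
  by move=> x /hle/andP[].
by rewrite ler_norml; apply/andP; split; lra.
Qed.

Lemma continuous_onB (f h : R -> R) a b : continuous_on f a b -> continuous_on h a b ->
  continuous_on (fun x => f x - h x) a b.
Proof. by move=> cf ch x xab; apply: continuousB; [exact: cf|exact: ch]. Qed.

Definition rect_form (g : C -> C) (a b c d : R) : R :=
  itv_integral (fun x => Re (g (x +i* c)) - Re (g (x +i* d))) a b -
  itv_integral (fun y => Im (g (b +i* y)) - Im (g (a +i* y))) c d.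

Definition differentiable_rect (g : C -> C) (a b c d : R) :=
  forall x y, a <= x <= b -> c <= y <= d -> differentiable g (x +i* y).

Lemma differentiable_rectS g a b c d a' b' c' d' : differentiable_rect g a b c d ->
  a <= a' -> b' <= b -> c <= c' -> d' <= d -> differentiable_rect g a' b' c' d'.
Proof.
move=> dg aa bb cc dd x y /andP[ax xb] /andP[cy yd]; apply: dg.
  by rewrite (le_trans aa ax) (le_trans xb bb).
by rewrite (le_trans cc cy) (le_trans yd dd).
Qed.

Lemma real_continuousP (h : R -> R) x :
  (forall e, 0 < e -> exists2 d : R, 0 < d & forall y, `|y - x| < d -> `|h y - h x| < e) ->
  {for x, continuous h}.
Proof.
move=> H; apply/cvgrPdist_lt => e e0.
have [d d0 Hd] := H e e0.
exists d => //= y yd.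
by rewrite distrC; apply: Hd; rewrite distrC.
Qed.

Lemma nc_hline (x y c : R) : nc (x +i* c - y +i* c) = `|x - y|.
Proof. by rewrite /= subrr expr0n/= addr0 sqrtr_sqr. Qed.

Lemma nc_vline (x y a : R) : nc (a +i* x - a +i* y) = `|x - y|.
Proof. by rewrite /= subrr expr0n/= add0r sqrtr_sqr. Qed.

Lemma rect_continuous g a b c d : differentiable_rect g a b c d ->
  (forall y, c <= y <= d -> continuous_on (fun x => Re (g (x +i* y))) a b) /\
  (forall x, a <= x <= b -> continuous_on (fun y => Im (g (x +i* y))) c d).
Proof.
move=> dg; split=> [y ycd x xab|x xab y ycd];
  have /differentiable_continuous/continuous_nc H := dg x y xab ycd;
  apply: real_continuousP => e /H[s s0 Hs]; exists s => // t ts.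
  have := Hs (t +i* y); rewrite nc_hline => /(_ ts); apply: le_lt_trans.
  by rewrite -Re_sub; exact: Re_nc.
have := Hs (x +i* t); rewrite nc_vline => /(_ ts); apply: le_lt_trans.
by rewrite -Im_sub; exact: Im_nc.
Qed.

Lemma rect_form_splitx g a m b c d : differentiable_rect g a b c d ->
  a <= m -> m <= b -> c <= d ->
  rect_form g a b c d = rect_form g a m c d + rect_form g m b c d.
Proof.
move=> dg am mb cd.
have ab := le_trans am mb.
have [ch cv] := rect_continuous dg.
rewrite /rect_form (@itv_integral_split _ a m b)//; last first.
  by apply: continuous_onB; apply: ch; rewrite ?lexx ?cd.
have cva : continuous_on (fun y => Im (g (a +i* y))) c d by apply: cv; rewrite lexx.
have cvm : continuous_on (fun y => Im (g (m +i* y))) c d by apply: cv; rewrite am.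
have cvb : continuous_on (fun y => Im (g (b +i* y))) c d by apply: cv; rewrite lexx ab.
rewrite !(itv_integralB cvb) ?(itv_integralB cvm)//.
by ring.
Qed.

Lemma rect_form_splity g a b c m d : differentiable_rect g a b c d ->
  c <= m -> m <= d -> a <= b ->
  rect_form g a b c d = rect_form g a b c m + rect_form g a b m d.
Proof.
move=> dg cm md ab.
have cd := le_trans cm md.
have [ch cv] := rect_continuous dg.
rewrite /rect_form (@itv_integral_split _ c m d)//; last first.
  by apply: continuous_onB; apply: cv; rewrite ?lexx ?ab.
have cva : continuous_on (fun x => Re (g (x +i* c))) a b by apply: ch; rewrite lexx.
have cvm : continuous_on (fun x => Re (g (x +i* m))) a b by apply: ch; rewrite cm.
have cvb : continuous_on (fun x => Re (g (x +i* d))) a b by apply: ch; rewrite lexx cd.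
rewrite !(itv_integralB cva) ?(itv_integralB cvm)//.
by ring.
Qed.

(* Near a point of differentiability the affine part of [g] contributes
   nothing, so the form is small compared with the area of the square. *)
Lemma rect_form_small g (p : C) a c h e d l : 0 < h -> 0 < e ->
  differentiable_rect g a (a + h) c (c + h) ->
  (forall w, nc (w - p) < d -> nc (g w - g p - l * (w - p)) <= e * nc (w - p)) ->
  a <= Re p <= a + h -> c <= Im p <= c + h -> 2 * h < d ->
  `|rect_form g a (a + h) c (c + h)| <= 8 * e * h ^+ 2.
Proof.
move=> h0 e0 dg Hl /andP[pa pb] /andP[pc pd] hd.
have [ch cv] := rect_continuous dg.
have ah : a <= a + h by rewrite lerDl ltW.
have chh : c <= c + h by rewrite lerDl ltW.
have err x y : a <= x <= a + h -> c <= y <= c + h ->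
    nc (g (x +i* y) - g p - l * (x +i* y - p)) <= e * (2 * h).
  move=> /andP[xa xb] /andP[yc yd].
  have wp : nc (x +i* y - p) <= 2 * h.
    apply: (le_trans (nc_ReIm _)); rewrite Re_sub Im_sub /=.
    have H1 : `|x - Re p| <= h by rewrite ler_norml; apply/andP; split; lra.
    have H2 : `|y - Im p| <= h by rewrite ler_norml; apply/andP; split; lra.
    lra.
  apply: (le_trans (Hl _ (le_lt_trans wp hd))).
  by rewrite ler_pM2l.
rewrite /rect_form.
set I1 := itv_integral _ _ _; set I2 := itv_integral _ _ _.
have H1 : `|I1 - (Im l * h) * (a + h - a)| <= e * (4 * h) * (a + h - a).
  apply: itv_integral_near_cst => //.
    by apply: continuous_onB; apply: ch; rewrite ?lexx ?chh.
  move=> x xab.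
  have E1 := err x c xab; rewrite lexx chh in E1; have {}E1 := E1 isT.
  have E2 := err x (c + h) xab; rewrite lexx chh in E2; have {}E2 := E2 isT.
  set z1 := g (x +i* c) in E1 *; set z2 := g (x +i* (c + h)) in E2 *.
  have -> : Re z1 - Re z2 - Im l * h =
     Re ((z1 - g p - l * (x +i* c - p)) - (z2 - g p - l * (x +i* (c + h) - p))).
    by rewrite !Re_sub !Re_mul !Im_sub/=; ring.
  apply: (le_trans (Re_nc _)); apply: (le_trans (ncB _ _)); lra.
have H2 : `|I2 - (Im l * h) * (c + h - c)| <= e * (4 * h) * (c + h - c).
  apply: itv_integral_near_cst => //.
    by apply: continuous_onB; apply: cv; rewrite ?lexx ?ah.
  move=> y ycd.
  have E1 := err (a + h) y; rewrite lexx ah in E1; have {}E1 := E1 isT ycd.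
  have E2 := err a y; rewrite lexx ah in E2; have {}E2 := E2 isT ycd.
  set z1 := g ((a + h) +i* y) in E1 *; set z2 := g (a +i* y) in E2 *.
  have -> : Im z1 - Im z2 - Im l * h =
     Im ((z1 - g p - l * ((a + h) +i* y - p)) - (z2 - g p - l * (a +i* y - p))).
    by rewrite !Im_sub !Im_mul !Re_sub/=; ring.
  apply: (le_trans (Im_nc _)); apply: (le_trans (ncB _ _)); lra.
have -> : I1 - I2 = (I1 - Im l * h * (a + h - a)) - (I2 - Im l * h * (c + h - c)) by ring.
apply: (le_trans (ler_normB _ _)).
apply: (le_trans (lerD H1 H2)).
by rewrite le_eqVlt; apply/orP; left; apply/eqP; ring.
Qed.

Section Bisection.
Variables (g : C -> C) (a0 c0 h0 : R).
Hypothesis h0_gt0 : 0 < h0.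
Hypothesis dg : differentiable_rect g a0 (a0 + h0) c0 (c0 + h0).

Let T (s : R * R) h := rect_form g s.1 (s.1 + h) s.2 (s.2 + h).

(** A square is given by its lower left corner and its side. The step keeps a quarter square that
    carries at least a quarter of the form. The last branch is untested: if the other three fail,
    additivity ([T4]) leaves only this one. *)
Let step (k : nat) (s : R * R) : R * R :=
  let h := h0 / 2 ^+ k in
  let h' := h / 2 in
  if `|T s h| / 4 <= `|T s h'| then s else
  if `|T s h| / 4 <= `|T (s.1 + h', s.2) h'| then (s.1 + h', s.2) else
  if `|T s h| / 4 <= `|T (s.1, s.2 + h') h'| then (s.1, s.2 + h') else
  (s.1 + h', s.2 + h').

Let sq := fix sq k := if k is k'.+1 then step k' (sq k') else (a0, c0).

Let hk k := h0 / 2 ^+ k.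

Let hk_gt0 k : 0 < hk k.
Proof. by rewrite divr_gt0// exprn_gt0. Qed.

Let hkS k : hk k.+1 = hk k / 2.
Proof. by rewrite /hk exprSr invfM mulrA. Qed.

Let sqS_bound k :
  [/\ (sq k).1 <= (sq k.+1).1, (sq k.+1).1 + hk k.+1 <= (sq k).1 + hk k,
      (sq k).2 <= (sq k.+1).2 & (sq k.+1).2 + hk k.+1 <= (sq k).2 + hk k].
Proof.
rewrite hkS /= /step -/(hk k); have := hk_gt0 k.
by do ?[case: ifP => _ /=]; split; lra.
Qed.

Let sq_bound k j : (k <= j)%N ->
  [/\ (sq k).1 <= (sq j).1, (sq j).1 + hk j <= (sq k).1 + hk k,
      (sq k).2 <= (sq j).2 & (sq j).2 + hk j <= (sq k).2 + hk k].
Proof.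
elim: j => [|j IH]; first by rewrite leqn0 => /eqP ->; split; rewrite lexx.
rewrite leq_eqVlt => /predU1P[->|]; first by split; rewrite lexx.
rewrite ltnS => /IH[A1 A2 A3 A4]; have [B1 B2 B3 B4] := sqS_bound j.
by split; [apply: le_trans A1 B1|apply: le_trans B2 A2|apply: le_trans A3 B3|apply: le_trans B4 A4].
Qed.

Let dgk k : differentiable_rect g (sq k).1 ((sq k).1 + hk k) (sq k).2 ((sq k).2 + hk k).
Proof.
have [A1 A2 A3 A4] := sq_bound (leq0n k).
move: A1 A2 A3 A4; rewrite /= {2 4}/hk expr0 divr1 => A1 A2 A3 A4.
exact: (differentiable_rectS dg).
Qed.

Let T4 s h : 0 < h -> differentiable_rect g s.1 (s.1 + h) s.2 (s.2 + h) ->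
  let h' := h / 2 in
  T s h = T s h' + T (s.1, s.2 + h') h' + (T (s.1 + h', s.2) h' + T (s.1 + h', s.2 + h') h').
Proof.
move=> h_gt0 ds h'; rewrite /T /=.
have h'E : h = h' + h' by rewrite -splitr.
have h'0 : 0 < h' by rewrite divr_gt0.
rewrite h'E [s.1 + (h' + h')]addrA [s.2 + (h' + h')]addrA -/h'.
rewrite h'E [s.1 + (h' + h')]addrA [s.2 + (h' + h')]addrA in ds.
have ds1 : differentiable_rect g s.1 (s.1 + h') s.2 (s.2 + h' + h').
  by apply: (differentiable_rectS ds); lra.
have ds2 : differentiable_rect g (s.1 + h') (s.1 + h' + h') s.2 (s.2 + h' + h').
  by apply: (differentiable_rectS ds); lra.
rewrite (rect_form_splitx ds (m := s.1 + h')); [|lra..].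
rewrite (rect_form_splity ds1 (m := s.2 + h')); [|lra..].
rewrite (rect_form_splity ds2 (m := s.2 + h')); [by []|lra..].
Qed.

Let T_sq k : `|T (sq k) (hk k)| / 4 <= `|T (sq k.+1) (hk k.+1)|.
Proof.
rewrite hkS /= /step -/(hk k).
have := T4 (hk_gt0 k) (@dgk k).
case: ifP => //= /negbT; rewrite -ltNge => L1.
case: ifP => //= /negbT; rewrite -ltNge => L2.
case: ifP => //= /negbT; rewrite -ltNge => L3 E.
rewrite leNgt; apply/negP => L4.
have : `|T (sq k) (hk k)| < `|T (sq k) (hk k)|.
  rewrite [X in `|X| < _]E.
  apply: (le_lt_trans (ler_normD _ _)).
  apply: (le_lt_trans (lerD (ler_normD _ _) (ler_normD _ _))).
  lra.
by rewrite ltxx.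
Qed.

Lemma goursat_square : rect_form g a0 (a0 + h0) c0 (c0 + h0) = 0.
Proof.
apply/eqP; apply/negPn/negP; rewrite -normr_gt0 -/(T (a0, c0) h0) => Tgt0.
set t0 := `|_| in Tgt0.
have Tk k : t0 / 4 ^+ k <= `|T (sq k) (hk k)|.
  elim: k => [|k IH]; first by rewrite expr0 divr1 /hk expr0 divr1.
  apply: le_trans (T_sq k); rewrite exprSr invfM mulrA.
  by rewrite ler_pM2r// invr_gt0.
(* The corners of the nested squares are bounded by each right, respectively upper, side, so their
   suprema are the coordinates of a point common to all squares. *)
pose A := [set (sq k).1 | k in [set: nat]].
pose B := [set (sq k).2 | k in [set: nat]].
have ubA k : ubound A ((sq k).1 + hk k).
  move=> _ [j _ <-]; have [kj|/ltnW jk] := leqP k j.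
    have [_ + _ _] := sq_bound kj; have := hk_gt0 j; lra.
  have [+ _ _ _] := sq_bound jk; have := hk_gt0 k; lra.
have ubB k : ubound B ((sq k).2 + hk k).
  move=> _ [j _ <-]; have [kj|/ltnW jk] := leqP k j.
    have [_ _ _] := sq_bound kj; have := hk_gt0 j; lra.
  have [_ _ + _] := sq_bound jk; have := hk_gt0 k; lra.
pose p := sup A +i* sup B.
have pA k : (sq k).1 <= Re p <= (sq k).1 + hk k.
  apply/andP; split.
    by apply: ub_le_sup; [exists ((sq 0).1 + hk 0); exact: ubA|exists k].
  by apply: ge_sup => //; exists (sq k).1; exists k.
have pB k : (sq k).2 <= Im p <= (sq k).2 + hk k.
  apply/andP; split.
    by apply: ub_le_sup; [exists ((sq 0).2 + hk 0); exact: ubB|exists k].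
  by apply: ge_sup => //; exists (sq k).2; exists k.
have /differentiable_nc[l Hl] : differentiable g p.
  apply: dg; have := pA 0%N; have := pB 0%N; rewrite /hk expr0 divr1//.
(* With this [e] the upper bound of [rect_form_small] at stage [k] is half of the lower bound t0 /
   4^k. *)
pose e := t0 / (16 * h0 ^+ 2).
have e0 : 0 < e by rewrite divr_gt0// mulr_gt0// exprn_gt0.
have [d d0 Hd] := Hl e e0.
have [k kd] : exists k, (2^-1 : R) ^+ k < d / (2 * h0).
  apply: expr_lt_eps; last by rewrite divr_gt0// mulr_gt0.
  by apply/andP; split; lra.
have hkd : 2 * hk k < d.
  by rewrite /hk mulrA -exprVn mulrC -ltr_pdivlMr// mulr_gt0.
have := rect_form_small (hk_gt0 k) e0 (@dgk k) Hd (pA k) (pB k) hkd.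
rewrite -/(T (sq k) (hk k)) => S1.
have eE : 8 * e * hk k ^+ 2 = t0 / 4 ^+ k / 2.
  have h00 := lt0r_neq0 h0_gt0.
  have k40 : (4 : R) ^+ k != 0 by rewrite expf_neq0// pnatr_eq0.
  have k4 : (2 ^+ k) ^+ 2 = 4 ^+ k :> R.
    by rewrite -exprM mulnC exprM; congr (_ ^+ _); rewrite expr2; ring.
  by rewrite /e /hk expr_div_n k4; field; rewrite h00 k40.
have := le_trans (Tk k) S1; rewrite eE.
have : 0 < t0 / 4 ^+ k by rewrite divr_gt0// exprn_gt0.
lra.
Qed.

End Bisection.
End Goursat.

(** * The exponential, means over circles, and the maximum principle *)

Section MaximumModulus.
Context {R : realType}.
Local Notation C := R[i].
Local Notation Re := (@complex.Re R).
Local Notation Im := (@complex.Im R).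
Local Notation nc := (@Normc.normc R).
Local Open Scope complex_scope.

Lemma is_derive_eps (f : R -> R) (x a : R) : is_derive x 1 f a ->
  forall e, 0 < e -> exists2 d : R, 0 < d &
    forall h, `|h| < d -> `|f (h + x) - f x - a * h| <= e * `|h|.
Proof.
move=> [df fa] e e0.
have : (h^-1 *: (f (h + x) - f x)) @[h --> 0^'] --> a.
  rewrite -fa /derive.
  suff -> : (fun h => h^-1 *: (f (h + x) - f x)) = (fun h => h^-1 *: ((f \o shift x) (h *: 1) - f x)) by exact: df.
  by apply/funext => h /=; rewrite [h *: 1]mulr1.
move=> /cvgrPdist_lt /(_ e e0)[d /= d0 H].
exists d => // h hd.
have [->|h0] := eqVneq h 0; first by rewrite add0r mulr0 !subrr normr0 mulr0.
have := H h; rewrite /= sub0r normrN => /(_ hd h0) /ltW K.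
have -> : f (h + x) - f x - a * h = - h * (a - h^-1 *: (f (h + x) - f x)).
  rewrite /GRing.scale/=; field; exact: h0.
by rewrite normrM normrN mulrC ler_wpM2r.
Qed.

Definition cexp (w : C) : C := (expR (Re w) * cos (Im w)) +i* (expR (Re w) * sin (Im w)).

Lemma cexpD w z : cexp (w + z) = cexp w * cexp z.
Proof.
apply/eqP; rewrite eq_complex Re_mul Im_mul /cexp/= Re_add Im_add expRD cosD sinD.
by apply/andP; split; apply/eqP; ring.
Qed.

Lemma cexp0 : cexp 0 = 1.
Proof. by rewrite /cexp/= expR0 cos0 sin0 !mul1r. Qed.

Lemma nc_cexp w : nc (cexp w) = expR (Re w).
Proof.
apply/eqP; rewrite -(eqrXn2 (n:=2))// ?normc_ge0 ?expR_ge0//.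
by rewrite nc_sqr /cexp/= !exprMn -mulrDr cos2Dsin2 mulr1.
Qed.

Lemma cexp_periodic (x y : R) : cexp (x +i* (y + pi *+ 2)) = cexp (x +i* y).
Proof. by rewrite /cexp/= cosD2pi sinD2pi. Qed.

Lemma cexp_near0 e : 0 < e -> exists2 d : R, 0 < d &
  forall h : C, nc h < d -> nc (cexp h - 1 - h) <= e * nc h.
Proof.
move=> e0.
(* Each coordinate of the error is at most 3 e' |h|, hence the total is at most 6/8 of e |h|. The
   bound |h| < e' / 2 below absorbs the one quadratic term. *)
pose e' := Num.min (e / 8) 1.
have e'0 : 0 < e' by rewrite /e' lt_min divr_gt0// ltr01.
have e'e : e' <= e / 8 by rewrite /e' ge_min lexx.
have e'1 : e' <= 1 by rewrite /e' ge_min lexx orbT.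
have [d1 d10 H1] := is_derive_eps (is_derive_expR 0) e'0.
have [d2 d20 H2] := is_derive_eps (is_derive_cos 0) e'0.
have [d3 d30 H3] := is_derive_eps (is_derive_sin 0) e'0.
exists (Num.min (Num.min d1 d2) (Num.min d3 (e' / 2))); first by rewrite !lt_min d10 d20 d30 divr_gt0.
move=> h; rewrite !lt_min => /andP[/andP[hd1 hd2] /andP[hd3 hd4]].
have Rh := Re_nc h; have Ih := Im_nc h.
have := H1 (Re h) (le_lt_trans Rh hd1); rewrite addr0 expR0 mul1r => {}H1.
have := H2 (Im h) (le_lt_trans Ih hd2); rewrite addr0 cos0 sin0 oppr0 mul0r subr0 => {}H2.
have := H3 (Im h) (le_lt_trans Ih hd3); rewrite addr0 cos0 sin0 mul1r subr0 => {}H3.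
apply: (le_trans (nc_ReIm _)); rewrite !Re_sub !Im_sub /=.
set x := Re h in H1 Rh *; set y := Im h in H2 H3 Ih *; set n := nc h in Rh Ih hd1 hd2 hd3 hd4 *.
set E := expR x in H1 *; set c := cos y in H2 *; set s := sin y in H3 *.
have n0 : 0 <= n by exact: normc_ge0.
have E1 : `|E - 1| <= e' * n + n.
  have -> : E - 1 = (E - 1 - x) + x by ring.
  apply: (le_trans (ler_normD _ _)); apply: lerD => //.
  by apply: (le_trans H1); rewrite ler_wpM2l// ltW.
have E2 : `|E| <= 2.
  have -> : E = (E - 1) + 1 by ring.
  apply: (le_trans (ler_normD _ _)); rewrite normr1.
  have : e' * n <= 1 * n by rewrite ler_wpM2r.
  lra.
have e'n (x' : R) : `|x'| <= n -> e' * `|x'| <= e' * n by move=> ?; rewrite ler_wpM2l// ltW.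
have A1 : `|E * c - 1 - x| <= 3 * e' * n.
  have -> : E * c - 1 - x = (E - 1 - x) + E * (c - 1) by ring.
  apply: (le_trans (ler_normD _ _)); rewrite normrM.
  have : `|E| * `|c - 1| <= 2 * (e' * n).
    by apply: ler_pM => //; apply: le_trans H2 _; exact: e'n.
  have := e'n _ Rh; lra.
have A2 : `|E * s - 0 - y| <= 3 * e' * n.
  have -> : E * s - 0 - y = (E - 1) * y + E * (s - y) by ring.
  apply: (le_trans (ler_normD _ _)); rewrite !normrM.
  have : `|E| * `|s - y| <= 2 * (e' * n).
    by apply: ler_pM => //; apply: le_trans H3 _; exact: e'n.
  have : `|E - 1| * `|y| <= (2 * n) * n.
    apply: ler_pM => //; apply: (le_trans E1).
    have : e' * n <= 1 * n by rewrite ler_wpM2r.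
    lra.
  have : (2 * n) * n <= e' * n by rewrite ler_wpM2r//; lra.
  lra.
apply: (le_trans (lerD A1 A2)).
have : e' * n <= e / 8 * n by rewrite ler_wpM2r.
have : 0 <= e * n by rewrite mulr_ge0// ltW.
lra.
Qed.

Lemma differentiable_cexp w : differentiable cexp w.
Proof.
apply/differentiable_nc; exists (cexp w) => e e0.
have E0 : 0 < nc (cexp w) by rewrite nc_cexp expR_gt0.
have [d d0 Hd] := cexp_near0 (divr_gt0 e0 E0).
exists d => // z zd.
have -> : cexp z - cexp w - cexp w * (z - w) = cexp w * (cexp (z - w) - 1 - (z - w)).
  rewrite -{1}(subrK w z) cexpD; ring.
rewrite ncM; apply: (le_trans (ler_wpM2l (ltW E0) (Hd _ zd))).
rewrite mulrA; have -> : nc (cexp w) * (e / nc (cexp w)) = e by field; exact: lt0r_neq0.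
exact: lexx.
Qed.

Lemma continuous_at_nc (f : C -> C) z : differentiable f z -> forall e : R, 0 < e ->
  exists2 d : R, 0 < d & forall w, nc (w - z) < d -> nc (f w - f z) < e.
Proof. by move=> /differentiable_continuous/continuous_nc. Qed.

Lemma continuous_nc_norm : continuous (@Normc.normc R : C -> R).
Proof.
move=> z; apply/(cvgrPdist_lt (F := nbhs z)) => e e0; apply/nbhs_nc; exists e => // w wz.
apply: le_lt_trans wz; rewrite ler_norml lerBrDr.
rewrite nc_distC; have := nc_le_sub z w; have := nc_le_sub w z; rewrite (nc_distC w z).
by move=> H1 H2; apply/andP; split; lra.
Qed.

Lemma compact_disc (r : R) : compact [set z : C | nc z <= r].
Proof.
pose S := [set (p.1 +i* p.2 : C) | p in (`[- r, r]%classic `*` `[- r, r]%classic : set (R * R))].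
have cS : compact S.
  apply: continuous_compact; last by apply: compact_setX; exact: segment_compact.
  apply: continuous_subspaceT => -[a b]; apply/cvg_nc => e e0.
  have e20 : 0 < e / 2 by rewrite divr_gt0.
  exists (ball a (e / 2), ball b (e / 2)); first by split; exact: nbhsx_ballx.
  move=> [x y] [/= xa yb].
  apply: (le_lt_trans (nc_ReIm ((x +i* y) - (a +i* b) : C))).
  rewrite distrC [X in _ + X]distrC.
  by move: xa yb; rewrite -!ball_normE/=; lra.
apply: subclosed_compact cS _.
  have -> : [set z : C | nc z <= r] = nc @^-1` [set x | x <= r] by [].
  by apply: preimage_closed => [x _|]; [exact: continuous_nc_norm|exact: closed_le].
move=> z /= zr; exists (Re z, Im z); last by case: (z).
by split; rewrite /= in_itv/=; have := Re_nc z; have := Im_nc z;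
  rewrite !ler_norml => /andP[? ?] /andP[? ?]; apply/andP; split; lra.
Qed.

(* Integral mean value property: [g] is [h] in logarithmic coordinates, so
   Goursat on squares of side [2 pi] compares the means over circles of radii
   [rho] and [rho * exp (- 2 pi k)]. *)
Lemma circle_mean (h : C -> C) (w u : C) (rho : R) : 0 < rho -> nc u = 1 ->
  (forall z, nc (z - w) <= rho -> differentiable h z) ->
  let g y := Re (h (w + rho%:C * u * cexp (0 +i* y))) in
  continuous_on g 0 (pi *+ 2) /\ itv_integral g 0 (pi *+ 2) = Re (h w) * (pi *+ 2).
Proof.
move=> rho0 u1 dh g.
have p0 : 0 < pi *+ 2 :> R by rewrite pmulrn_lgt0// pi_gt0.
(* The factor 'i turns the real part of [h] into the imaginary part that [rect_form] integrates
   along vertical sides. The horizontal sides cancel by periodicity. *)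
pose G W := 'i * h (w + rho%:C * u * cexp W).
have ru : nc (rho%:C * u) = rho by rewrite ncM u1 mulr1 nc_real gtr0_norm.
have dG W : Re W <= 0 -> differentiable G W.
  move=> W0; apply: differentiableM; first exact: differentiable_cst.
  apply: (@differentiable_comp _ _ _ _ (fun W => w + rho%:C * u * cexp W) h).
    apply: differentiableD; first exact: differentiable_cst.
    apply: differentiableM; first exact: differentiable_cst.
    exact: differentiable_cexp.
  apply: dh; rewrite addrC addKr ncM ru nc_cexp.
  by rewrite ger_pMr// -expR0 ler_expR.
have dGr a b c d : b <= 0 -> differentiable_rect G a b c d.
  by move=> b0 x y /andP[_ xb] _; apply: dG => /=; exact: le_trans xb b0.
have ImG x y : Im (G (x +i* y)) = Re (h (w + rho%:C * u * cexp (x +i* y))).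
  by rewrite /G Im_mul /= mul0r mul1r add0r.
pose A x := itv_integral (fun y => Im (G (x +i* y))) 0 (pi *+ 2).
have cA x : x <= 0 -> continuous_on (fun y => Im (G (x +i* y))) 0 (pi *+ 2).
  move=> x0; apply: (rect_continuous (dGr x x 0 (pi *+ 2) x0)).2.
  by rewrite lexx.
have step a : a + pi *+ 2 <= 0 -> A (a + pi *+ 2) = A a.
  move=> a0; have := goursat_square p0 (dGr a (a + pi *+ 2) 0 (0 + pi *+ 2) a0).
  have p2E : 0 + pi *+ 2 = pi *+ 2 :> R by rewrite add0r.
  have a0' : a <= 0 by apply: le_trans a0; rewrite lerDl ltW.
  have EB := itv_integralB (cA _ a0) (cA _ a0').
  rewrite /rect_form p2E EB.
  have -> : (fun x => Re (G (x +i* 0)) - Re (G (x +i* (pi *+ 2)))) = (fun=> 0 : R).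
    by apply/funext => x; rewrite /G -[in X in _ - X]p2E cexp_periodic subrr.
  rewrite itv_integral_cst; last by rewrite lerDl ltW.
  by rewrite mul0r sub0r => /eqP; rewrite oppr_eq0 subr_eq0 => /eqP.
have Ak k : A (- (pi *+ 2 *+ k)) = A 0.
  elim: k => [|k IH]; first by rewrite mulr0n oppr0.
  have kE : - (pi *+ 2 *+ k.+1) + pi *+ 2 = - (pi *+ 2 *+ k) :> R.
    by rewrite (mulrSr (pi *+ 2)); set t := pi *+ 2; ring.
  have := step (- (pi *+ 2 *+ k.+1)); rewrite kE => <-; first exact: IH.
  by rewrite oppr_le0; exact: mulrn_wge0 (ltW p0).
have gE : g = (fun y => Im (G (0 +i* y))) by apply/funext => y; rewrite ImG.
split; first by rewrite gE; exact: cA.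
rewrite gE -/(A 0); apply/eqP; rewrite -subr_eq0 -normr_le0; apply/ler_addgt0Pr => e e0.
rewrite add0r.
have e0' : 0 < e / (pi *+ 2) by rewrite divr_gt0.
have hw : differentiable h w by apply: dh; rewrite subrr Normc.normc0 ltW.
have [d d0 Hd] := continuous_at_nc hw e0'.
have [k kd] : exists k, expR (- (pi *+ 2)) ^+ k < d / rho.
  apply: expr_lt_eps; last by rewrite divr_gt0.
  by rewrite expR_ge0/= expR_lt1 oppr_lt0.
rewrite -(Ak k).
have := @itv_integral_near_cst _ (fun y => Im (G (- (pi *+ 2 *+ k) +i* y))) 0 (pi *+ 2) (Re (h w)) (e / (pi *+ 2)) (ltW p0).
rewrite subr0 divfK ?lt0r_neq0//; apply.
  by apply: cA; rewrite oppr_le0 mulrn_wge0// ltW.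
move=> y _; rewrite ImG -Re_sub; apply: (le_trans (Re_nc _)); apply/ltW/Hd.
rewrite addrC addKr ncM ru nc_cexp /= -mulNrn -mulr_natl expRM_natl.
by rewrite mulrC -ltr_pdivlMr.
Qed.

(** Let |f| be maximal at [w], with |f w| > M. The circle about [w] that touches |z| = r from inside
    contains a point where |f| <= M. So h = f / f w has Re h <= 1 on this circle and Re h < 1 on an
    arc, although its mean is Re (h w) = 1. A single circle suffices, without a connectedness
    argument. *)
Theorem maximum_modulus (f : C -> C) (r M : R) :
  (forall z, nc z <= r -> differentiable f z) ->
  (forall z, nc z = r -> nc (f z) <= M) ->
  forall z, nc z <= r -> nc (f z) <= M.
Proof.
move=> df fM z0 z0r; rewrite leNgt; apply/negP => Mz0.
have r_ge0 : 0 <= r by exact: le_trans (normc_ge0 z0) z0r.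
have M0 : 0 <= M.
  by apply: le_trans (fM r%:C _); [exact: normc_ge0|rewrite nc_real ger0_norm].
have [w] : exists2 w, w \in [set z : C | nc z <= r] &
    forall t, t \in [set z : C | nc z <= r] -> nc (f t) <= nc (f w).
  apply: (@compact_EVT_max C R (fun z => nc (f z))); first by exists z0.
    exact: compact_disc.
  apply: continuous_in_subspaceT => z; rewrite inE/= => zr.
  apply: (@continuous_comp _ _ _ f nc); last exact: continuous_nc_norm.
  exact/differentiable_continuous/df.
rewrite inE/= => wr wmax.
have Mw : M < nc (f w) by apply: lt_le_trans Mz0 _; apply: wmax; rewrite inE.
have wr' : nc w < r.
  rewrite lt_neqAle wr andbT; apply/eqP => /fM; rewrite leNgt; by rewrite Mw.
have aw0 : 0 < nc (f w) by exact: le_lt_trans Mw.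
have fw0 : f w != 0 by rewrite -nc_gt0.
pose h z := f z / f w.
(* This circle meets |z| = r at w + rho u, with [u] the direction of [w]; the angle is measured from
   there. *)
pose rho := r - nc w.
have rho0 : 0 < rho by rewrite subr_gt0.
have in_r z : nc (z - w) <= rho -> nc z <= r.
  by move=> H; rewrite -(subrK w z); apply: (le_trans (ncD _ _)); move: H; rewrite /rho; lra.
have dh z : nc (z - w) <= rho -> differentiable h z.
  move=> /in_r zr; apply: differentiableM; [exact: df|exact: differentiable_cst].
have h1 z : nc z <= r -> nc (h z) <= 1.
  move=> zr; rewrite /h ncM Normc.normcV ler_pdivrMr// mul1r; apply: wmax.
  by rewrite inE.
have [u u1 uw] : exists2 u : C, nc u = 1 & w = (nc w)%:C * u.
  have [->|w0] := eqVneq w 0; first by exists 1; [exact: Normc.normc1|rewrite Normc.normc0 mul0r].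
  have nw0 : 0 < nc w by rewrite nc_gt0.
  exists (w / (nc w)%:C).
    by rewrite ncM Normc.normcV nc_real gtr0_norm// divff// lt0r_neq0.
  rewrite mulrC divfK//; apply/eqP => /complexI/eqP.
  by rewrite gt_eqF.
have [cg] := circle_mean rho0 u1 dh; set g := fun y => _ in cg *.
have p0 : 0 < pi *+ 2 :> R by rewrite pmulrn_lgt0// pi_gt0.
rewrite /h divff// mul1r => Ig.
have ru : nc (rho%:C * u) = rho by rewrite ncM u1 mulr1 nc_real gtr0_norm.
have g1 y : g y <= 1.
  apply: (le_trans (Re_le_nc _)); apply: h1; apply: in_r.
  by rewrite addrC addKr ncM ru nc_cexp /= expR0 mulr1.
have g0 : g 0 <= M / nc (f w).
  apply: (le_trans (Re_le_nc _)); rewrite /h ncM Normc.normcV ler_pM2r ?invr_gt0//.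
  apply: fM; rewrite cexp0 mulr1 {1}uw -mulrDl -rmorphD ncM u1 mulr1 nc_real.
  by rewrite /rho addrC subrK ger0_norm.
pose m := (M / nc (f w) + 1) / 2.
have Ma1 : M / nc (f w) < 1 by rewrite ltr_pdivrMr// mul1r.
have gm : g 0 < m by rewrite /m; lra.
have m1 : m < 1 by rewrite /m; lra.
have : {for 0, continuous g} by apply: cg; rewrite lexx ltW.
move=> /cvgrPdist_lt /(_ (m - g 0)); rewrite subr_gt0 => /(_ gm) [d /= d0 Hd].
pose s := Num.min (d / 2) (pi *+ 2).
have s0 : 0 < s by rewrite lt_min divr_gt0.
have sp : s <= pi *+ 2 by rewrite /s ge_min lexx orbT.
have sd : s <= d / 2 by rewrite /s ge_min lexx.
have gs y : 0 <= y <= s -> g y <= m.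
  move=> /andP[y0 ys]; have := Hd y; rewrite /= sub0r normrN ger0_norm//.
  have yd : y < d by lra.
  move=> /(_ yd); rewrite distrC => H.
  have := ler_norm (g y - g 0); lra.
have I1 : itv_integral g 0 s <= m * s.
  have <- : itv_integral (fun=> m) 0 s = m * s by rewrite itv_integral_cst ?subr0 ?ltW.
  by apply: le_itv_integral => //; [exact: (continuous_onS cg)|exact: continuous_on_cst].
have I2 : itv_integral g s (pi *+ 2) <= 1 * (pi *+ 2 - s).
  rewrite -itv_integral_cst//.
  apply: le_itv_integral; [exact: (continuous_onS cg (ltW s0) (lexx _))|exact: continuous_on_cst|].
  by move=> y _; exact: g1.
have := itv_integral_split cg (ltW s0) sp; rewrite Ig => E.
have : m * s < 1 * s by rewrite ltr_pM2r.
lra.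
Qed.

End MaximumModulus.

(** * Removable singularities, the Schwarz and Schwarz-Pick lemmas, and a minimum principle for real
    parts *)

Section Schwarz.
Context {R : realType}.
Local Notation C := R[i].
Local Notation Re := (@complex.Re R).
Local Notation Im := (@complex.Im R).
Local Notation nc := (@Normc.normc R).
Local Open Scope complex_scope.

Lemma differentiable_local (f g : C -> C) (z : C) (d : R) : 0 < d ->
  (forall w, nc (w - z) < d -> f w = g w) -> differentiable f z -> differentiable g z.
Proof.
move=> d0 fg /differentiable_nc[a H]; apply/differentiable_nc; exists a => e e0.
have [d' d'0 Hd] := H e e0.
exists (Num.min d d'); first by rewrite lt_min d0.
move=> w; rewrite lt_min => /andP[wd wd']; rewrite -!fg ?subrr ?Normc.normc0//.
exact: Hd.
Qed.

Definition cont_at (f : C -> C) (z : C) := forall e : R, 0 < e ->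
  exists2 d : R, 0 < d & forall w, nc (w - z) < d -> nc (f w - f z) < e.

Lemma cont_atP (f : C -> C) z : {for z, continuous f} <-> cont_at f z.
Proof. exact: continuous_nc. Qed.

Lemma differentiable_cont_at (f : C -> C) z : differentiable f z -> cont_at f z.
Proof. by move=> /differentiable_continuous/cont_atP. Qed.

Lemma cont_at_cst (c z : C) : cont_at (fun=> c) z.
Proof. by move=> e e0; exists 1 => // w _; rewrite subrr Normc.normc0. Qed.

Lemma cont_atB (f g : C -> C) z : cont_at f z -> cont_at g z ->
  cont_at (fun w => f w - g w) z.
Proof. by move=> /cont_atP cf /cont_atP cg; apply/cont_atP; exact: (continuousB cf cg). Qed.

Lemma cont_atM (f g : C -> C) z : cont_at f z -> cont_at g z ->
  cont_at (fun w => f w * g w) z.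
Proof. by move=> /cont_atP cf /cont_atP cg; apply/cont_atP; exact: (continuousM cf cg). Qed.

Lemma cont_at_comp (f g : C -> C) z : cont_at f z -> cont_at g (f z) ->
  cont_at (fun w => g (f w)) z.
Proof.
move=> cf cg e /cg[d d0 Hd]; have [d' d'0 Hd'] := cf d d0.
by exists d' => // w /Hd'/Hd.
Qed.

Lemma cont_at_local (f g : C -> C) (z : C) (d : R) : 0 < d ->
  (forall w, nc (w - z) < d -> f w = g w) ->
  cont_at f z -> cont_at g z.
Proof.
move=> d0 fg H e /H[d' d'0 Hd].
exists (Num.min d d'); first by rewrite lt_min d0.
move=> w; rewrite lt_min => /andP[wd wd']; rewrite -!fg ?subrr ?Normc.normc0//.
exact: Hd.
Qed.

(** The difference quotient at [s] is [G] itself, so continuity of [G] is enough. *)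
Lemma differentiable_mul_sub (G : C -> C) (s : C) : cont_at G s ->
  differentiable (fun z => (z - s) * G z) s.
Proof.
move=> H; apply/differentiable_nc; exists (G s) => e /H[d d0 Hd].
exists d => // w wd; rewrite subrr mul0r subr0 mulrC -mulrBl ncM ler_wpM2r ?normc_ge0//.
exact/ltW/Hd.
Qed.

Lemma differentiable_id (z : C) : differentiable (fun w : C => w) z.
Proof. by apply/derivable1_diffP; exact: derivable_id. Qed.

Lemma differentiable_sub (s z : C) : differentiable (fun w : C => w - s) z.
Proof. by apply: differentiableB; [exact: differentiable_id|exact: differentiable_cst]. Qed.

Lemma differentiable_prod (I : Type) (r : seq I) (F : I -> C -> C) (z : C) :
  (forall i, differentiable (F i) z) ->
  differentiable (fun w => \prod_(i <- r) F i w) z.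
Proof.
move=> dF; elim: r => [|i r IH].
  under eq_fun do rewrite big_nil; exact: differentiable_cst.
under eq_fun do rewrite big_cons; exact: differentiableM.
Qed.

Lemma differentiable_exp (f : C -> C) (N : nat) (z : C) : differentiable f z ->
  differentiable (fun w => f w ^+ N) z.
Proof.
move=> df; elim: N => [|N IH].
  under eq_fun do rewrite expr0; exact: differentiable_cst.
under eq_fun do rewrite exprS; exact: differentiableM.
Qed.

Lemma continuous_exp (f : C -> C) (N : nat) (z : C) : cont_at f z ->
  cont_at (fun w => f w ^+ N) z.
Proof.
move=> cf; apply: (@cont_at_comp f (fun w => w ^+ N) z cf).
exact: differentiable_cont_at (differentiable_exp N (differentiable_id _)).
Qed.

Lemma differentiable_quot (f g : C -> C) (z : C) : differentiable f z ->
  differentiable g z -> g z != 0 -> differentiable (fun w => f w / g w) z.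
Proof. by move=> df dg g0; exact: (differentiableM df (differentiableV dg g0)). Qed.

Lemma exists_notin (S : seq C) (z : C) (d : R) : 0 < d ->
  exists2 w, w \notin S & nc (w - z) < d.
Proof.
move=> d0; apply: contrapT => H.
have inS w : nc (w - z) < d -> w \in S.
  by move=> wd; apply: contrapT => /negP wS; apply: H; exists w.
pose p (k : nat) : C := z + (d / k.+2%:R)%:C.
have pd k : nc (p k - z) < d.
  rewrite /p addrC addKr nc_real ger0_norm ?divr_ge0 ?ltW//.
  by rewrite ltr_pdivrMr// ltr_pMr// ltr1n.
have : (size (map p (iota 0 (size S).+1)) <= size S)%N.
  apply: uniq_leq_size; last by move=> w /mapP[k _ ->]; exact: inS.
  rewrite map_inj_uniq ?iota_uniq// => i j; rewrite /p => /addrI/complexI.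
  by move=> /(mulfI (lt0r_neq0 d0))/invr_inj/eqP; rewrite eqr_nat => /eqP[].
by rewrite size_map size_iota ltnn.
Qed.

(** Let P be the product of the z - s over [S]. Then P f^N is differentiable even on [S], and the
    maximum principle gives |P z| |f z|^N <= K M^N with [K] independent of N. As N grows this forces
    |f z| <= M wherever P z is not 0; the points of [S] follow by continuity. *)
Lemma maximum_modulus_except (S : seq C) (f : C -> C) (r M : R) :
  (forall z, nc z <= r -> cont_at f z) ->
  (forall z, nc z <= r -> z \notin S -> differentiable f z) ->
  (forall z, nc z = r -> nc (f z) <= M) ->
  forall z, nc z <= r -> nc (f z) <= M.
Proof.
move=> cf df fM.
have off z : nc z <= r -> z \notin S -> nc (f z) <= M.
  move=> zr zS; rewrite leNgt; apply/negP => Mfz.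
  have r0 : 0 <= r by exact: le_trans (normc_ge0 z) zr.
  have M0 : 0 <= M.
    by apply: le_trans (fM r%:C _); [exact: normc_ge0|rewrite nc_real ger0_norm].
  pose P w := \prod_(s <- S) (w - s).
  pose K := \prod_(s <- S) (r + nc s).
  have fz0 : 0 < nc (f z) by exact: le_lt_trans Mfz.
  have Pz0 : 0 < nc (P z).
    rewrite nc_gt0 /P prodf_seq_neq0; apply/allP => s sS; rewrite subr_eq0/=.
    by apply: contra zS => /eqP ->.
  have bound N : nc (P z) * nc (f z) ^+ N <= K * M ^+ N.
    pose F w := P w * f w ^+ N.
    have := @maximum_modulus R F r (K * M ^+ N).
    rewrite -ncX -ncM -/(F z) => H; apply: H; [move=> w wr|move=> w wr|exact: zr].
      have [wS|wS] := boolP (w \in S); last first.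
        apply: differentiableM; last exact/differentiable_exp/df.
        apply: (@differentiable_prod _ _ (fun s w => w - s)) => s.
        exact: differentiable_sub.
      have FE x : (x - w) * (\prod_(s <- rem w S) (x - s) * f x ^+ N) = F x.
        by rewrite mulrA /F /P (big_rem w wS).
      have -> : F = fun x => (x - w) * (\prod_(s <- rem w S) (x - s) * f x ^+ N).
        by apply/funext => x; rewrite FE.
      apply: differentiable_mul_sub; apply: cont_atM; last exact/continuous_exp/cf.
      apply: differentiable_cont_at.
      apply: (@differentiable_prod _ _ (fun s w => w - s)) => s.
      exact: differentiable_sub.
    rewrite /F ncM ncX; apply: ler_pM; rewrite ?normc_ge0 ?exprn_ge0 ?normc_ge0//.
      rewrite /P /K nc_prod; apply: ler_prod => s _; rewrite normc_ge0/=.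
      by apply: (le_trans (ncB _ _)); rewrite wr.
    by apply: lerXn2r; rewrite ?nnegrE ?normc_ge0// fM.
  have K0 : 0 < K.
    have := bound 0%N; rewrite !expr0 !mulr1; exact: lt_le_trans.
  have [N] : exists N, (M / nc (f z)) ^+ N < nc (P z) / K.
    apply: expr_lt_eps; last by rewrite divr_gt0.
    by rewrite divr_ge0 ?normc_ge0//= ltr_pdivrMr// mul1r.
  rewrite expr_div_n ltr_pdivrMr ?exprn_gt0// mulrAC ltr_pdivlMr// mulrC ltNge.
  by rewrite bound.
move=> z zr; have [zS|] := boolP (z \in S); last exact: off.
have [zr'|zr'] := eqVneq (nc z) r; first exact: fM.
have {zr'}zr' : nc z < r by rewrite lt_neqAle zr'.
apply/ler_addgt0Pr => e e0.
have [d d0 Hd] := cf z zr e e0.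
have [w wS] : exists2 w, w \notin S & nc (w - z) < Num.min d (r - nc z).
  by apply: exists_notin; rewrite lt_min d0 subr_gt0.
rewrite lt_min => /andP[wd wr].
have wr' : nc w <= r.
  by rewrite -(subrK z w); apply: (le_trans (ncD _ _)); move: wr; lra.
have := off w wr' wS; have := Hd w wd; have := nc_le_sub (f z) (f w).
rewrite nc_distC; lra.
Qed.

Lemma bounded_on_disc (f : C -> C) (r : R) :
  (forall z, nc z <= r -> cont_at f z) -> 0 <= r ->
  exists2 M : R, 0 <= M & forall z, nc z <= r -> nc (f z) <= M.
Proof.
move=> cf r0.
have [w] : exists2 w, w \in [set z : C | nc z <= r] &
    forall t, t \in [set z : C | nc z <= r] -> nc (f t) <= nc (f w).
  apply: (@compact_EVT_max C R (fun z => nc (f z))).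
  - by exists 0; rewrite /mkset Normc.normc0.
  - exact: compact_disc.
  - apply: continuous_in_subspaceT => z; rewrite inE/= => zr.
    apply: (@continuous_comp _ _ _ f nc); last exact: continuous_nc_norm.
    exact/cont_atP/cf.
move=> _ wmax; exists (nc (f w)); first exact: normc_ge0.
by move=> z zr; apply: wmax; rewrite inE.
Qed.

(** The derivative on the diagonal makes the quotient continuous there. If f 0 = 0, then [slope f 0]
    is f z / z, with the derivative as its value at 0. *)
Definition slope (q : C -> C) (w z : C) : C :=
  if z == w then derive1 q w else (q z - q w) / (z - w).

Lemma derive1_cvg (q : C -> C) (w : C) : differentiable q w ->
  forall e, 0 < e -> exists2 d : R, 0 < d &
    forall z, nc (z - w) < d -> z != w -> nc ((q z - q w) / (z - w) - derive1 q w) < e.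
Proof.
move=> /derivable1_diffP dq e e0.
have : (h^-1 *: (q (h + w) - q w)) @[h --> 0^'] --> derive1 q w.
  move: dq; rewrite /derivable /derive1.
  rewrite (_ : (fun h => h^-1 *: ((q \o shift w) (h *: 1) - q w)) = (fun h => h^-1 *: (q (h + w) - q w)))//.
  by apply/funext => h /=; rewrite [h *: 1]mulr1.
move=> /cvg_nc /(_ e e0) /nbhs_nc[d d0 H].
exists d => // z zd zw.
have := H (z - w); rewrite subr0 subr_eq0 => /(_ zd zw).
by rewrite subrK scaleC [_ * (q z - q w)]mulrC.
Qed.

Lemma continuous_slope (q : C -> C) (w z : C) : cont_at q z ->
  differentiable q w -> cont_at (slope q w) z.
Proof.
move=> cq dq; have [->|zw] := eqVneq z w.
  move=> e e0; have [d d0 Hd] := derive1_cvg dq e0.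
  exists d => // x xd; rewrite {2}/slope eqxx /slope.
  by case: eqVneq => [_|xw]; [rewrite subrr Normc.normc0|exact: Hd].
have zw0 : 0 < nc (z - w) by rewrite nc_gt0 subr_eq0.
apply: (@cont_at_local (fun x => (q x - q w) / (x - w)) _ z (nc (z - w))).
- by [].
- move=> x xz; rewrite /slope; case: eqVneq => // xw.
  by move: xz; rewrite xw nc_distC ltxx.
- apply: cont_atM; first by apply: cont_atB => //; exact: cont_at_cst.
  apply: differentiable_cont_at; apply: differentiableV; last by rewrite subr_eq0.
  exact: differentiable_sub.
Qed.

Lemma differentiable_slope (q : C -> C) (w z : C) : differentiable q z ->
  z != w -> differentiable (slope q w) z.
Proof.
move=> dq zw.
have zw0 : 0 < nc (z - w) by rewrite nc_gt0 subr_eq0.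
apply: (@differentiable_local (fun x => (q x - q w) / (x - w)) _ z (nc (z - w))).
- by [].
- move=> x xz; rewrite /slope; case: eqVneq => // xw.
  by move: xz; rewrite xw nc_distC ltxx.
- apply: differentiable_quot; last by rewrite subr_eq0.
    by apply: differentiableB; [exact: dq|exact: differentiable_cst].
  exact: differentiable_sub.
Qed.

(* Riemann's theorem. By the maximum principle the difference quotients of [q]
   at two points [w], [w'] off the singularity differ by O(|w - w'|) on the
   whole disc, in particular at 0. *)
Theorem removable_singularity (q : C -> C) :
  (forall z, nc z < 1 -> cont_at q z) ->
  (forall z, nc z < 1 -> z != 0 -> differentiable q z) ->
  differentiable q 0.
Proof.
move=> cq dq.
have half1 z : nc z <= 2^-1 -> nc z < 1 by move=> H; apply: le_lt_trans H _; lra.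
have [M M0 qM] : exists2 M, 0 <= M & forall z, nc z <= 2^-1 -> nc (q z) <= M.
  by apply: bounded_on_disc => [z /half1/cq|] //; lra.
pose small w := (0 < nc w) /\ (nc w < 4^-1).
have sm1 w : small w -> nc w < 1 by move=> [_ ?]; lra.
have smd w : small w -> differentiable q w.
  by move=> sw; apply: dq; [exact: sm1|rewrite -nc_gt0; case: sw].
have far w z : small w -> nc z = 2^-1 -> 4^-1 <= nc (z - w).
  by move=> [_ w4] z2; have := nc_le_sub z w; lra.
have far_neq w z : small w -> nc z = 2^-1 -> z != w.
  move=> sw z2; have := far w z sw z2; rewrite -subr_eq0 -nc_gt0.
  by apply: lt_le_trans; lra.
have lip w z : small w -> nc z <= 2^-1 -> nc (q z - q w) <= (8 * M) * nc (z - w).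
  move=> sw z2.
  have := @maximum_modulus_except [:: 0; w] (slope q w) 2^-1 (8 * M).
  move=> /(_ _ _ _ z z2) H.
  have [->|zw] := eqVneq z w; first by rewrite !subrr Normc.normc0 mulr0.
  have zw0 : 0 < nc (z - w) by rewrite nc_gt0 subr_eq0.
  rewrite -ler_pdivrMr// -Normc.normcV -ncM.
  suff : nc (slope q w z) <= 8 * M by rewrite /slope (negbTE zw).
  apply: H.
  - by move=> x /half1 x1; apply: continuous_slope; [exact: cq|exact: smd].
  - move=> x /half1 x1; rewrite !inE negb_or => /andP[x0 xw].
    exact: differentiable_slope (dq x x1 x0) xw.
  - move=> x x2; rewrite /slope (negbTE (far_neq _ _ sw x2)) ncM Normc.normcV.
    have f4 := far _ _ sw x2.
    rewrite ler_pdivrMr; last by apply: lt_le_trans f4; lra.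
    apply: (le_trans (ncB _ _)).
    have := qM x; rewrite x2 lexx => /(_ isT) qx.
    have := qM w; have [_ w4] := sw => /(_ _) qw.
    have {}qw : nc (q w) <= M by apply: qw; lra.
    have : 8 * M * 4^-1 <= 8 * M * nc (x - w) by rewrite ler_wpM2l// mulr_ge0.
    lra.
(* On |x| = 1/2 the difference of the two quotients has a denominator of modulus at least 1/16 and a
   numerator of modulus at most (2 M + 8 M) |w - w'|. *)
pose K := 16 * (2 * M + 8 * M).
have K0 : 0 <= K by rewrite /K; lra.
pose D w := slope q w 0.
have DE w : small w -> D w = (q w - q 0) / w.
  move=> [w0 _]; rewrite nc_gt0 in w0.
  by rewrite /D /slope eq_sym (negbTE w0) sub0r -opprB invrN mulrNN.
have Dlip w w' : small w -> small w' -> nc (D w - D w') <= K * nc (w - w').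
  move=> sw sw'.
  have := @maximum_modulus_except [:: 0; w; w'] (fun z => slope q w z - slope q w' z) 2^-1 (K * nc (w - w')).
  apply; last by rewrite Normc.normc0; lra.
  - move=> x /half1 x1; apply: cont_atB.
      by apply: continuous_slope; [exact: cq|exact: smd].
    by apply: continuous_slope; [exact: cq|exact: smd].
  - move=> x /half1 x1; rewrite !inE !negb_or => /and3P[x0 xw xw'].
    by apply: differentiableB; apply: differentiable_slope; [exact: (dq x x1 x0)|exact: xw|exact: (dq x x1 x0)|exact: xw'].
  - move=> x x2; rewrite /slope (negbTE (far_neq _ _ sw x2)) (negbTE (far_neq _ _ sw' x2)).
    have xw := far_neq _ _ sw x2; have xw' := far_neq _ _ sw' x2.
    rewrite -subr_eq0 in xw; rewrite -subr_eq0 in xw'.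
    have -> : (q x - q w) / (x - w) - (q x - q w') / (x - w') =
      ((q x - q w) * (w - w') - (q w - q w') * (x - w)) / ((x - w) * (x - w')).
      by field; rewrite xw xw'.
    have f4 := far _ _ sw x2; have f4' := far _ _ sw' x2.
    rewrite ncM Normc.normcV ncM.
    rewrite ler_pdivrMr; last by rewrite mulr_gt0// ?nc_gt0.
    apply: (le_trans (ncB _ _)); rewrite !ncM.
    have qx : nc (q x) <= M by apply: qM; rewrite x2.
    have qw : nc (q w) <= M by apply: qM; case: sw; lra.
    have B1 : nc (q x - q w) <= 2 * M by apply: (le_trans (ncB _ _)); lra.
    have B2 : nc (q w - q w') <= 8 * M * nc (w - w') by apply: lip => //; case: sw; lra.
    have B3 : nc (x - w) <= 1.
      by apply: (le_trans (ncB _ _)); case: sw; rewrite x2; lra.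
    have n0 := normc_ge0 (w - w').
    have C1 : nc (q x - q w) * nc (w - w') <= 2 * M * nc (w - w') by rewrite ler_wpM2r.
    have C2 : nc (q w - q w') * nc (x - w) <= 8 * M * nc (w - w') * 1.
      by apply: ler_pM => //; exact: normc_ge0.
    have C3 : 4^-1 * 4^-1 <= nc (x - w) * nc (x - w') by apply: ler_pM => //; lra.
    have C4 : K * nc (w - w') * (4^-1 * 4^-1) <= K * nc (w - w') * (nc (x - w) * nc (x - w')).
      by rewrite ler_wpM2l// mulr_ge0.
    apply: le_trans C4; rewrite /K; lra.
have Dbnd w : small w -> nc (D w) <= 8 * M.
  move=> sw; rewrite DE// ncM Normc.normcV; have [w0 w4] := sw.
  rewrite ler_pdivrMr//; have := lip w 0 sw; rewrite Normc.normc0 sub0r ncN nc_distC.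
  by apply; lra.
have Fsmall : (0 : C)^' [set w | small w].
  apply/nbhs_nc; exists 4^-1; first by lra.
  by move=> w; rewrite subr0 => w4 w0; split=> //; rewrite nc_gt0.
(* Boundedness of the quotient [D] gives a cluster value at 0, and the Lipschitz estimate turns it
   into a limit. *)
have [l [_ clus]] : [set z : C | nc z <= 8 * M] `&` cluster (D @ (0 : C)^') !=set0.
  apply: (@compact_disc R (8 * M) (D @ (0 : C)^')).
  by apply: filterS Fsmall => w; exact: Dbnd.
have Dl w : small w -> nc (D w - l) <= K * nc w.
  move=> sw; apply/ler_addgt0Pr => e e0.
  pose e1 := e / (K + 1).
  have e10 : 0 < e1 by rewrite divr_gt0//; lra.
  have e1E : K * e1 + e1 = e by rewrite /e1; field; lra.
  have A1 : (D @ (0 : C)^') (D @` [set w | small w /\ nc w < e1]).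
    apply: (@filterS _ (0 : C)^' _ [set w | small w /\ nc w < e1]).
      by move=> x Hx; exists x.
    apply: filterI => //; apply/nbhs_nc; exists e1 => // x; rewrite subr0.
    by move=> ? _.
  have A2 : nbhs l [set z | nc (z - l) < e1] by apply/nbhs_nc; exists e1.
  have [_ [[w' [sw' w'e] <-] /= H]] := clus _ _ A1 A2.
  have := Dlip w w' sw sw'.
  have -> : D w - l = (D w - D w') + (D w' - l) by ring.
  move=> H1; apply: (le_trans (ncD _ _)).
  have := ncB w w' => H2.
  have : K * nc (w - w') <= K * (nc w + e1) by rewrite ler_wpM2l//; lra.
  lra.
apply/differentiable_nc; exists l => e e0.
exists (Num.min 4^-1 (e / (K + 1))).
  by rewrite lt_min divr_gt0 ?andbT//; lra.
move=> w; rewrite subr0 lt_min => /andP[w4 we].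
have [->|w0] := eqVneq w 0; first by rewrite subrr mulr0 subrr Normc.normc0 mulr0.
have sw : small w by split=> //; rewrite nc_gt0.
have -> : q w - q 0 - l * w = (D w - l) * w.
  by rewrite DE// mulrBl divfK.
rewrite ncM ler_wpM2r ?normc_ge0//; apply: (le_trans (Dl w sw)).
move: we; rewrite ltr_pdivlMr; last by lra.
have := normc_ge0 w; lra.
Qed.

Lemma slope0 (f : C -> C) z : f 0 = 0 -> f z = z * slope f 0 z.
Proof.
rewrite /slope => f0; case: eqVneq => [->|z0]; first by rewrite f0 mul0r.
by rewrite f0 !subr0 mulrC divfK.
Qed.

Lemma differentiable_slope0 (f : C -> C) : (forall z, nc z < 1 -> differentiable f z) ->
  forall z, nc z < 1 -> differentiable (slope f 0) z.
Proof.
move=> df z z1; have d0 : differentiable f 0 by apply: df; rewrite Normc.normc0.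
have [->|z0] := eqVneq z 0; last exact: differentiable_slope (df z z1) z0.
apply: removable_singularity => w w1.
  by apply: continuous_slope d0; apply/differentiable_cont_at/df.
by move=> w0; exact: differentiable_slope (df w w1) w0.
Qed.

Lemma le_of_mul_lt1 (x y : R) (t : R) : 0 <= t < 1 ->
  (forall r, t < r < 1 -> r * x <= y) -> x <= y.
Proof.
move=> /andP[t0 t1] H; rewrite leNgt; apply/negP => yx.
have [y0|y0] := ltP y 0.
  have := H ((t + 1) / 2); have : t < (t + 1) / 2 < 1 by apply/andP; split; lra.
  move=> -> /(_ isT) H1.
  have x0 : x < 0.
    rewrite ltNge; apply/negP => x0.
    have : 0 <= (t + 1) / 2 * x by rewrite mulr_ge0//; lra.
    lra.
  have : x * 1 <= x * ((t + 1) / 2) by rewrite ler_wnM2l//; lra.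
  by rewrite mulr1 mulrC; lra.
have x0 : 0 < x by exact: le_lt_trans yx.
pose r := (Num.max t (y / x) + 1) / 2.
have yx1 : y / x < 1 by rewrite ltr_pdivrMr// mul1r.
have m1 : Num.max t (y / x) < 1 by rewrite gt_max t1.
have tm : t <= Num.max t (y / x) by rewrite le_max lexx.
have ym : y / x <= Num.max t (y / x) by rewrite le_max lexx orbT.
have : t < r < 1 by apply/andP; split; rewrite /r; lra.
move=> /H; rewrite leNgt -ltr_pdivrMr//.
have -> : y / x < r by rewrite /r; lra.
by [].
Qed.

(** The maximum principle for [slope f 0] on |z| = r gives the bound M / r, and r tends to 1. At z =
    0 the conclusion bounds the derivative. *)
Theorem schwarz (f : C -> C) (M : R) :
  (forall z, nc z < 1 -> differentiable f z) ->
  (forall z, nc z < 1 -> nc (f z) <= M) -> f 0 = 0 ->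
  forall z, nc z < 1 -> nc (slope f 0 z) <= M.
Proof.
move=> df fM f0 z z1; have dq := differentiable_slope0 df.
apply: (@le_of_mul_lt1 _ _ (nc z)); first by rewrite normc_ge0.
move=> r /andP[zr r1].
have r0 : 0 < r by exact: le_lt_trans (normc_ge0 z) zr.
rewrite -ler_pdivlMl// mulrC.
apply: (@maximum_modulus _ (slope f 0) r) => //; last exact: ltW.
  by move=> w wr; apply: dq; exact: le_lt_trans r1.
move=> w wr; have w0 : w != 0 by rewrite -nc_gt0 wr.
rewrite /slope (negbTE w0) f0 !subr0 ncM Normc.normcV wr ler_pM2r ?invr_gt0//.
by apply: fM; rewrite wr.
Qed.

Lemma schwarz_norm (f : C -> C) (M : R) :
  (forall z, nc z < 1 -> differentiable f z) ->
  (forall z, nc z < 1 -> nc (f z) <= M) -> f 0 = 0 ->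
  forall z, nc z < 1 -> nc (f z) <= M * nc z.
Proof.
move=> df fM f0 z z1; rewrite (slope0 z f0) ncM mulrC ler_wpM2r ?normc_ge0//.
exact: schwarz.
Qed.

Lemma moebius_identity (a b : C) :
  nc (1 - conjc a * b) ^+ 2 = nc (b - a) ^+ 2 + (1 - nc a ^+ 2) * (1 - nc b ^+ 2).
Proof.
case: a b => [x y] [s t]; rewrite !nc_sqr /=; ring.
Qed.

Lemma moebius_denom_neq0 (a b : C) : nc a <= 1 -> nc b < 1 -> 1 - conjc a * b != 0.
Proof.
move=> a1 b1; rewrite subr_eq0 eq_sym; apply/eqP => E.
have := congr1 nc E; rewrite ncM ncJ Normc.normc1 => E1.
have : nc a * nc b <= 1 * nc b by rewrite ler_wpM2r ?normc_ge0.
by rewrite E1 mul1r leNgt b1.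
Qed.

Lemma moebius_lt1 (a b : C) : nc a < 1 -> nc b < 1 -> nc ((b - a) / (1 - conjc a * b)) < 1.
Proof.
move=> a1 b1; have D0 := moebius_denom_neq0 (ltW a1) b1.
rewrite ncM Normc.normcV ltr_pdivrMr ?nc_gt0// mul1r.
rewrite -(ltr_pXn2r (n := 2))// ?nnegrE ?normc_ge0// moebius_identity ltrDl.
by rewrite mulr_gt0// subr_gt0 expr_lt1// normc_ge0.
Qed.

Lemma schwarz_pick_lt (h : C -> C) (a z : C) :
  (forall z, nc z < 1 -> differentiable h z) ->
  (forall z, nc z < 1 -> nc (h z) < 1) -> nc a < 1 -> nc z < 1 ->
  nc (h z - h a) * nc (1 - conjc a * z) <= nc (z - a) * nc (1 - conjc (h a) * h z).
Proof.
move=> dh h1 a1 z1.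
(* [m] is the automorphism of the disc taking 0 to [a], and [psi] follows h o m by the automorphism
   taking h a to 0. Schwarz is applied to [psi] at [t], the preimage of [z]. *)
pose m w := (w - (- a)) / (1 - conjc (- a) * w).
have na1 : nc (- a) < 1 by rewrite ncN.
have m1 w : nc w < 1 -> nc (m w) < 1 by move=> w1; exact: moebius_lt1.
pose psi w := (h (m w) - h a) / (1 - conjc (h a) * h (m w)).
have m0 : m 0 = a by rewrite /m sub0r mulr0 subr0 divr1 opprK.
pose t := (z - a) / (1 - conjc a * z).
have t1 : nc t < 1 by exact: moebius_lt1.
have D0 := moebius_denom_neq0 (ltW a1) z1.
have Daa : 1 - conjc a * a != 0 by exact: moebius_denom_neq0 (ltW a1) a1.
have mt : m t = z.
  rewrite /m /t conjcN opprK mulNr opprK.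
  have E2 : 1 + conjc a * ((z - a) / (1 - conjc a * z)) != 0.
    have -> : 1 + conjc a * ((z - a) / (1 - conjc a * z)) = (1 - conjc a * a) / (1 - conjc a * z).
      by field.
    by rewrite mulf_neq0// invr_eq0.
  apply: (mulIf E2); rewrite divfK//; field; exact: D0.
have dm w : nc w < 1 -> differentiable m w.
  move=> w1; apply: differentiable_quot; first exact: differentiable_sub.
    apply: differentiableB; first exact: differentiable_cst.
    by apply: differentiableM; [exact: differentiable_cst|exact: differentiable_id].
  exact: moebius_denom_neq0 (ltW na1) w1.
have dhm w : nc w < 1 -> differentiable (fun w => h (m w)) w.
  move=> w1; apply: (@differentiable_comp _ _ _ _ m h); first exact: dm.
  exact/dh/m1.
have := @schwarz_norm psi 1.
move=> /(_ _ _ _ t t1); rewrite mul1r => H.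
have {}H : nc (psi t) <= nc t.
  apply: H.
  - move=> w w1; apply: differentiable_quot.
    + by apply: differentiableB; [exact: dhm|exact: differentiable_cst].
    + apply: differentiableB; first exact: differentiable_cst.
      by apply: differentiableM; [exact: differentiable_cst|exact: dhm].
    + by apply: moebius_denom_neq0; [exact/ltW/h1|exact/h1/m1].
  - by move=> w w1; apply/ltW/moebius_lt1; [exact: h1|exact/h1/m1].
  - by rewrite /psi m0 subrr mul0r.
move: H; rewrite /psi mt /t !ncM !Normc.normcV.
have D1 : 0 < nc (1 - conjc (h a) * h z).
  by rewrite nc_gt0; apply: moebius_denom_neq0; [exact/ltW/h1|exact/h1].
have D2 : 0 < nc (1 - conjc a * z) by rewrite nc_gt0.
by rewrite ler_pdivrMr// mulrAC ler_pdivlMr.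
Qed.

(** Values on the unit circle are allowed, so 1 - conjc (h a) * h z may vanish and the inequality is
    kept free of denominators. It follows from the strict case for s h, as s tends to 1. *)
Theorem schwarz_pick (h : C -> C) (a z : C) :
  (forall z, nc z < 1 -> differentiable h z) ->
  (forall z, nc z < 1 -> nc (h z) <= 1) -> nc a < 1 -> nc z < 1 ->
  nc (h z - h a) * nc (1 - conjc a * z) <= nc (z - a) * nc (1 - conjc (h a) * h z).
Proof.
move=> dh h1 a1 z1.
apply/ler_addgt0Pr => e e0.
set X := _ * _; set Y := _ * _.
have X0 : 0 <= X by rewrite mulr_ge0 ?normc_ge0.
(* Replacing [h] by s h changes the right side by at most 2 * 2 (1 - s), which is less than [e] for
   s > 1 - e / 4. *)
apply: (@le_of_mul_lt1 _ _ (Num.max 0 (1 - e / 4))).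
  by rewrite le_max lexx/= gt_max ltr01/=; lra.
move=> s; rewrite gt_max => /andP[/andP[s0 se] s1].
have := @schwarz_pick_lt (fun w => s%:C * h w) a z.
move=> /(_ _ _ a1 z1) H.
have ns : nc s%:C = s by rewrite nc_real gtr0_norm.
have {}H : s * X <= nc (z - a) * nc (1 - conjc (s%:C * h a) * (s%:C * h z)).
  have -> : s * X = nc (s%:C * h z - s%:C * h a) * nc (1 - conjc a * z).
    by rewrite -mulrBr ncM ns /X mulrA.
  apply: H => w w1.
    by apply: differentiableM; [exact: differentiable_cst|exact: dh].
  rewrite ncM ns; have : s * nc (h w) <= s * 1 by rewrite ler_pM2l//; exact: h1.
  lra.
apply: (le_trans H).
set u := conjc (h a) * h z in Y *.
have u1 : nc u <= 1.
  rewrite ncM ncJ; have := ler_pM (normc_ge0 _) (normc_ge0 _) (h1 a a1) (h1 z z1).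
  by rewrite mulr1.
have -> : 1 - conjc (s%:C * h a) * (s%:C * h z) = (1 - u) + (1 - s%:C ^+ 2) * u.
  by rewrite conjcM conjc_real /u; ring.
have B : nc ((1 - s%:C ^+ 2) * u) <= 2 * (1 - s).
  rewrite ncM -(rmorphXn (real_complex R)) -(rmorph1 (real_complex R)) -rmorphB nc_real.
  rewrite ger0_norm; last by rewrite subr_ge0 expr_le1// ltW.
  have E : 1 - s ^+ 2 <= 2 * (1 - s) by have := sqr_ge0 (1 - s); lra.
  have := ler_pM _ (normc_ge0 u) E u1; rewrite mulr1; apply.
  by rewrite subr_ge0 expr_le1// ltW.
have za : nc (z - a) <= 2 by apply: (le_trans (ncB _ _)); lra.
apply: (le_trans (ler_wpM2l (normc_ge0 _) (ncD _ _))).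
rewrite mulrDr lerD2l.
have := ler_pM (normc_ge0 _) (normc_ge0 _) za B; lra.
Qed.

(* Quantitative consequences: [k] bounds [1 - d^2] from below, [d] the
   pseudohyperbolic distance of [a] and [z]. *)
Lemma pseudohyperbolic_lower (a z : C) (r0 r : R) : nc a <= r0 -> nc z <= r ->
  r0 < 1 -> r < 1 ->
  nc (z - a) ^+ 2 <= (1 - (1 - r0 ^+ 2) * (1 - r ^+ 2) / 4) * nc (1 - conjc a * z) ^+ 2.
Proof.
move=> ar zr r01 r1.
have a0 := normc_ge0 a; have z0 := normc_ge0 z.
have D4 : nc (1 - conjc a * z) ^+ 2 <= 4.
  have : nc (1 - conjc a * z) <= 2.
    apply: (le_trans (ncB _ _)); rewrite Normc.normc1 ncM ncJ.
    have : nc a * nc z <= 1 * 1 by apply: ler_pM => //; lra.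
    lra.
  move=> H; have := ler_pM (normc_ge0 _) (normc_ge0 _) H H; rewrite -expr2; lra.
have A2 : nc a ^+ 2 <= r0 ^+ 2 by apply: lerXn2r => //; rewrite nnegrE//; lra.
have Z2 : nc z ^+ 2 <= r ^+ 2 by apply: lerXn2r => //; rewrite nnegrE//; lra.
have r02 : r0 ^+ 2 <= 1 by rewrite expr_le1//; lra.
have r2 : r ^+ 2 <= 1 by rewrite expr_le1//; lra.
have E := moebius_identity a z.
set k := (1 - r0 ^+ 2) * (1 - r ^+ 2).
have k0 : 0 <= k by rewrite /k mulr_ge0//; lra.
have kle : k <= (1 - nc a ^+ 2) * (1 - nc z ^+ 2) by apply: ler_pM; lra.
have : k / 4 * nc (1 - conjc a * z) ^+ 2 <= k / 4 * 4 by rewrite ler_wpM2l//; lra.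
lra.
Qed.

Section Quantitative.
Variables (h : C -> C) (a z : C) (r0 r : R).
Hypotheses (dh : forall z, nc z < 1 -> differentiable h z)
  (h1 : forall z, nc z < 1 -> nc (h z) <= 1).
Hypotheses (ar : nc a <= r0) (zr : nc z <= r) (r01 : r0 < 1) (r1 : r < 1).
Let k := (1 - r0 ^+ 2) * (1 - r ^+ 2) / 4.

Let k01 : 0 < k <= 1.
Proof.
have r00 : 0 <= r0 by exact: le_trans (normc_ge0 a) ar.
have r_0 : 0 <= r by exact: le_trans (normc_ge0 z) zr.
have A : 0 < 1 - r0 ^+ 2 by rewrite subr_gt0 expr_lt1.
have B : 0 < 1 - r ^+ 2 by rewrite subr_gt0 expr_lt1.
rewrite /k divr_gt0 ?mulr_gt0//=.
have : (1 - r0 ^+ 2) * (1 - r ^+ 2) <= 1 * 1.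
  by have := sqr_ge0 r0; have := sqr_ge0 r; move=> ? ?; apply: ler_pM; lra.
lra.
Qed.

Let pick2 : nc (h z - h a) ^+ 2 <= (1 - k) * nc (1 - conjc (h a) * h z) ^+ 2.
Proof.
have a1 : nc a < 1 by exact: le_lt_trans ar r01.
have z1 : nc z < 1 by exact: le_lt_trans zr r1.
have D0 : 0 < nc (1 - conjc a * z).
  by rewrite nc_gt0; apply: moebius_denom_neq0 => //; exact: ltW.
have P := schwarz_pick dh h1 a1 z1.
have L := pseudohyperbolic_lower ar zr r01 r1; rewrite -/k in L.
have D2 : 0 < nc (1 - conjc a * z) ^+ 2 by rewrite exprn_gt0.
rewrite -(ler_pM2r D2) -exprMn.
have := lerXn2r 2 _ _ P; rewrite !nnegrE !mulr_ge0 ?normc_ge0// => /(_ isT isT) P2.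
by apply: (le_trans P2); rewrite exprMn [leRHS]mulrAC ler_wpM2r ?sqr_ge0.
Qed.

(** If |h a| is close to 1, then [h] is nearly constant on smaller discs, at a linear rate. Rigidity
    uses this to carry information from one point to a whole circle. *)
Lemma schwarz_pick_close : nc (h z - h a) <= 4 / k * (1 - nc (h a)).
Proof.
have /andP[k0 k1] := k01.
have a1 : nc a < 1 by exact: le_lt_trans ar r01.
have z1 : nc z < 1 by exact: le_lt_trans zr r1.
have ha1 := h1 a1; have ha0 := normc_ge0 (h a).
set X := nc (h z - h a); set A := nc (h a) in ha1 ha0 *.
have X0 : 0 <= X by exact: normc_ge0.
have D : nc (1 - conjc (h a) * h z) <= (1 - A ^+ 2) + A * X.
  have -> : 1 - conjc (h a) * h z = (1 - h a * conjc (h a)) - conjc (h a) * (h z - h a) by ring.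
  apply: (le_trans (ncB _ _)); rewrite ncM ncJ mulcJ -/A -/X.
  rewrite -(rmorph1 (real_complex R)) -rmorphB nc_real ger0_norm ?lexx//.
  by rewrite subr_ge0 expr_le1.
have S : X <= (1 - k / 2) * nc (1 - conjc (h a) * h z).
  rewrite -(ler_pXn2r (n := 2)) ?nnegrE// ?mulr_ge0 ?normc_ge0//; last by lra.
  apply: (le_trans pick2); rewrite exprMn ler_wpM2r ?sqr_ge0//.
  have := sqr_ge0 (k / 2); lra.
have A2 : 1 - A ^+ 2 <= 2 * (1 - A) by have := sqr_ge0 (1 - A); lra.
have AX : A * X <= 1 * X by rewrite ler_wpM2r.
have S2 : X <= (1 - k / 2) * (2 * (1 - A) + X).
  by apply: (le_trans S); rewrite ler_wpM2l//; lra.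
have S3 : k / 2 * X <= 2 * (1 - A).
  have : 0 <= k * (1 - A) by rewrite mulr_ge0//; lra.
  lra.
rewrite mulrAC ler_pdivlMr//; lra.
Qed.

(** The opposite use of the same estimate: if |h a| stays away from 1, then so does |h z|. *)
Lemma schwarz_pick_away : k * (1 - nc (h a)) / 2 <= 1 - nc (h z) ^+ 2.
Proof.
have /andP[k0 k1] := k01.
have a1 : nc a < 1 by exact: le_lt_trans ar r01.
have z1 : nc z < 1 by exact: le_lt_trans zr r1.
have ha1 := h1 a1; have ha0 := normc_ge0 (h a).
have hz1 := h1 z1; have hz0 := normc_ge0 (h z).
have E := moebius_identity (h a) (h z).
have P := pick2.
have D : 1 - nc (h a) <= nc (1 - conjc (h a) * h z).
  have := nc_le_sub 1 (conjc (h a) * h z); rewrite Normc.normc1 ncM ncJ.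
  have : nc (h a) * nc (h z) <= nc (h a) * 1 by rewrite ler_wpM2l.
  lra.
set A := nc (h a) in ha1 ha0 E D *; set Z := nc (h z) in hz1 hz0 E *.
set W := nc (1 - _) in P E D.
have W2 : (1 - A) ^+ 2 <= W ^+ 2 by apply: lerXn2r => //; rewrite nnegrE; lra.
have K1 : k * (1 - A) ^+ 2 <= (1 - A ^+ 2) * (1 - Z ^+ 2).
  have : k * (1 - A) ^+ 2 <= k * W ^+ 2 by rewrite ler_wpM2l// ltW.
  lra.
have Z2 : 0 <= 1 - Z ^+ 2 by rewrite subr_ge0 expr_le1.
have [->|A1] := eqVneq A 1; first by rewrite subrr mulr0 mul0r.
have A1' : 0 < 1 - A by rewrite subr_gt0 lt_neqAle A1.
have : k * (1 - A) * (1 - A) <= (1 + A) * (1 - Z ^+ 2) * (1 - A).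
  by rewrite -mulrA -expr2; apply: (le_trans K1); rewrite le_eqVlt; apply/orP; left; apply/eqP; ring.
rewrite ler_pM2r// => K2.
have : (1 + A) * (1 - Z ^+ 2) <= 2 * (1 - Z ^+ 2) by rewrite ler_wpM2r//; lra.
lra.
Qed.

End Quantitative.

Lemma minimum_Re (f : C -> C) (r K e : R) :
  (forall z, nc z <= r -> differentiable f z) ->
  (forall z, nc z = r -> nc (f z) <= K) ->
  (forall z, nc z = r -> - e <= Re (f z)) ->
  forall z, nc z <= r -> - e <= Re (f z).
Proof.
move=> df fK fe z zr.
have r0 : 0 <= r by exact: le_trans (normc_ge0 z) zr.
have nr : nc r%:C = r by rewrite nc_real ger0_norm.
have K0 : 0 <= K by apply: le_trans (fK _ nr); exact: normc_ge0.
pose L := K + `|e|.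
have L0 : 0 <= L by rewrite addr_ge0.
(* a half-plane is the union of the discs of centre [B] through 0 *)
have key B : 0 < B -> B ^+ 2 - 2 * B * (Re (f z) + e) <= L ^+ 2 + B ^+ 2.
  move=> B0.
  have := @maximum_modulus _ (fun w => f w + (e - B)%:C) r (Num.sqrt (L ^+ 2 + B ^+ 2)).
  move=> /(_ _ _ z zr) H.
  have {}H : nc (f z + (e - B)%:C) <= Num.sqrt (L ^+ 2 + B ^+ 2).
    apply: H => w wr.
      by apply: differentiableD; [exact: df|exact: differentiable_cst].
    rewrite -(ler_pXn2r (n := 2)) ?nnegrE ?normc_ge0 ?sqrtr_ge0//.
    rewrite sqr_sqrtr ?addr_ge0 ?sqr_ge0// nc_sqr Re_add Im_add /= addr0.
    have F1 : nc (f w + e%:C) <= L.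
      by apply: (le_trans (ncD _ _)); rewrite nc_real lerD2r fK.
    have := lerXn2r 2 _ _ F1; rewrite !nnegrE normc_ge0 L0 => /(_ isT isT).
    rewrite nc_sqr Re_add Im_add /= addr0 => F2.
    have := fe w wr => F3.
    have : 0 <= B * (Re (f w) + e) by apply: mulr_ge0; lra.
    move: F2; set x := Re (f w); set y := Im (f w); nra.
  have := lerXn2r 2 _ _ H; rewrite !nnegrE normc_ge0 sqrtr_ge0 => /(_ isT isT).
  rewrite sqr_sqrtr ?addr_ge0 ?sqr_ge0// nc_sqr Re_add Im_add /= addr0.
  have := sqr_ge0 (Im (f z)); have := sqr_ge0 (Re (f z) + e).
  set x := Re (f z); set y := Im (f z); nra.
rewrite leNgt; apply/negP => Lt.
have t0 : 0 < - (Re (f z) + e) by lra.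
(* With t = - (Re (f z) + e) > 0, [key] says 2 B t <= L^2, and this B violates it since B t = L^2 +
   t. *)
have B0 : 0 < L ^+ 2 / (- (Re (f z) + e)) + 1.
  by rewrite ltr_wpDl// divr_ge0 ?sqr_ge0// ltW.
have := key _ B0; set t := - (Re (f z) + e) in t0 B0 *.
have -> : Re (f z) + e = - t by rewrite /t opprK.
have : (L ^+ 2 / t + 1) * t = L ^+ 2 + t by rewrite mulrDl mul1r divfK// lt0r_neq0.
have := sqr_ge0 L.
set u := L ^+ 2; set b := u / t + 1; nra.
Qed.

End Schwarz.

(** * Generating polynomials of points and Newton's identities *)

Section ElementarySymmetric.
Context {R : realType}.
Local Notation C := R[i].
Local Notation Re := (@complex.Re R).
Local Notation Im := (@complex.Im R).
Local Notation nc := (@Normc.normc R).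
Local Open Scope complex_scope.
Variable n : nat.
Implicit Types (s z : 'rV[C]_n).

(** For s = symm z this is the product of the 1 + z_j X, with zeros - 1 / z_j. Membership in the
    symmetrized polydisc thus means that the closed unit disc contains no zero. *)
Definition gpoly s : {poly C} := 1 + \sum_(k < n) s 0 k *: 'X^(k.+1).

Definition elsym s (k : nat) : C := (gpoly s)`_k.

Lemma elsym0 s : elsym s 0 = 1.
Proof.
rewrite /elsym /gpoly coefD coefC/= coef_sum big1 ?addr0// => k _.
by rewrite coefZ coefXn/= mulr0.
Qed.

Lemma elsymS s (k : 'I_n) : elsym s k.+1 = s 0 k.
Proof.
rewrite /elsym /gpoly coefD coefC/= add0r coef_sum (bigD1 k)//= coefZ coefXn eqxx mulr1.
rewrite big1 ?addr0// => j jk; rewrite coefZ coefXn eqSS.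
by rewrite eq_sym (inj_eq val_inj) (negbTE jk) mulr0.
Qed.

Lemma elsym_lt s k (kn : (k < n)%N) : elsym s k.+1 = s 0 (Ordinal kn).
Proof. by rewrite -elsymS. Qed.

Lemma size_gpoly s : (size (gpoly s) <= n.+1)%N.
Proof.
rewrite /gpoly; apply: (leq_trans (size_polyD _ _)); rewrite geq_max size_poly1/=.
apply: (leq_trans (size_sum _ _ _)); apply/bigmax_leqP => k _.
by apply: (leq_trans (size_scale_leq _ _)); rewrite size_polyXn ltnS.
Qed.

Lemma elsym_gt s k : (n < k)%N -> elsym s k = 0.
Proof. by move=> nk; rewrite /elsym nth_default// (leq_trans (size_gpoly s)). Qed.

Lemma elsym_out s k : ~~ (k < n)%N -> elsym s k.+1 = 0.
Proof. by rewrite -leqNgt -ltnS => /elsym_gt. Qed.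

Lemma gpoly_horner s t : (gpoly s).[t] = \sum_(j < n.+1) elsym s j * t ^+ j.
Proof. exact: horner_coef_wide (size_gpoly s). Qed.

Lemma gpoly_inj : injective gpoly.
Proof. by move=> s s' E; apply/rowP => k; rewrite -!elsymS /elsym E. Qed.

Lemma prod_linear z :
  \prod_(j < n) (1 + z 0 j *: 'X) = gpoly (symm z) :> {poly C}.
Proof.
under eq_bigr do rewrite addrC.
rewrite bigA_distr.
have E (A : {set 'I_n}) : \prod_(j < n) (if j \in A then z 0 j *: 'X else 1) =
    (\prod_(j in A) z 0 j) *: 'X^#|A| :> {poly C}.
  by rewrite -big_mkcond/= scaler_prod prodr_const.
rewrite (eq_bigr _ (fun A _ => E A)).
rewrite (partition_big (fun A : {set 'I_n} => inord #|A| : 'I_n.+1) xpredT)//=.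
have cA (A : {set 'I_n}) (k : nat) : (k < n.+1)%N -> (inord #|A| == inord k :> 'I_n.+1) = (#|A| == k).
  move=> kn; have An : (#|A| < n.+1)%N by rewrite ltnS -[X in (_ <= X)%N]card_ord max_card.
  apply/eqP/eqP => [/(congr1 val)/=|->//]; by rewrite !inordK.
rewrite big_ord_recl/= /gpoly; congr (_ + _).
  rewrite (big_pred1 (finset.set0 : {set 'I_n})) => [|A]; first by rewrite big_set0 cards0 expr0 scale1r.
  by rewrite -[ord0]inord_val cA//= cards_eq0.
apply: eq_bigr => k _; rewrite mxE scaler_suml; apply: eq_big => [A|A /eqP Ak].
  by rewrite -[lift _ _]inord_val cA.
congr (_ *: 'X^_); move: (congr1 val Ak) => /=.
by rewrite inordK// ltnS -[X in (_ <= X)%N]card_ord max_card.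
Qed.

Lemma gpoly_symm_horner z t : (gpoly (symm z)).[t] = \prod_(j < n) (1 + z 0 j * t).
Proof.
rewrite -prod_linear horner_prod; apply: eq_bigr => j _.
by rewrite !hornerE.
Qed.

(** As [gpoly s] is 1 at 0, none of its roots vanishes. Their negative reciprocals are the
    coordinates, padded with zeros if the degree is below [n]. *)
Lemma symm_surj s : exists z, symm z = s.
Proof.
have [rs Ers] := closed_field_poly_normal (gpoly s).
have p0 : (gpoly s).[0] = 1 by rewrite horner_coef0 -/(elsym s 0) elsym0.
have lc0 : lead_coef (gpoly s) != 0.
  by rewrite lead_coef_eq0; apply/eqP => E; move: p0; rewrite E horner0 => /eqP; rewrite eq_sym oner_eq0.
have srs : (size rs <= n)%N.
  have := size_gpoly s; rewrite Ers size_scale// size_prod_XsubC.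
  by rewrite ltnS.
pose l := [seq - r^-1 | r <- rs].
exists (\row_(j < n) nth 0 l j); apply: gpoly_inj.
rewrite -prod_linear.
have -> : \prod_(j < n) (1 + (\row_(j < n) nth 0 l j) 0 j *: 'X) =
    \prod_(x <- l) (1 + x *: 'X) :> {poly C}.
  transitivity (\prod_(j < n) (1 + nth 0 l j *: 'X) : {poly C}).
    by apply: eq_bigr => j _; rewrite mxE.
  rewrite -(big_mkord xpredT (fun j => 1 + nth 0 l j *: 'X : {poly C})).
  rewrite [RHS](big_nth 0) size_map (@big_cat_nat _ _ _ (size rs))//=.
  rewrite [X in _ * X]big1_seq ?mulr1//.
  move=> j; rewrite mem_index_iota => /and3P[_ jr _].
  by rewrite nth_default ?scale0r ?addr0// size_map.
rewrite big_map Ers.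
have r0 r : r \in rs -> r != 0.
  move=> rrs; apply/eqP => E; move: p0; rewrite Ers hornerZ.
  rewrite (_ : _.[0] = 0) ?mulr0 => [/eqP|]; first by rewrite eq_sym oner_eq0.
  by apply/rootP; rewrite root_prod_XsubC -E.
have -> : \prod_(r <- rs) ('X - r%:P) = (\prod_(r <- rs) - r) *: \prod_(r <- rs) (1 + (- r^-1) *: 'X) :> {poly C}.
  rewrite -scaler_prod; apply: eq_big_seq => r /r0 rn0.
  by rewrite scalerDr scalerA mulrNN divff// scale1r addrC -alg_polyC scaleNr.
rewrite scalerA.
suff -> : lead_coef (gpoly s) * \prod_(r <- rs) - r = 1 by rewrite scale1r.
apply: etrans p0; rewrite [in RHS]Ers hornerZ horner_prod; congr (_ * _).
by apply: eq_bigr => r _; rewrite hornerXsubC sub0r.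
Qed.

Lemma symm_polydiscP s :
  (forall t, nc t <= 1 -> (gpoly s).[t] != 0) -> symm_polydisc n s.
Proof.
have [z <-] := symm_surj s => H; exists z => // j /=; rewrite /disc/= ltNge; apply/negP => zj.
have z0 : z 0 j != 0 by rewrite -nc_gt0; apply: lt_le_trans zj.
have := H (- (z 0 j)^-1); rewrite ncN Normc.normcV invf_le1 ?nc_gt0// => /(_ zj).
rewrite gpoly_symm_horner (bigD1 j)//= mulrN divff// subrr mul0r.
by rewrite eqxx.
Qed.

Lemma elsym_symm z k : (0 < k)%N ->
  elsym (symm z) k = \sum_(A : {set 'I_n} | #|A| == k) \prod_(j in A) z 0 j.
Proof.
case: k => // k _; have [kn|kn] := boolP (k < n)%N; first by rewrite elsym_lt mxE.
rewrite elsym_out// big_pred0// => A; apply/negP => /eqP Ak.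
by move/negP: kn; apply; rewrite -Ak -[X in (_ <= X)%N]card_ord max_card.
Qed.

Lemma elsym_bound s k : symm_polydisc n s -> nc (elsym s k) <= 2 ^+ n.
Proof.
have one2 : 1 <= 2 ^+ n :> R by rewrite exprn_ege1// ler1n.
move=> [z z1 <-]; case: k => [|k]; first by rewrite elsym0 Normc.normc1.
rewrite elsym_symm//; apply: (le_trans (nc_sum _ _ _)).
apply: (@le_trans _ _ (\sum_(A : {set 'I_n}) 1)).
  rewrite big_mkcond/=; apply: ler_sum => A _; case: ifP => // _.
  rewrite nc_prod.
  apply: (@le_trans _ _ (\prod_(j in A) 1)); last by rewrite big1_eq.
  apply: ler_prod => j _; rewrite normc_ge0/=.
  exact/ltW/z1.
rewrite sumr_const -cardsT -powersetT card_powerset cardsT card_ord.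
by rewrite natrX.
Qed.

Lemma symm_scale z u : symm (u *: z) = \row_(k < n) (u ^+ k.+1 * symm z 0 k).
Proof.
apply/rowP => k; rewrite !mxE mulr_sumr; apply: eq_bigr => A /eqP Ak.
under eq_bigr do rewrite mxE.
by rewrite big_split/= prodr_const Ak.
Qed.

(* [dnum s lam / dden s lam] is the function [f_{lam, ..., lam}]. *)
Definition dnum s (lam : C) := \sum_(j < n) j.+1%:R * elsym s j.+1 * lam ^+ j.
Definition dden s (lam : C) := \sum_(j < n) (n - j)%:R * elsym s j * lam ^+ j.

Lemma dnumE s lam : dnum s lam = (gpoly s)^`().[lam].
Proof.
rewrite (@horner_coef_wide _ n).
  by apply: eq_bigr => j _; rewrite coef_deriv mulr_natl.
apply: leq_trans (leq_trans (size_poly _ _) _) _; first exact: leqnn.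
by have := size_gpoly s; case: (size _).
Qed.

Lemma ddenE s lam : dden s lam = n%:R * (gpoly s).[lam] - lam * (gpoly s)^`().[lam].
Proof.
rewrite -dnumE gpoly_horner mulr_sumr mulr_sumr.
rewrite big_ord_recr/=.
have -> : \sum_(j < n) lam * (j.+1%:R * elsym s j.+1 * lam ^+ j) =
          \sum_(j < n.+1) j%:R * (elsym s j * lam ^+ j).
  rewrite [RHS]big_ord_recl/= mul0r add0r; apply: eq_bigr => j _.
  by rewrite /bump/= add1n exprS; ring.
rewrite big_ord_recr/= opprD addrACA subrr addr0 -sumrB.
by apply: eq_bigr => j _; rewrite natrB ?(ltnW (ltn_ord j))//; ring.
Qed.

Lemma deriv_prod_linear (F : 'I_n -> C) : (\prod_(j < n) (1 + F j *: 'X) : {poly C})^`() =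
  \sum_(j < n) F j *: \prod_(l < n | l != j) (1 + F l *: 'X).
Proof.
elim: n F => [|m IH] F; first by rewrite !big_ord0 derivC.
rewrite big_ord_recl derivM IH derivD derivC add0r derivZ derivX.
rewrite big_ord_recl; congr (_ + _).
  rewrite -scalerAl mul1r; congr (_ *: _).
  rewrite [RHS]big_mkcond big_ord_recl/= mul1r; apply: eq_bigr => i _.
  by [].
rewrite mulr_sumr; apply: eq_bigr => j _.
rewrite -scalerAr; congr (_ *: _).
rewrite [RHS]big_mkcond big_ord_recl/=; congr (_ * _).
rewrite big_mkcond/=; apply: eq_bigr => i _.
by rewrite (inj_eq lift_inj).
Qed.

Lemma half_plane (y : C) : nc y < 1 -> 2^-1 < Re (1 + y)^-1.
Proof.
move=> y1; have n1 : nc y ^+ 2 < 1 by rewrite expr_lt1// normc_ge0.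
have y0 : 1 + y != 0.
  rewrite addrC addr_eq0; apply/eqP => E; move: y1; rewrite E ncN Normc.normc1 ltxx//.
move: n1; rewrite nc_sqr => n1.
have : 0 < nc (1 + y) ^+ 2 by rewrite exprn_gt0// nc_gt0.
rewrite nc_sqr Re_add Im_add /=; case: y n1 {y1 y0} => a b /= n1 D0.
rewrite add0r in D0 *.
by rewrite ltr_pdivlMr//; move: n1; nra.
Qed.

(** With P the value of [gpoly s] at [lam] and S the sum of the 1 / (1 + z_j lam), one has lam *
    dnum = P (n - S) and dden = P S. Each summand has real part above 1/2, so Re S > n / 2 and S is
    closer to n than to 0. *)
Lemma dnum_lt_dden s lam : (0 < n)%N -> symm_polydisc n s -> nc lam = 1 ->
  nc (dnum s lam) < nc (dden s lam).
Proof.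
move=> n0 [z z1 <-] l1.
pose w j := (1 + z 0 j * lam)^-1.
have zl j : nc (z 0 j * lam) < 1 by rewrite ncM l1 mulr1; exact: z1.
have w0 j : 1 + z 0 j * lam != 0.
  rewrite addrC addr_eq0; apply/eqP => E; have := zl j; rewrite E ncN Normc.normc1 ltxx//.
pose P := \prod_(j < n) (1 + z 0 j * lam).
have P0 : P != 0 by apply/prodf_neq0 => j _.
pose S := \sum_(j < n) w j.
have others j : \prod_(l < n | l != j) (1 + z 0 l * lam) = P * w j.
  by apply: (mulIf (w0 j)); rewrite /w divfK// /P [RHS](bigD1 j)//= mulrC.
have dE : (gpoly (symm z))^`().[lam] = \sum_(j < n) z 0 j * (P * w j).
  rewrite -prod_linear deriv_prod_linear horner_sum; apply: eq_bigr => j _.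
  rewrite hornerZ horner_prod -others; congr (_ * _); apply: eq_bigr => l _.
  by rewrite !hornerE.
have lA : lam * dnum (symm z) lam = P * (n%:R - S).
  have -> : n%:R = \sum_(j < n) 1 :> C by rewrite sumr_const card_ord.
  rewrite dnumE dE mulr_sumr /S -sumrB mulr_sumr.
  by apply: eq_bigr => j _; rewrite /w; field; exact: w0.
have NE : dden (symm z) lam = P * S.
  by rewrite ddenE -dnumE lA gpoly_symm_horner -/P; ring.
have -> : nc (dnum (symm z) lam) = nc (lam * dnum (symm z) lam) by rewrite ncM l1 mul1r.
rewrite lA NE !ncM ltr_pM2l ?nc_gt0//.
rewrite -(ltr_pXn2r (n := 2)) ?nnegrE ?normc_ge0//.
have ReS : n%:R / 2 < Re S.
  have -> : n%:R / 2 = \sum_(j < n) 2^-1 :> R by rewrite sumr_const card_ord mulr_natl.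
  rewrite /S raddf_sum/=.
  apply: ltr_sum; first by apply/hasP; exists (Ordinal n0); rewrite ?mem_index_enum.
  by move=> j _; exact: half_plane.
have nn : 0 < n%:R :> R by rewrite ltr0n.
rewrite !nc_sqr Re_sub Im_sub.
have -> : Re n%:R = n%:R by rewrite -(rmorph_nat (real_complex R)).
have -> : Im (n%:R : C) = 0 by rewrite -(rmorph_nat (real_complex R)).
move: ReS; nra.
Qed.

Definition psum (z : 'rV[C]_n) (k : nat) : C := \sum_(j < n) z 0 j ^+ k.

(** Newton's identity, obtained by comparing coefficients in P' = sum_j z_j Q_j, where Q_j = P / (1
    + z_j X) is expanded as a geometric series. *)
Lemma newton z k : k.+1%:R * elsym (symm z) k.+1 =
  \sum_(i < k.+1) (-1) ^+ i * elsym (symm z) (k - i) * psum z i.+1.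
Proof.
have -> : k.+1%:R * elsym (symm z) k.+1 = (gpoly (symm z))^`()`_k.
  by rewrite coef_deriv mulr_natl.
rewrite -prod_linear deriv_prod_linear coef_sum.
pose Q j := \prod_(l < n | l != j) (1 + z 0 l *: 'X) : {poly C}.
have QE j m : (Q j)`_m = \sum_(i < m.+1) (- z 0 j) ^+ i * elsym (symm z) (m - i).
  have PQ : gpoly (symm z) = Q j + z 0 j *: (Q j * 'X).
    rewrite -prod_linear (bigD1 j)//= -/(Q j) mulrDl mul1r; congr (_ + _).
    by rewrite -scalerAl mulrC.
  elim: m => [|m IH].
    rewrite big_ord_recl big_ord0/= expr0 mul1r addr0 subnn /elsym PQ coefD coefZ coefMX/=.
    by rewrite mulr0 addr0.
  rewrite big_ord_recl/= expr0 mul1r subn0 /elsym PQ coefD coefZ coefMX/= -PQ.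
  rewrite -[LHS]addr0 -addrA; congr (_ + _).
  rewrite IH mulr_sumr -big_split/= big1// => i _.
  by rewrite /bump/= add1n subSS exprS /elsym; ring.
under eq_bigr => j _ do rewrite coefZ -/(Q j) QE mulr_sumr.
rewrite exchange_big/=; apply: eq_bigr => i _.
rewrite mulr_sumr; apply: eq_bigr => j _.
by rewrite exprS (exprNn (z 0 j)); ring.
Qed.

End ElementarySymmetric.

(** * Discs in the symmetrized polydisc: the lower bound by rho and the divisor case *)

Section AnalyticDiscs.
Context {R : realType}.
Local Notation C := R[i].
Local Notation Re := (@complex.Re R).
Local Notation Im := (@complex.Im R).
Local Notation nc := (@Normc.normc R).
Local Open Scope complex_scope.

Lemma phase (c : C) : exists2 u : C, nc u = 1 & c = (nc c)%:C * u.
Proof.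
have [->|c0] := eqVneq c 0; first by exists 1; [exact: Normc.normc1|rewrite Normc.normc0 mul0r].
have nc0 : 0 < nc c by rewrite nc_gt0.
exists (c / (nc c)%:C).
  by rewrite ncM Normc.normcV nc_real gtr0_norm// divff// lt0r_neq0.
rewrite mulrC divfK//; apply/eqP => /complexI/eqP.
by rewrite gt_eqF.
Qed.

Lemma unimodular_root (m : nat) (w : C) : (0 < m)%N -> nc w = 1 ->
  exists2 u : C, nc u = 1 & u ^+ m = w.
Proof.
move=> m0 w1; exists (m.-root w)%C; last exact: rootCK.
apply/eqP; rewrite -(pexpr_eq1 m0) ?normc_ge0// -ncX rootCK//.
by rewrite w1.
Qed.

Lemma differentiable_coordinate n (phi : C -> 'rV[C]_n) (z : C) (k : 'I_n) :
  differentiable phi z -> differentiable (fun x => phi x 0 k) z.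
Proof.
move=> dphi.
exact: (@differentiable_comp _ _ _ _ phi (fun M : 'rV[C]_n => M 0 k) z dphi
  (differentiable_coord _ _ _)).
Qed.

Lemma differentiable_row n (phi : C -> 'rV[C]_n) (z : C) :
  (forall k, differentiable (fun x => phi x 0 k) z) -> differentiable phi z.
Proof.
move=> H; have -> : phi = \sum_(k < n) (fun x => phi x 0 k *: delta_mx 0 k).
  by apply/funext => x; rewrite fct_sumE; exact: row_sum_delta.
by apply: differentiable_sum => k; exact: differentiableZl.
Qed.

Lemma derive1_comp_diff (V W : normedModType C) (f : C -> V) (g : V -> W) (z : C) :
  differentiable f z -> differentiable g (f z) ->
  derive1 (g \o f) z = 'd g (f z) (derive1 f z).
Proof.
move=> df dg; rewrite !derive1E'//; last exact: differentiable_comp.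
by rewrite diff_comp.
Qed.

Lemma derive1_coordinate n (phi : C -> 'rV[C]_n) (z : C) (k : 'I_n) :
  differentiable phi z -> derive1 phi z 0 k = derive1 (fun x => phi x 0 k) z.
Proof.
move=> dphi.
have := derive1_comp_diff dphi (differentiable_coord (phi z) 0 k) => /= ->.
have @f : {linear 'rV[C]_n -> C}.
  by exists (fun N : 'rV[C]_n => N 0 k); do 2![eexists]; do ?[constructor];
     rewrite ?mxE// => ? *; rewrite ?mxE//; move=> ?; rewrite !mxE.
have -> : (fun N : 'rV[C]_n => N 0 k) = f by [].
by rewrite diff_lin//; exact: coord_continuous.
Qed.

Lemma derive1_eq (f : C -> C) (z a : C) : is_derive z 1 f a -> derive1 f z = a.
Proof. by move=> [_ <-]; rewrite derive1E. Qed.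

Lemma derive1_is_derive (f : C -> C) (z : C) : differentiable f z ->
  is_derive z 1 f (derive1 f z).
Proof. by move=> /derivable1_diffP df; rewrite derive1E; exact: derivableP. Qed.

Variable n : nat.
Hypothesis n_gt0 : (0 < n)%N.
Implicit Types (s X : 'rV[C]_n) (phi : C -> 'rV[C]_n).

Let nC0 : n%:R != 0 :> C.
Proof. by rewrite pnatr_eq0 -lt0n. Qed.

Lemma differentiable_elsym phi z k : differentiable phi z ->
  differentiable (fun x => elsym (phi x) k) z.
Proof.
case: k => [|k] dphi; first by under eq_fun do rewrite elsym0; exact: differentiable_cst.
have [kn|kn] := boolP (k < n)%N.
  by under eq_fun do rewrite (elsym_lt _ kn); exact: differentiable_coordinate.
by under eq_fun do rewrite (elsym_out _ kn); exact: differentiable_cst.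
Qed.

Lemma differentiable_dnum phi z lam : differentiable phi z ->
  differentiable (fun x => dnum (phi x) lam) z.
Proof.
move=> dphi; rewrite /dnum -fct_sumE; apply: differentiable_sum => j.
apply: differentiableM; last exact: differentiable_cst.
apply: differentiableM; first exact: differentiable_cst.
exact: differentiable_elsym.
Qed.

Lemma differentiable_dden phi z lam : differentiable phi z ->
  differentiable (fun x => dden (phi x) lam) z.
Proof.
move=> dphi; rewrite /dden -fct_sumE; apply: differentiable_sum => j.
apply: differentiableM; last exact: differentiable_cst.
apply: differentiableM; first exact: differentiable_cst.
exact: differentiable_elsym.
Qed.

Lemma dnum0 lam : dnum (0 : 'rV[C]_n) lam = 0.
Proof. by rewrite /dnum big1// => j _; rewrite elsymS mxE mulr0 mul0r. Qed.

Lemma dden0 lam : dden (0 : 'rV[C]_n) lam = n%:R.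
Proof.
rewrite /dden; move: n_gt0; case: n => // m _; rewrite big_ord_recl/= elsym0 subn0 !mulr1.
rewrite big1 ?addr0// => j _; rewrite /bump/= add1n.
by rewrite (elsym_lt _ (ltn_trans (ltn_ord j) (ltnSn m))) mxE mulr0 mul0r.
Qed.

Section Disc.
Variable phi : C -> 'rV[C]_n.
Hypothesis hphi : holomorphic disc (symm_polydisc n) phi.
Hypothesis phi0 : phi 0 = 0.
Variable lam : C.
Hypothesis lam1 : nc lam = 1.

Definition cquot (z : C) := dnum (phi z) lam / dden (phi z) lam.

Lemma dden_neq0 z : nc z < 1 -> dden (phi z) lam != 0.
Proof.
move=> /hphi[_ Gz]; rewrite -nc_gt0.
by apply: le_lt_trans (dnum_lt_dden n_gt0 Gz lam1); exact: normc_ge0.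
Qed.

Lemma differentiable_cquot z : nc z < 1 -> differentiable cquot z.
Proof.
move=> z1; have [dphi _] := hphi z1; apply: differentiable_quot.
- exact: differentiable_dnum.
- exact: differentiable_dden.
- exact: dden_neq0.
Qed.

Lemma cquot_le1 z : nc z < 1 -> nc (cquot z) <= 1.
Proof.
move=> z1; have [_ Gz] := hphi z1.
rewrite ncM Normc.normcV ler_pdivrMr ?nc_gt0 ?dden_neq0// mul1r.
exact/ltW/dnum_lt_dden.
Qed.

Lemma cquot0 : cquot 0 = 0.
Proof. by rewrite /cquot phi0 dnum0 mul0r. Qed.

Lemma slope_cquot_le1 z : nc z < 1 -> nc (slope cquot 0 z) <= 1.
Proof.
by move=> z1; apply: schwarz z1; [exact: differentiable_cquot|exact: cquot_le1|exact: cquot0].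
Qed.

(** The right side is the linear form whose modulus [rho] maximises. It is found by differentiating
    dnum = cquot * dden: as [cquot] vanishes at 0, the derivative of [dden] does not enter, and
    [dden] is n there. *)
Lemma derive1_cquot : derive1 cquot 0 =
  n%:R^-1 * \sum_(j < n) j.+1%:R * derive1 phi 0 0 j * lam ^+ j.
Proof.
have z1 : nc (0 : C) < 1 by rewrite Normc.normc0.
have [dphi _] := hphi z1.
have E z : nc z < 1 -> dnum (phi z) lam = cquot z * dden (phi z) lam.
  by move=> z1'; rewrite /cquot divfK// dden_neq0.
have dq := derive1_is_derive (differentiable_cquot z1).
have dd := derive1_is_derive (differentiable_dden lam dphi).
have dqd := is_deriveM dq dd.
have dn : is_derive (0 : C) 1 (fun x => dnum (phi x) lam)
    (\sum_(j < n) j.+1%:R * derive1 phi 0 0 j * lam ^+ j).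
  rewrite /dnum -fct_sumE; apply: is_derive_sum => j.
  have -> : (fun x => j.+1%:R * elsym (phi x) j.+1 * lam ^+ j) =
            (fun x => (j.+1%:R * lam ^+ j) *: phi x 0 j).
    by apply/funext => x; rewrite elsymS scaleC; ring.
  have -> : j.+1%:R * derive1 phi 0 0 j * lam ^+ j =
    (j.+1%:R * lam ^+ j) *: derive1 (fun x => phi x 0 j) 0.
    by rewrite derive1_coordinate// scaleC; ring.
  exact: (is_deriveZ (j.+1%:R * lam ^+ j) (derive1_is_derive (differentiable_coordinate j dphi))).
have : is_derive (0 : C) 1 (fun x => dnum (phi x) lam)
    (cquot 0 *: derive1 (fun x => dden (phi x) lam) 0 + dden (phi 0) lam *: derive1 cquot 0).
  have nE : {near (0 : C), cquot * (fun x => dden (phi x) lam) =1 (fun x => dnum (phi x) lam)}.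
    apply/nbhs_nc; exists 1 => // w; rewrite subr0 => w1.
    by rewrite E.
  exact: (near_eq_is_derive nE dqd).
move=> [_ E1]; move: dn => [_]; rewrite E1 cquot0 scale0r add0r phi0 dden0 => <-.
by rewrite scaleC mulKf.
Qed.

Lemma dnum_schwarz z : nc z < 1 -> nc (dnum (phi z) lam) <= nc z * nc (dden (phi z) lam).
Proof.
move=> z1; have D0 := dden_neq0 z1.
rewrite -ler_pdivrMr ?nc_gt0// -Normc.normcV -ncM -/(cquot z).
rewrite (slope0 z cquot0) ncM ler_piMr ?normc_ge0//.
exact: slope_cquot_le1.
Qed.

End Disc.

Lemma rho_le_kobayashi_royden X :
  (rho X <= kobayashi_royden (symm_polydisc n) 0 X)%E.
Proof.
apply: le_ereal_inf_tmp => _ [a [a0 [phi [hphi phi0 phiX]]] <-].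
apply: ge_ereal_sup => _ [lam lam1 <-]; rewrite lee_fin -phiX.
have z1 : nc (0 : C) < 1 by rewrite Normc.normc0.
have := slope_cquot_le1 hphi phi0 lam1 z1; rewrite /slope eqxx derive1_cquot//.
set S := \sum_(_ < n) _ => S1.
have -> : \sum_(j < n) j.+1%:R * (a%:C *: derive1 phi 0) 0 j * lam ^+ j = a%:C * S.
  by rewrite mulr_sumr; apply: eq_bigr => j _; rewrite mxE; ring.
by rewrite mulrCA ncM nc_real ger0_norm// ler_piMr.
Qed.

Section PolyDisc.
Variable p : C -> {poly C}.
Hypotheses (psize : forall z, (size (p z) <= n.+1)%N) (p0 : forall z, nc z < 1 -> (p z)`_0 = 1).
Hypothesis pnz : forall z t, nc z < 1 -> nc t <= 1 -> (p z).[t] != 0.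
Hypothesis pdiff : forall z k, nc z < 1 -> differentiable (fun x => (p x)`_k) z.

(** Discs are prescribed by their generating polynomials; landing in the symmetrized polydisc then
    amounts to the absence of zeros in the closed unit disc ([pnz]). *)
Definition poly_disc (z : C) : 'rV[C]_n := \row_(k < n) (p z)`_k.+1.

Lemma gpoly_poly_disc z : nc z < 1 -> gpoly (poly_disc z) = p z.
Proof.
move=> z1; apply/polyP => k; rewrite -/(elsym _ k); case: k => [|k]; first by rewrite elsym0 p0.
have [kn|kn] := boolP (k < n)%N; first by rewrite (elsym_lt _ kn) mxE.
by rewrite elsym_out// nth_default// (leq_trans (psize z))// ltnS leqNgt.
Qed.

Lemma holomorphic_poly_disc : holomorphic disc (symm_polydisc n) poly_disc.
Proof.
move=> z z1; split.
  apply: differentiable_row => k; under eq_fun do rewrite mxE; exact: pdiff.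
by apply: symm_polydiscP => t t1; rewrite gpoly_poly_disc//; exact: pnz.
Qed.

End PolyDisc.

Lemma coef_binomial (a : C) (k m j : nat) : (0 < k)%N ->
  ((1 + a *: 'X^k) ^+ m : {poly C})`_j =
  \sum_(i < m.+1) 'C(m, i)%:R * a ^+ i * (j == (k * i)%N)%:R.
Proof.
move=> k0; rewrite exprDn coef_sum; apply: eq_bigr => i _.
rewrite expr1n mul1r exprZn -exprM coefMn coefZ coefXn.
by rewrite -[RHS]mulrA mulr_natl.
Qed.

Lemma divisor_disc (k : nat) (u : C) : (0 < k <= n)%N -> (k %| n)%N -> nc u = 1 ->
  exists phi : C -> 'rV[C]_n, [/\ holomorphic disc (symm_polydisc n) phi, phi 0 = 0,
    derive1 phi 0 = ((n %/ k)%:R * u) *: basis_vec n k &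
    forall z, nc z < 1 -> gpoly (phi z) = (1 + (u * z) *: 'X^k) ^+ (n %/ k)].
Proof.
move=> /andP[k0 kn] kdvd u1.
set m := (n %/ k)%N; have mk : (m * k = n)%N by rewrite divnK.
have m0 : (0 < m)%N by move: n_gt0; rewrite -mk muln_gt0 => /andP[].
pose p z : {poly C} := (1 + (u * z) *: 'X^k) ^+ m.
have pc z j : (p z)`_j = \sum_(i < m.+1) 'C(m, i)%:R * (u * z) ^+ i * (j == (k * i)%N)%:R.
  exact: coef_binomial.
have psize z : (size (p z) <= n.+1)%N.
  have sq : (size (1 + (u * z) *: 'X^k : {poly C})%R <= k.+1)%N.
    apply: (leq_trans (size_polyD _ _)); rewrite geq_max size_poly1/=.
    by apply: (leq_trans (size_scale_leq _ _)); rewrite size_polyXn.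
  apply: (leq_trans (size_poly_exp_leq _ _)).
  by rewrite ltnS -mk mulnC leq_mul2l -subn1 leq_subLR add1n sq orbT.
have p0 z : (p z)`_0 = 1.
  rewrite pc big_ord_recl/= muln0 eqxx bin0 expr0 !mulr1 big1 ?addr0// => i _.
  by rewrite /bump/= add1n eq_sym muln_eq0 (gtn_eqF k0)/= mulr0.
have pnz z t : nc z < 1 -> nc t <= 1 -> (p z).[t] != 0.
  move=> z1 t1; rewrite horner_exp !hornerE expf_neq0//.
  rewrite addrC addr_eq0; apply/eqP => /(congr1 nc).
  rewrite ncN Normc.normc1 !ncM u1 mul1r ncX => E.
  have : nc z * nc t ^+ k <= nc z * 1.
    by rewrite ler_wpM2l ?normc_ge0// exprn_ile1 ?normc_ge0.
  by rewrite E mulr1 leNgt z1.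
have pdiff z j : differentiable (fun x => (p x)`_j) z.
  under eq_fun do rewrite pc.
  rewrite -fct_sumE; apply: differentiable_sum => i.
  apply: differentiableM; last exact: differentiable_cst.
  apply: differentiableM; first exact: differentiable_cst.
  apply: differentiable_exp; apply: differentiableM; first exact: differentiable_cst.
  exact: differentiable_id.
have hol := holomorphic_poly_disc psize (fun z _ => p0 z) pnz (fun z j _ => pdiff z j).
exists (poly_disc p); split; [exact: hol| | |by move=> z; exact: gpoly_poly_disc].
  apply/rowP => j; rewrite !mxE pc big_ord_recl/= muln0/= mulr0 add0r big1// => i _.
  by rewrite mulr0 expr0n/= mulr0 mul0r.
have z1 : disc (0 : C) by rewrite /disc/= expr0n/= addr0 sqrtr0.
have [dp _] := hol 0 z1.
apply/rowP => j; rewrite mxE derive1_coordinate// !mxE.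
have -> : (fun x => poly_disc p x 0 j) = (fun x => (p x)`_j.+1) by apply/funext => x; rewrite mxE.
have D : is_derive (0 : C) 1 (fun x => (p x)`_j.+1) (m%:R * u * (j.+1 == k)%:R).
  under eq_fun do rewrite pc.
  rewrite -fct_sumE.
  (* Of the powers x^i only i = 1 has a nonzero derivative at 0. *)
  have -> : m%:R * u * (j.+1 == k)%:R = \sum_(i < m.+1) (if i == 1%N :> nat then m%:R * u * (j.+1 == k)%:R else 0).
    have m1 : (1 < m.+1)%N by [].
    by rewrite (bigD1 (Ordinal m1))//= big1 ?addr0// => i /negbTE; rewrite -val_eqE/= => ->.
  apply: is_derive_sum => i.
  have -> : (fun x => 'C(m, i)%:R * (u * x) ^+ i * (j.+1 == (k * i)%N)%:R) =
     (fun x => ('C(m, i)%:R * u ^+ i * (j.+1 == (k * i)%N)%:R) *: x ^+ i).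
    by apply/funext => x; rewrite scaleC exprMn; ring.
  have -> : (if i == 1%N :> nat then m%:R * u * (j.+1 == k)%:R else 0) =
     ('C(m, i)%:R * u ^+ i * (j.+1 == (k * i)%N)%:R) *: (i%:R * 0 ^+ i.-1).
    rewrite scaleC; case: i => -[|[|i]] hi /=; rewrite ?mul0r ?mulr0//.
      by rewrite bin1 expr1 muln1 expr0 !mulr1.
    by rewrite expr0n/= !mulr0.
  apply: is_deriveZ.
  have := is_deriveX i (is_derive_id (0 : C) 1); rewrite scaleC mulr1.
  by rewrite exprfctE.
by rewrite (derive1_eq D).
Qed.

Lemma kobayashi_royden_divisor (k : nat) (c : C) : (0 < k <= n)%N -> (k %| n)%N ->
  (kobayashi_royden (symm_polydisc n) 0 (c *: basis_vec n k) <= (nc c * k%:R / n%:R)%:E)%E.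
Proof.
move=> kn kdvd; have [u u1 cu] := phase c.
have [phi [hol phi0 dphi _]] := divisor_disc kn kdvd u1.
apply: ereal_inf_lbound; exists (nc c * k%:R / n%:R) => //; split.
  by rewrite divr_ge0// mulr_ge0// normc_ge0.
exists phi; split => //; rewrite dphi scalerA; congr (_ *: _).
have mk : (n %/ k * k = n)%N by rewrite divnK.
have -> : (nc c * k%:R / n%:R)%:C = (nc c)%:C * k%:R / n%:R.
  by rewrite !rmorphM fmorphV !rmorph_nat.
move: n_gt0; rewrite [in RHS]cu -{1}mk -[in n%:R]mk natrM muln_gt0 => /andP[m0 k0].
have k0' : k%:R != 0 :> C by rewrite pnatr_eq0 -lt0n.
have m0' : (n %/ k)%:R != 0 :> C by rewrite pnatr_eq0 -lt0n.
by move: k0' m0'; move: (k%:R : C) ((n %/ k)%:R : C) => a b' a0 b0; field; rewrite a0 b0.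
Qed.

Lemma rho_subadditive X Y : (rho (X + Y) <= rho X + rho Y)%E.
Proof.
apply: ge_ereal_sup => _ [lam lam1 <-].
apply: (@le_trans _ _ ((nc (n%:R^-1 * \sum_(j < n) j.+1%:R * X 0 j * lam ^+ j))%:E +
   (nc (n%:R^-1 * \sum_(j < n) j.+1%:R * Y 0 j * lam ^+ j))%:E)%E).
  rewrite -EFinD lee_fin; apply: le_trans (ncD _ _).
  rewrite -mulrDr -big_split/= le_eqVlt; apply/orP; left; apply/eqP.
  congr (nc (_ * _)); apply: eq_bigr => j _; rewrite mxE; ring.
by apply: leeD; apply: ereal_sup_ubound; exists lam.
Qed.

Lemma rho_le_kobayashi_royden2 X :
  (rho X <= kobayashi_royden2 (symm_polydisc n) 0 X)%E.
Proof.
apply: le_ereal_inf_tmp => _ [X1 [X2 [<- ->]]].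
apply: (le_trans (rho_subadditive _ _)).
by apply: leeD; exact: rho_le_kobayashi_royden.
Qed.

Lemma rho_sum_basis (k : nat) (c lam : C) : (0 < k <= n)%N ->
  \sum_(j < n) j.+1%:R * (c *: basis_vec n k) 0 j * lam ^+ j = k%:R * c * lam ^+ k.-1.
Proof.
case: k => // k /andP[_ kn]; rewrite (bigD1 (Ordinal kn))//= !mxE eqxx mulr1.
rewrite big1 ?addr0// => j jk; rewrite !mxE eqSS.
by move: jk; rewrite -val_eqE/= => /negbTE ->; rewrite !mulr0 mul0r.
Qed.

Lemma rho_basis (k : nat) (c : C) : (0 < k <= n)%N ->
  rho (c *: basis_vec n k) = (nc c * k%:R / n%:R)%:E.
Proof.
move=> kn.
have E lam : nc lam = 1 -> nc (n%:R^-1 * \sum_(j < n) j.+1%:R * (c *: basis_vec n k) 0 j * lam ^+ j)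
    = nc c * k%:R / n%:R.
  by move=> l1; rewrite rho_sum_basis// !ncM Normc.normcV ncX l1 expr1n mulr1 !nc_nat; ring.
apply/eqP; rewrite eq_le; apply/andP; split.
  by apply: ge_ereal_sup => _ [lam l1 <-]; rewrite E.
apply: ereal_sup_ubound; exists 1; first exact: Normc.normc1.
by rewrite E// Normc.normc1.
Qed.

(** The exponents of [lam] in the two terms differ by l - k > 0, so some [lam] on the circle gives
    both terms the same argument. Hence [rho] is additive along the splitting of X into its two
    components, which is why two discs suffice for [kobayashi_royden2]. *)
Lemma rho_coordinate_span (k l : nat) (a b : C) : (0 < k <= n)%N -> (0 < l <= n)%N -> (k < l)%N ->
  rho (a *: basis_vec n k + b *: basis_vec n l) =
  (nc a * k%:R / n%:R + nc b * l%:R / n%:R)%:E.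
Proof.
move=> kn ln kl; apply/eqP; rewrite eq_le; apply/andP; split.
  by apply: (le_trans (rho_subadditive _ _)); rewrite !rho_basis.
have [ua ua1 aE] := phase a; have [ub ub1 bE] := phase b.
have ub0 : ub != 0 by rewrite -nc_gt0 ub1.
have [lam lam1 lamE] : exists2 lam : C, nc lam = 1 & lam ^+ (l - k) = ua / ub.
  by apply: unimodular_root; rewrite ?subn_gt0// ncM Normc.normcV ua1 ub1 divr1.
apply: ereal_sup_ubound; exists lam => //; congr EFin.
have -> : \sum_(j < n) j.+1%:R * (a *: basis_vec n k + b *: basis_vec n l) 0 j * lam ^+ j =
   k%:R * a * lam ^+ k.-1 + l%:R * b * lam ^+ l.-1.
  rewrite -!rho_sum_basis// -big_split/=; apply: eq_bigr => j _.
  by rewrite mxE; ring.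
have -> : lam ^+ l.-1 = lam ^+ k.-1 * (ua / ub).
  rewrite -lamE -exprD; congr (_ ^+ _).
  by move: kn kl; case: (k) => // k' _; case: (l) => // l' /=; rewrite ltnS subSS => /ltnW/subnKC ->.
have -> : k%:R * a * lam ^+ k.-1 + l%:R * b * (lam ^+ k.-1 * (ua / ub)) =
  (nc a * k%:R + nc b * l%:R)%:C * (ua * lam ^+ k.-1).
  rewrite {1}aE {1}bE rmorphD !rmorphM !rmorph_nat; by field.
rewrite !ncM ua1 ncX lam1 expr1n !mulr1 Normc.normcV nc_nat nc_real ger0_norm; first by ring.
by rewrite addr_ge0// mulr_ge0// normc_ge0.
Qed.

Theorem kobayashi_royden_basis (k : nat) : (1 <= k <= n)%N -> (k %| n)%N ->
  kobayashi_royden (symm_polydisc n) 0 (basis_vec n k : 'rV[C]_n) = rho (basis_vec n k).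
Proof.
move=> kn kdvd; apply/eqP; rewrite eq_le rho_le_kobayashi_royden andbT.
by rewrite -[basis_vec n k]scale1r rho_basis//; exact: kobayashi_royden_divisor.
Qed.

Theorem kobayashi_royden2_span (k l : nat) : (1 <= k <= n)%N -> (1 <= l <= n)%N ->
  (k <= l)%N -> (k %| n)%N -> (l %| n)%N ->
  forall X, coordinate_span n k l X -> kobayashi_royden2 (symm_polydisc n) 0 X = rho X.
Proof.
move=> kn ln kl kd ld X [a [b ->]].
apply/eqP; rewrite eq_le rho_le_kobayashi_royden2 andbT.
have upper (x y : C) j j' : (0 < j <= n)%N -> (0 < j' <= n)%N -> (j %| n)%N -> (j' %| n)%N ->
   (kobayashi_royden2 (symm_polydisc n) 0 (x *: basis_vec n j + y *: basis_vec n j') <=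
     (nc x * j%:R / n%:R + nc y * j'%:R / n%:R)%:E)%E.
  move=> jn j'n jd j'd; apply: (@le_trans _ _
    (kobayashi_royden (symm_polydisc n) 0 (x *: basis_vec n j) +
     kobayashi_royden (symm_polydisc n) 0 (y *: basis_vec n j'))%E).
    by apply: ereal_inf_lbound; eexists; eexists; split; first reflexivity.
  by rewrite EFinD; apply: leeD; exact: kobayashi_royden_divisor.
(* For k = l additivity fails, and X is split as (a + b) e_k + 0 instead. *)
move: kl; rewrite leq_eqVlt => /predU1P[E|kl]; last first.
  by rewrite rho_coordinate_span//; exact: upper.
rewrite -E in ln ld *; rewrite -scalerDl rho_basis//.
have := upper (a + b) 0 k k kn kn kd kd.
by rewrite scale0r addr0 Normc.normc0 !mul0r addr0.
Qed.

End AnalyticDiscs.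

(** * Power sums as functions on C^n, and their perturbation when k does not divide n *)

Section PowerSums.
Context {R : realType}.
Local Notation C := R[i].
Local Notation Re := (@complex.Re R).
Local Notation Im := (@complex.Im R).
Local Notation nc := (@Normc.normc R).
Local Open Scope complex_scope.
Variable n : nat.
Implicit Types (s z : 'rV[C]_n).

(* The choice of the roots is immaterial, by [pws_symm]. *)
Definition pws s (k : nat) : C := psum (sval (cid (symm_surj s))) k.

Lemma newton_pws s k : k.+1%:R * elsym s k.+1 =
  \sum_(i < k.+1) (-1) ^+ i * elsym s (k - i) * pws s i.+1.
Proof. by rewrite /pws; case: cid => z /= <-; exact: newton. Qed.

Lemma sumBS (f : nat -> C) (k : nat) : f k = \sum_(i < k.+1) f i - \sum_(i < k) f i.
Proof. by rewrite big_ord_recr/= addrAC subrr add0r. Qed.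

(** Newton's identity solved for the last power sum. It expresses the power sums through the
    coordinates of [s] alone, hence their independence of the chosen roots and their holomorphy
    along discs. *)
Lemma pws_rec s k : pws s k.+1 = (-1) ^+ k *
  (k.+1%:R * elsym s k.+1 - \sum_(i < k) (-1) ^+ i * elsym s (k - i) * pws s i.+1).
Proof.
rewrite newton_pws -(sumBS (fun i => (-1) ^+ i * elsym s (k - i) * pws s i.+1)).
by rewrite subnn elsym0 mulr1 mulrA -exprD -signr_odd oddD addbb expr0 mul1r.
Qed.

Lemma pws_symm z k : (0 < k)%N -> pws (symm z) k = psum z k.
Proof.
case: k => // k _; elim/ltn_ind: k => k IH.
have E : psum z k.+1 = (-1) ^+ k * (k.+1%:R * elsym (symm z) k.+1 -
    \sum_(i < k) (-1) ^+ i * elsym (symm z) (k - i) * psum z i.+1).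
  rewrite newton -(sumBS (fun i => (-1) ^+ i * elsym (symm z) (k - i) * psum z i.+1)).
  by rewrite subnn elsym0 mulr1 mulrA -exprD -signr_odd oddD addbb expr0 mul1r.
rewrite E pws_rec; congr (_ * (_ - _)); apply: eq_bigr => i _.
by rewrite IH.
Qed.

Lemma pws_lowest s k : (forall j, (0 < j < k)%N -> elsym s j = 0) ->
  (forall j, (0 < j < k)%N -> pws s j = 0) /\
  ((0 < k)%N -> pws s k = (-1) ^+ k.-1 * (k%:R * elsym s k)).
Proof.
move=> H.
have low j : (0 < j < k)%N -> pws s j = 0.
  case: j => // j /= jk; rewrite pws_rec H ?jk// mulr0 sub0r big1 ?oppr0 ?mulr0// => i _.
  rewrite H ?mulr0 ?mul0r// subn_gt0 ltn_ord/=.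
  by apply: leq_ltn_trans (leq_subr _ _) _; exact: ltn_trans jk.
split => //; case: (k) low => // k' low _; rewrite pws_rec/=; congr (_ * _).
rewrite big1 ?subr0// => i _.
by rewrite low ?mulr0//= ltnS ltn_ord.
Qed.

Lemma elsym_0 k : (0 < k)%N -> elsym (0 : 'rV[C]_n) k = 0.
Proof.
case: k => // k _; have [kn|kn] := boolP (k < n)%N; last exact: elsym_out.
by rewrite (elsym_lt _ kn) mxE.
Qed.

Lemma pws_0 k : (0 < k)%N -> pws (0 : 'rV[C]_n) k = 0.
Proof.
move=> k0; have [_ H] : _ /\ _ := pws_lowest (fun j (jk : (0 < j < k)%N) => elsym_0 (proj1 (andP jk))).
by rewrite H// elsym_0// !mulr0.
Qed.

Section AlongDisc.
Variable phi : C -> 'rV[C]_n.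

Lemma differentiable_pws (x : C) k : differentiable phi x ->
  differentiable (fun w => pws (phi w) k.+1) x.
Proof.
move=> dphi; elim/ltn_ind: k => k IH.
under eq_fun do rewrite pws_rec.
apply: differentiableM; first exact: differentiable_cst.
apply: differentiableB.
  by apply: differentiableM; [exact: differentiable_cst|exact: differentiable_elsym].
rewrite -fct_sumE; apply: differentiable_sum => i.
apply: differentiableM; last exact: IH.
by apply: differentiableM; [exact: differentiable_cst|exact: differentiable_elsym].
Qed.

(** In the recursion every product has two factors vanishing at 0, so only the term linear in the
    coordinates survives. *)
Lemma is_derive_pws k : differentiable phi 0 -> phi 0 = 0 ->
  is_derive (0 : C) 1 (fun w => pws (phi w) k.+1)
    ((-1) ^+ k * (k.+1%:R * derive1 (fun w => elsym (phi w) k.+1) 0)).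
Proof.
move=> dphi phi0; elim/ltn_ind: k => k IH.
have de j : is_derive (0 : C) 1 (fun w => elsym (phi w) j) (derive1 (fun w => elsym (phi w) j) 0).
  exact/derive1_is_derive/differentiable_elsym.
have dt (i : 'I_k) : is_derive (0 : C) 1
    (fun w => (-1) ^+ i * elsym (phi w) (k - i) * pws (phi w) i.+1) 0.
  have D := is_deriveZ ((-1) ^+ i) (is_deriveM (de (k - i)%N) (IH i (ltn_ord i))).
  rewrite phi0 pws_0// elsym_0 ?subn_gt0// !scale0r addr0 scaler0 in D.
  have -> : (fun w => (-1) ^+ i * elsym (phi w) (k - i) * pws (phi w) i.+1) =
    (-1) ^+ i \*: ((fun w => elsym (phi w) (k - i)) * (fun w => pws (phi w) i.+1)).
    by apply/funext => w; rewrite -mulrA.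
  exact: D.
have ds := is_derive_sum dt; rewrite [X in is_derive _ _ _ X]big1// fct_sumE in ds.
have := is_deriveZ ((-1) ^+ k) (is_deriveB (is_deriveZ k.+1%:R (de k.+1)) ds).
rewrite subr0 !scaleC.
have -> : (-1) ^+ k \*: (k.+1%:R \*: (fun w => elsym (phi w) k.+1) -
    (fun x => \sum_(i < k) (-1) ^+ i * elsym (phi x) (k - i) * pws (phi x) i.+1)) =
    (fun w => pws (phi w) k.+1).
  by apply/funext => w; rewrite pws_rec.
by [].
Qed.

End AlongDisc.

(* [pairing] is positive where [psum k] has maximal modulus, unless [k]
   divides [n]: it is the sum of the [|psum j|^2] when all [z_j ^ k] agree. *)
Definition pairing (p : nat -> C) (k : nat) :=
  \sum_(j < k.-1) p j.+1 * p (k - j.+1)%N.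

Lemma sum_geometric_unity (k : nat) (x : C) : (0 < k)%N -> x ^+ k = 1 ->
  \sum_(j < k) x ^+ j = (if x == 1 then k%:R else 0).
Proof.
move=> k0 xk; case: eqP => [->|/eqP x1].
  by under eq_bigr do rewrite expr1n; rewrite sumr_const card_ord.
have /eqP := subrX1 x k; rewrite xk subrr eq_sym mulf_eq0 subr_eq0 (negbTE x1)/=.
by move/eqP.
Qed.

Lemma psum_extremal z k : (0 < k)%N -> ~~ (k %| n)%N ->
  (forall j, nc (z 0 j) <= 1) -> nc (psum z k) = n%:R ->
  0 < Re (psum z k * conjc (pairing (psum z) k)).
Proof.
move=> k0 kn z1 pn.
have n0 : (0 < n)%N by case: (n) kn => //; rewrite dvdn0.
have nR : 0 < n%:R :> R by rewrite ltr0n.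
have nC : n%:R != 0 :> C by rewrite pnatr_eq0 -lt0n.
pose c := psum z k / n%:R.
have c1 : nc c = 1 by rewrite ncM Normc.normcV nc_nat pn divff// lt0r_neq0.
have zk1 j : nc (z 0 j ^+ k) <= 1 by rewrite ncX exprn_ile1// normc_ge0.
have Re1 j : Re (z 0 j ^+ k * conjc c) <= 1.
  by apply: (le_trans (Re_le_nc _)); rewrite ncM ncJ c1 mulr1.
(* Equality in the triangle inequality: nonnegative terms with sum 0 vanish, so every z_j^k equals
   [c]. *)
have sumE : \sum_(j < n) (1 - Re (z 0 j ^+ k * conjc c)) = 0.
  rewrite sumrB sumr_const card_ord -(raddf_sum (@complex.Re R)) -mulr_suml -/(psum z k).
  have -> : psum z k = n%:R * c by rewrite /c mulrC divfK.
  rewrite -mulrA mulcJ c1 expr1n mulr1.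
  by rewrite -(rmorph_nat (real_complex R)) subrr.
have zkc j : z 0 j ^+ k = c.
  have H : 1 - Re (z 0 j ^+ k * conjc c) = 0.
    have /eqP := sumE; rewrite psumr_eq0 => [/allP/(_ j)|i _]; last by rewrite subr_ge0.
    by rewrite mem_index_enum => /(_ isT)/eqP.
  apply/eqP; rewrite -subr_eq0 -nc_eq0 -sqrf_eq0 eq_le sqr_ge0 andbT.
  move: H c1 (zk1 j); set y := z 0 j ^+ k => H c1' y1.
  have y2 : nc y ^+ 2 <= 1 by rewrite expr_le1// normc_ge0.
  have c2 : nc c ^+ 2 = 1 by rewrite c1' expr1n.
  move: H y2 c2; rewrite !nc_sqr Re_mul Re_sub Im_sub Re_conjc Im_conjc; nra.
have zn1 j : nc (z 0 j) = 1.
  by apply/eqP; rewrite -(pexpr_eq1 k0) ?normc_ge0// -ncX zkc c1.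
have conjE j i : (j <= k)%N -> z 0 i ^+ (k - j) = c * conjc (z 0 i ^+ j).
  move=> jk; have zi0 : z 0 i ^+ j != 0 by rewrite expf_neq0// -nc_gt0 zn1.
  apply: (mulIf zi0); rewrite -exprD subnK// zkc -mulrA [conjc _ * _]mulrC mulcJ.
  by rewrite ncX zn1 !expr1n mulr1.
have pE j : (j <= k)%N -> psum z (k - j) = c * conjc (psum z j).
  move=> jk; rewrite /psum raddf_sum/= mulr_sumr; apply: eq_bigr => i _.
  exact: conjE.
have QE : pairing (psum z) k = c * (\sum_(j < k.-1) nc (psum z j.+1) ^+ 2)%:C.
  rewrite /pairing raddf_sum/= mulr_sumr; apply: eq_bigr => j _.
  have jk : (j.+1 <= k)%N by apply: leq_trans (ltn_ord j) (leq_pred _).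
  by rewrite (pE _ jk) mulrCA mulcJ.
have -> : psum z k = n%:R * c by rewrite /c mulrC divfK.
rewrite QE conjcM conjc_real.
have -> : n%:R * c * (conjc c * (\sum_(j < k.-1) nc (psum z j.+1) ^+ 2)%:C) =
   (n%:R * \sum_(j < k.-1) nc (psum z j.+1) ^+ 2)%:C.
  set S := \sum_(j < k.-1) _.
  rewrite (rmorphM (real_complex R)) (rmorph_nat (real_complex R)).
  transitivity (n%:R * (c * conjc c) * S%:C); first by ring.
  by rewrite mulcJ c1 expr1n mulr1.
rewrite /= mulr_gt0// lt_def sumr_ge0 ?andbT; last by move=> j _; rewrite sqr_ge0.
apply/negP; rewrite psumr_eq0; last by move=> j _; rewrite sqr_ge0.
move=> /allP H.
have p0 j : (0 < j < k)%N -> psum z j = 0.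
  case: j => // j /= jk; have jk' : (j < k.-1)%N by rewrite -ltnS prednK.
  have := H (Ordinal jk'); rewrite mem_index_enum => /(_ isT).
  by rewrite sqrf_eq0 nc_eq0 => /eqP.
move/negP: kn; apply.
pose i0 := Ordinal n0.
have w0 : z 0 i0 != 0 by rewrite -nc_gt0 zn1.
(* The double sum of (z_i / z_0)^j over i and j < k is counted twice. Summed over j first it gives k
   for each coordinate equal to z_0 and 0 otherwise, since the ratios are k-th roots of unity.
   Summed over i first only j = 0 contributes, namely n, since the lower power sums vanish. *)
pose m := #|[pred i | z 0 i == z 0 i0]|.
suff E : n = (k * m)%N by rewrite [n in (_ %| n)%N]E dvdn_mulr.
apply/eqP; rewrite -(@eqr_nat C) natrM; apply/eqP.
have E1 i : \sum_(j < k) (z 0 i / z 0 i0) ^+ j = (if z 0 i == z 0 i0 then k%:R else 0).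
  rewrite sum_geometric_unity//; last by rewrite expr_div_n !zkc divff// -nc_gt0 c1.
  by rewrite -(inj_eq (mulIf w0)) divfK// mul1r.
have : \sum_i \sum_(j < k) (z 0 i / z 0 i0) ^+ j = k%:R * m%:R.
  under eq_bigr do rewrite E1.
  by rewrite -big_mkcond/= sumr_const mulr_natr.
rewrite exchange_big/= => <-.
have k1 : (k = k.-1.+1)%N by rewrite prednK.
rewrite k1 big_ord_recl/= [X in _ + X]big1.
  by rewrite addr0; under eq_bigr do rewrite expr0; rewrite sumr_const card_ord.
move=> j _; under eq_bigr do rewrite expr_div_n.
rewrite -mulr_suml -/(psum z (bump 0 j)) p0 ?mul0r//.
by rewrite /bump/= add1n -ltn_predRL ltn_ord.
Qed.

Lemma differentiable_psum (z : 'rV[C]_n) k : differentiable (fun w : 'rV[C]_n => psum w k) z.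
Proof.
rewrite /psum -fct_sumE; apply: differentiable_sum => j.
case: k => [|k]; first by under eq_fun do rewrite expr0; exact: differentiable_cst.
have := differentiableX k (differentiable_coord z 0 j).
by rewrite exprfctE.
Qed.

Lemma differentiable_pairing (z : 'rV[C]_n) k :
  differentiable (fun w : 'rV[C]_n => pairing (psum w) k) z.
Proof.
rewrite /pairing -fct_sumE; apply: differentiable_sum => j.
by apply: differentiableM; exact: differentiable_psum.
Qed.

Lemma continuous_Re : continuous (@complex.Re R : C -> R).
Proof.
move=> z; apply/(cvgrPdist_lt (F := nbhs z)) => e e0; apply/nbhs_nc; exists e => // w wz.
by apply: le_lt_trans wz; rewrite -Re_sub nc_distC; exact: Re_nc.
Qed.

Lemma continuous_Im : continuous (@complex.Im R : C -> R).
Proof.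
move=> z; apply/(cvgrPdist_lt (F := nbhs z)) => e e0; apply/nbhs_nc; exists e => // w wz.
by apply: le_lt_trans wz; rewrite -Im_sub nc_distC; exact: Im_nc.
Qed.

Lemma compact_polydisc : compact [set z : 'rV[C]_n | forall j, nc (z 0 j) <= 1].
Proof.
exact: (@rV_compact C n (fun=> [set w : C | nc w <= 1]) (fun=> @compact_disc R 1)).
Qed.

(** Applied to |P - a Q|^2 = |P|^2 - 2 a Re (P conjc Q) + a^2 |Q|^2. Near a point with u = L the
    linear term is strictly negative and dominates the quadratic one; near any other point a small
    [a] cannot lift [u] to L. Compactness makes the choice of [a] uniform. *)
Lemma perturb_maximum (T : topologicalType) (K : set T) (u w q : T -> R) (L : R) :
  compact K -> K !=set0 -> continuous u -> continuous w -> continuous q ->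
  (forall x, K x -> u x <= L) -> (forall x, K x -> u x = L -> 0 < w x) ->
  exists2 a : R, 0 < a & exists2 M : R, M < L &
    forall x, K x -> u x - 2 * a * w x + a ^+ 2 * q x <= M.
Proof.
move=> cK K0 cu cw cq uL wL.
have cf a : continuous (fun z : T => u z - 2 * a * w z + a ^+ 2 * q z).
  move=> x; apply: cvgD; last by apply: cvgM; [exact: cvg_cst|exact: cq].
  by apply: cvgB; [exact: cu|apply: cvgM; [exact: cvg_cst|exact: cw]].
have near_neg : \forall a \near (0 : R)^'+, K `<=` [set z : T | K z -> u z - 2 * a * w z + a ^+ 2 * q z < L].
  have := (compact_near_coveringP K).1 cK R (0 : R)^'+
    (fun a (z : T) => K z -> u z - 2 * a * w z + a ^+ 2 * q z < L) _; apply.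
  move=> z Kz.
  have Q0 : 0 < `|q z| + 1 by rewrite ltr_wpDl.
  have W0 : 0 < `|w z| + 1 by rewrite ltr_wpDl.
  have right_itv (a0 : R) : 0 < a0 -> (0 : R)^'+ [set a | 0 < a < a0].
    move=> a00; near=> a; apply/andP; split; near: a; [exact: nbhs_right_gt|exact: nbhs_right_lt].
  have qb : \forall z' \near z, q z' < `|q z| + 1.
    have := cq z; move/cvgrPdist_lt => /(_ 1 ltr01); apply: filterS => z'.
    rewrite distrC => H; have := ler_norm (q z' - q z); have := ler_norm (q z); lra.
  have [uz|uz] := eqVneq (u z) L.
    have w0 := wL z Kz uz.
    have wb : \forall z' \near z, w z / 2 < w z'.
      have := cw z; move/cvgrPdist_lt => /(_ (w z / 2)); rewrite divr_gt0// => /(_ isT).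
      by apply: filterS => z' H; have := ler_norm (w z - w z'); lra.
    exists ([set z' | q z' < `|q z| + 1] `&` [set z' | w z / 2 < w z'],
            [set a | 0 < a < w z / (`|q z| + 1)]).
      by split; [exact: filterI|apply: right_itv; rewrite divr_gt0].
    move=> [z' a] [/= [qz' wz'] /andP[a0]]; rewrite ltr_pdivlMr// => aw Kz'.
    have := uL z' Kz'.
    have A1 : a * (w z / 2) < a * w z' by rewrite ltr_pM2l.
    have A2 : a * (a * q z') <= a * (a * (`|q z| + 1)) by rewrite !ler_pM2l// ltW.
    have A3 : a * (a * (`|q z| + 1)) < a * w z by rewrite ltr_pM2l.
    rewrite expr2; lra.
  have uz' : u z < L by rewrite lt_neqAle uz uL.
  have ub : \forall z' \near z, u z' < (u z + L) / 2.
    have := cu z; move/cvgrPdist_lt => /(_ ((L - u z) / 2)); rewrite divr_gt0 ?subr_gt0// => /(_ isT).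
    by apply: filterS => z'; rewrite distrC => H; have := ler_norm (u z' - u z); lra.
  have wb : \forall z' \near z, - w z' < `|w z| + 1.
    have := cw z; move/cvgrPdist_lt => /(_ 1 ltr01); apply: filterS => z' H.
    have := ler_norm (w z - w z'); have := ler_norm (- w z); rewrite normrN; lra.
  pose B := 2 * (`|w z| + 1) + (`|q z| + 1).
  have B0 : 0 < B by rewrite /B; lra.
  exists ([set z' | u z' < (u z + L) / 2] `&` [set z' | - w z' < `|w z| + 1] `&`
      [set z' | q z' < `|q z| + 1], [set a | 0 < a < Num.min 1 ((L - u z) / 2 / B)]).
    split; first by apply: filterI => //; exact: filterI.
    by apply: right_itv; rewrite lt_min ltr01 !divr_gt0// subr_gt0.
  move=> [z' a] [/= [[uz'' wz'] qz'] /andP[a0]]; rewrite lt_min => /andP[a1].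
  rewrite ltr_pdivlMr// => aB Kz'.
  have A1 : a * (- w z') < a * (`|w z| + 1) by rewrite ltr_pM2l.
  have A2 : a * (a * q z') <= a * (a * (`|q z| + 1)) by rewrite !ler_pM2l// ltW.
  have A3 : a * (a * (`|q z| + 1)) <= a * (1 * (`|q z| + 1)).
    by rewrite ler_pM2l// ler_wpM2r ?ltW.
  move: aB; rewrite /B expr2; lra.
have [a [a0 aL]] : exists a : R, 0 < a /\ K `<=` [set z : T | K z -> u z - 2 * a * w z + a ^+ 2 * q z < L].
  have : \forall a \near (0 : R)^'+, 0 < a /\ K `<=` [set z : T | K z -> u z - 2 * a * w z + a ^+ 2 * q z < L].
    by apply: filterI => //; exact: nbhs_right_gt.
  by move=> /filter_ex[a Ha]; exists a.
exists a => //.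
have [z0 Kz0 zmax] := compact_EVT_max K0 cK (continuous_subspaceT (cf a)).
rewrite inE in Kz0; exists (u z0 - 2 * a * w z0 + a ^+ 2 * q z0); first exact: aL.
by move=> z Kz; apply: zmax; rewrite inE.
Unshelve. all: by end_near. Qed.

Theorem nondivisor_function (k : nat) : (0 < k <= n)%N -> ~~ (k %| n)%N ->
  exists2 a : R, 0 < a & exists2 M : R, 0 < M < n%:R &
    forall s, symm_polydisc n s ->
      nc (pws s k - a%:C * pairing (pws s) k) <= M.
Proof.
move=> /andP[k0 kn] kdvd.
have nR : 0 < n%:R :> R by rewrite ltr0n (leq_trans k0 kn).
pose P (z : 'rV[C]_n) := psum z k; pose Q (z : 'rV[C]_n) := pairing (psum z) k.
have cP : continuous P by move=> z; exact/differentiable_continuous/differentiable_psum.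
have cQ : continuous Q by move=> z; exact/differentiable_continuous/differentiable_pairing.
have cncP : continuous (fun z => nc (P z) ^+ 2).
  have cN : continuous (fun z => nc (P z)).
    by move=> z; apply: (@continuous_comp _ _ _ P nc); [exact: cP|exact: continuous_nc_norm].
  have -> : (fun z => nc (P z) ^+ 2) = (fun z => nc (P z) * nc (P z)).
    by apply/funext => z; rewrite expr2.
  by move=> z; apply: (@cvgM _ _ (nbhs z) _); exact: cN.
have cncQ : continuous (fun z => nc (Q z) ^+ 2).
  have cN : continuous (fun z => nc (Q z)).
    by move=> z; apply: (@continuous_comp _ _ _ Q nc); [exact: cQ|exact: continuous_nc_norm].
  have -> : (fun z => nc (Q z) ^+ 2) = (fun z => nc (Q z) * nc (Q z)).
    by apply/funext => z; rewrite expr2.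
  by move=> z; apply: (@cvgM _ _ (nbhs z) _); exact: cN.
have cw : continuous (fun z => Re (P z * conjc (Q z))).
  have -> : (fun z => Re (P z * conjc (Q z))) = (fun z => Re (P z) * Re (Q z) + Im (P z) * Im (Q z)).
    by apply/funext => z; rewrite Re_mul Re_conjc Im_conjc mulrN opprK.
  move=> z; apply: (@cvgD _ _ _ (nbhs z) _); apply: (@cvgM _ _ (nbhs z) _).
  - by apply: (@continuous_comp _ _ _ P Re); [exact: cP|exact: continuous_Re].
  - by apply: (@continuous_comp _ _ _ Q Re); [exact: cQ|exact: continuous_Re].
  - by apply: (@continuous_comp _ _ _ P Im); [exact: cP|exact: continuous_Im].
  - by apply: (@continuous_comp _ _ _ Q Im); [exact: cQ|exact: continuous_Im].
have K0 : [set z : 'rV[C]_n | forall j, nc (z 0 j) <= 1] !=set0.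
  by exists 0 => j; rewrite mxE Normc.normc0.
have [||a a0 [M ML HM]] := @perturb_maximum _ _ _ _ _ (n%:R ^+ 2) compact_polydisc K0 cncP cw cncQ.
- move=> z z1; have : nc (P z) <= n%:R.
    apply: (le_trans (nc_sum _ _ _)).
    have -> : n%:R = \sum_(j < n) 1 :> R by rewrite sumr_const card_ord.
    by apply: ler_sum => j _; rewrite ncX exprn_ile1 ?normc_ge0//; exact: z1.
  by move=> H; apply: lerXn2r; rewrite ?nnegrE ?normc_ge0.
- move=> z z1 /eqP; rewrite eqrXn2// ?normc_ge0// => /eqP.
  exact: psum_extremal.
exists a => //.
have M0 : 0 <= Num.max M 0 by rewrite le_max lexx orbT.
have sM : Num.sqrt (Num.max M 0) < n%:R.
  rewrite -(ltr_pXn2r (n := 2)) ?nnegrE ?sqrtr_ge0 ?ltW// sqr_sqrtr// gt_max ML/=.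
  by rewrite exprn_gt0.
(* Averaging with n makes the bound strictly positive, so that it can be divided by, while it stays
   below n. *)
exists ((Num.sqrt (Num.max M 0) + n%:R) / 2).
  by have := sqrtr_ge0 (Num.max M 0); move=> ?; apply/andP; split; lra.
move=> s [z z1 <-].
have -> : pws (symm z) k = P z by exact: pws_symm.
have -> : pairing (pws (symm z)) k = Q z.
  apply: eq_bigr => j _; rewrite !pws_symm// subn_gt0.
  by rewrite -ltn_predRL ltn_ord.
apply: (@le_trans _ _ (Num.sqrt (Num.max M 0))); last by lra.
rewrite -(ler_pXn2r (n := 2)) ?nnegrE ?normc_ge0 ?sqrtr_ge0// sqr_sqrtr//.
rewrite le_max; apply/orP; left.
apply: le_trans (HM z _); last by move=> j; exact/ltW/z1.
rewrite le_eqVlt; apply/orP; left; apply/eqP; rewrite !nc_sqr Re_mul Re_sub Im_sub.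
rewrite Re_conjc Im_conjc Re_mul Im_mul /=; ring.
Qed.

End PowerSums.

(** * The case of a non-divisor: lower bounds for the Kobayashi-Buseman metric and the Kobayashi
    distance *)

Section Nondivisor.
Context {R : realType}.
Local Notation C := R[i].
Local Notation Re := (@complex.Re R).
Local Notation Im := (@complex.Im R).
Local Notation nc := (@Normc.normc R).
Local Open Scope complex_scope.

Lemma artanh_ge (x : R) : 0 <= x < 1 -> x <= artanh x.
Proof.
move=> /andP[x0 x1]; rewrite /artanh.
have [->|xn0] := eqVneq x 0; first by rewrite addr0 subr0 divr1 ln1 mul0r.
have {xn0}x0 : 0 < x by rewrite lt_def xn0.
pose h (t : R) := ln (1 + t) - ln (1 - t) - 2 * t.
have dh (t : R) : 0 <= t < 1 -> is_derive t 1 h ((1 + t)^-1 + (1 - t)^-1 - 2).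
  move=> /andP[t0 t1].
  have p1 : 0 < 1 + t by lra.
  have p2 : 0 < 1 - t by lra.
  have E1 : is_derive t 1 (fun t : R => 1 + t) 1.
    by have := is_deriveD (is_derive_cst (1 : R) t 1) (is_derive_id t 1); rewrite add0r.
  have E2 : is_derive t 1 (fun t : R => 1 - t) (- 1).
    by have := is_deriveB (is_derive_cst (1 : R) t 1) (is_derive_id t 1); rewrite sub0r.
  have D1 : is_derive t 1 (fun t => ln (1 + t)) ((1 + t)^-1).
    by have := @is_derive1_comp R (@ln R) (fun t => 1 + t) t _ _ (is_derive1_ln p1) E1; rewrite mulr1.
  have D2 : is_derive t 1 (fun t => ln (1 - t)) (- (1 - t)^-1).
    by have := @is_derive1_comp R (@ln R) (fun t => 1 - t) t _ _ (is_derive1_ln p2) E2; rewrite mulrN mulr1.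
  have D3 : is_derive t 1 (fun t : R => 2 * t) 2.
    by have := is_deriveZ 2 (is_derive_id t 1); rewrite /GRing.scale/= mulr1.
  have := is_deriveB (is_deriveB D1 D2) D3; rewrite opprK; exact.
have [c] : exists2 c, c \in `]0, x[ & h x - h 0 = ((1 + c)^-1 + (1 - c)^-1 - 2) * (x - 0).
  apply: MVT => //.
    by move=> t; rewrite in_itv/= => /andP[t0 tx]; apply: dh; rewrite (ltW t0) (lt_trans tx).
  apply: derivable_within_continuous => t; rewrite in_itv/= => /andP[t0 tx].
  by have [] := dh t; first by rewrite t0 (le_lt_trans tx).
rewrite in_itv/= => /andP[c0 cx].
have c1 : c < 1 by exact: lt_trans x1.
have c2 : 0 < 1 - c ^+ 2 by rewrite subr_gt0 expr_lt1// ltW.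
have -> : (1 + c)^-1 + (1 - c)^-1 - 2 = 2 * c ^+ 2 / (1 - c ^+ 2).
  by field; apply/and3P; split; apply: lt0r_neq0; lra.
rewrite /h addr0 subr0 ln1 subrr mulr0 !subr0 => E.
have : 0 <= 2 * c ^+ 2 / (1 - c ^+ 2) * x.
  by rewrite mulr_ge0 ?divr_ge0 ?mulr_ge0 ?sqr_ge0 ?ltW.
rewrite -E lnM ?posrE ?invr_gt0; [|lra..].
rewrite lnV ?posrE; last by lra.
by rewrite ler_pdivlMr//; lra.
Qed.

Lemma artanh_le (y : R) : 0 <= y < 1 -> artanh y <= y / (1 - y).
Proof.
move=> /andP[y0 y1]; rewrite /artanh.
have d0 : 0 < 1 - y by lra.
have E : (1 + y) / (1 - y) = 1 + 2 * (y / (1 - y)) by field; exact: lt0r_neq0.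
rewrite E ler_pdivrMr// mulrC; apply: le_ln1Dx.
by apply: (@lt_le_trans _ _ 0) => //; rewrite mulr_ge0 ?divr_ge0// ltW.
Qed.

Lemma artanh_mono (x y : R) : 0 <= x -> x <= y -> y < 1 -> artanh x <= artanh y.
Proof.
move=> x0 xy y1; rewrite /artanh ler_pM2r ?invr_gt0//.
rewrite ler_ln ?posrE ?divr_gt0; [|lra..].
rewrite ler_pdivrMr; last by lra.
rewrite mulrAC ler_pdivlMr; last by lra.
lra.
Qed.

Lemma artanh_inj_le (x y : R) : 0 <= x < 1 -> 0 <= y < 1 -> artanh x <= artanh y -> x <= y.
Proof.
move=> /andP[x0 x1] /andP[y0 y1]; rewrite /artanh ler_pM2r ?invr_gt0//.
rewrite ler_ln ?posrE ?divr_gt0; [|lra..].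
rewrite ler_pdivrMr; last by lra.
rewrite mulrAC ler_pdivlMr; last by lra.
lra.
Qed.

Lemma artanh_double (d : R) : 0 <= d < 1 -> artanh (2 * d / (1 + d ^+ 2)) = 2 * artanh d.
Proof.
move=> /andP[d0 d1]; rewrite /artanh.
have p0 : 0 < 1 + d ^+ 2 by rewrite ltr_pwDl// sqr_ge0.
have pm : 0 < 1 - d by lra.
have E : (1 + 2 * d / (1 + d ^+ 2)) / (1 - 2 * d / (1 + d ^+ 2)) = ((1 + d) / (1 - d)) ^+ 2.
  have p2 : 1 + d ^+ 2 - 2 * d != 0.
    have -> : 1 + d ^+ 2 - 2 * d = (1 - d) ^+ 2 by ring.
    by rewrite expf_neq0// lt0r_neq0.
  by field; rewrite ?p2 ?lt0r_neq0.
rewrite E lnXn ?posrE ?divr_gt0//; last by lra.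
by rewrite mulr2n; lra.
Qed.

(** With d = |a - b| one has |1 - conjc b * a| <= 1 + (d/2)^2, so rho >= d / (1 + (d/2)^2), the
    doubling formula at d/2; hence artanh rho >= 2 artanh (d/2) >= d. This makes the Euclidean
    distance of the values of a function bounded by 1 a pseudodistance below the Lempert function,
    even if values on the circle occur. *)
Lemma euclidean_le_poincare (a b : C) (rho : R) : nc a <= 1 -> nc b <= 1 -> 0 <= rho < 1 ->
  nc (a - b) <= rho * nc (1 - conjc b * a) -> nc (a - b) <= artanh rho.
Proof.
move=> a1 b1 /andP[rho0 rho1] H.
set d := nc (a - b) in H *; have d0 : 0 <= d by exact: normc_ge0.
have D : nc (1 - conjc b * a) <= 1 + (d / 2) ^+ 2.
  rewrite -(ler_pXn2r (n := 2)) ?nnegrE ?normc_ge0 ?addr_ge0 ?sqr_ge0//.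
  rewrite moebius_identity -/d.
  have A2 : nc a ^+ 2 <= 1 by rewrite expr_le1// normc_ge0.
  have B2 : nc b ^+ 2 <= 1 by rewrite expr_le1// normc_ge0.
  have dab : d <= nc a + nc b by exact: ncB.
  have S : d ^+ 2 / 2 <= nc a ^+ 2 + nc b ^+ 2.
    have : d ^+ 2 <= (nc a + nc b) ^+ 2.
      by apply: lerXn2r; rewrite ?nnegrE ?addr_ge0 ?normc_ge0.
    have := sqr_ge0 (nc a - nc b); lra.
  move: A2 B2 S; set x := nc a ^+ 2; set y := nc b ^+ 2; set t := d ^+ 2 => A2 B2 S.
  have -> : (d / 2) ^+ 2 = t / 4 by rewrite /t; field.
  have : 0 <= (2 - x - y) by lra.
  have : 2 - x - y <= 2 - t / 2 by lra.
  have := sqr_ge0 (x - y); nra.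
have d2 : d < 2.
  have : d <= rho * (1 + (d / 2) ^+ 2) by apply: (le_trans H); rewrite ler_wpM2l.
  move=> H2; rewrite ltNge; apply/negP => d2.
  have : d <= nc a + nc b by exact: ncB.
  move=> dab; have dE : d = 2 by lra.
  move: H2; rewrite dE divff// expr1n; lra.
have dh : 0 <= d / 2 < 1 by apply/andP; split; lra.
have L : 2 * (d / 2) / (1 + (d / 2) ^+ 2) <= rho.
  rewrite ler_pdivrMr ?ltr_pwDl ?sqr_ge0// mulrC divfK//.
  by apply: (le_trans H); rewrite ler_wpM2l.
apply: (le_trans _ (artanh_mono _ L rho1)); last first.
  by rewrite divr_ge0 ?addr_ge0 ?sqr_ge0// mulr_ge0// divr_ge0.
rewrite artanh_double//; have := artanh_ge dh; lra.
Qed.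

Variable n : nat.
Implicit Types (s X : 'rV[C]_n).

Section Functional.
Variables (k : nat) (a M : R).
Hypotheses (kn : (0 < k <= n)%N) (M0 : 0 < M).
Hypothesis FM : forall s, symm_polydisc n s ->
  nc (pws s k - a%:C * pairing (pws s) k) <= M.

Let F s := (pws s k - a%:C * pairing (pws s) k) / M%:C.

Let n0 : (0 < n)%N.
Proof. by have /andP[k0 kn'] := kn; exact: leq_trans kn'. Qed.

Lemma functional_le1 s : symm_polydisc n s -> nc (F s) <= 1.
Proof.
move=> Gs; rewrite /F ncM Normc.normcV nc_real gtr0_norm// ler_pdivrMr// mul1r.
exact: FM.
Qed.

Lemma functional0 : F 0 = 0.
Proof.
have /andP[k0 _] := kn.
rewrite /F pws_0// /pairing big1 ?mulr0 ?subr0 ?mul0r// => j _.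
by rewrite pws_0// mul0r.
Qed.

Lemma differentiable_functional (phi : C -> 'rV[C]_n) z : differentiable phi z ->
  differentiable (fun w => F (phi w)) z.
Proof.
have /andP[k0 _] := kn => dphi.
apply: differentiableM; last exact: differentiable_cst.
apply: differentiableB.
  by have := differentiable_pws k.-1 dphi; rewrite prednK.
apply: differentiableM; first exact: differentiable_cst.
rewrite /pairing -fct_sumE; apply: differentiable_sum => j.
apply: differentiableM; first exact: differentiable_pws.
have jk : (0 < k - j.+1)%N by rewrite subn_gt0 -ltn_predRL ltn_ord.
by have := differentiable_pws (k - j.+1).-1 dphi; rewrite (prednK jk).
Qed.

Lemma derive1_functional (phi : C -> 'rV[C]_n) : differentiable phi 0 -> phi 0 = 0 ->
  derive1 (fun w => F (phi w)) 0 =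
  (-1) ^+ k.-1 * (k%:R * derive1 (fun w => elsym (phi w) k) 0) / M%:C.
Proof.
have /andP[k0 _] := kn => dphi phi0; apply: derive1_eq.
have D1 := is_derive_pws k.-1 dphi phi0; rewrite (prednK k0) in D1.
have Dt (j : 'I_k.-1) : is_derive (0 : C) 1
    (fun w => pws (phi w) j.+1 * pws (phi w) (k - j.+1)%N) 0.
  have jk : (0 < k - j.+1)%N by rewrite subn_gt0 -ltn_predRL ltn_ord.
  have E2 := is_derive_pws (k - j.+1).-1 dphi phi0; rewrite (prednK jk) in E2.
  have E1 := is_derive_pws j dphi phi0.
  set d1 := (-1) ^+ j * _ in E1; set d2 := (-1) ^+ _ * _ in E2.
  have V : pws (phi 0) j.+1 * d2 + pws (phi 0) (k - j.+1)%N * d1 = 0.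
    have P1 : pws (phi 0) j.+1 = 0 by rewrite phi0; exact: pws_0.
    have P2 : pws (phi 0) (k - j.+1)%N = 0 by rewrite phi0; exact: pws_0.
    by rewrite P1 mul0r P2 mul0r addr0.
  exact: (is_derive_eq (is_deriveM E1 E2) V).
have D0 := is_derive_sum Dt; rewrite fct_sumE in D0.
have Ds := is_derive_eq D0 (big1_eq _ _).
have := is_deriveZ (M%:C)^-1 (is_deriveB D1 (is_deriveZ a%:C Ds)).
rewrite scaler0 subr0 scaleC mulrC => D.
have -> : (fun w => F (phi w)) = (M%:C)^-1 \*: ((fun w => pws (phi w) k) -
   a%:C \*: (fun x => \sum_(i < k.-1) pws (phi x) i.+1 * pws (phi x) (k - i.+1)%N)).
  by apply/funext => w; rewrite /F /pairing mulrC.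
exact: D.
Qed.

(** The seminorm is the modulus of the derivative of [F] at 0, to which the products in [pairing]
    contribute nothing. As M < n in the application, it exceeds k / n, the value of [rho] at e_k. *)
Lemma kobayashi_buseman_ge :
  ((k%:R / M)%:E <= kobayashi_buseman (symm_polydisc n) 0 (basis_vec n k))%E.
Proof.
have /andP[k0 kn'] := kn.
have kn1 : (k.-1 < n)%N by rewrite prednK.
have kC0 : 0 <= k%:R / M by rewrite divr_ge0// ltW.
pose N X := k%:R / M * nc (X 0 (Ordinal kn1)).
have -> : k%:R / M = N (basis_vec n k).
  by rewrite /N mxE /= prednK// eqxx Normc.normc1 mulr1.
apply: ereal_sup_ubound; exists N => //; split.
  split=> [X Y|c X]; rewrite /N mxE.
    by rewrite -mulrDr ler_wpM2l// ncD.
  by rewrite ncM; ring.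
move=> X; apply: le_ereal_inf_tmp => _ [al [al0 [phi [hphi phi0 <-]]] <-].
rewrite lee_fin.
have z1 : nc (0 : C) < 1 by rewrite Normc.normc0.
have [dphi _] := hphi 0 z1.
have := @schwarz _ (fun w => F (phi w)) 1.
move=> /(_ _ _ _ 0 z1) H.
have {}H : nc (slope (fun w => F (phi w)) 0 0) <= 1.
  apply: H.
  - by move=> w /hphi[dw _]; exact: differentiable_functional.
  - by move=> w /hphi[_ Gw]; exact: functional_le1.
  - by rewrite phi0 functional0.
move: H; rewrite /slope eqxx (derive1_functional dphi phi0) !ncM Normc.normcV nc_real gtr0_norm//.
rewrite nc_nat ncX ncN Normc.normc1 expr1n mul1r => H.
rewrite /N mxE ncM nc_real ger0_norm//.
have -> : derive1 phi 0 0 (Ordinal kn1) = derive1 (fun w => elsym (phi w) k) 0.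
  have -> : (fun w => elsym (phi w) k) = (fun w => phi w 0 (Ordinal kn1)).
    by apply/funext => w; rewrite -elsymS /= prednK.
  exact: derive1_coordinate dphi.
rewrite mulrCA ler_piMr//.
by rewrite mulrAC.
Qed.

Lemma functional_distance_le_lempert z w : symm_polydisc n z -> symm_polydisc n w ->
  ((nc (F z - F w))%:E <= lempert (symm_polydisc n) z w)%E.
Proof.
move=> Gz Gw; apply: le_ereal_inf_tmp => _ [al [al1 [phi [hphi <- <-]]] <-].
rewrite lee_fin.
have z1 : nc (0 : C) < 1 by rewrite Normc.normc0.
have := @schwarz_pick _ (fun w => F (phi w)) 0 al.
move=> /(_ _ _ z1 al1); rewrite conjc0 mul0r !subr0 Normc.normc1 mulr1 => H.
rewrite nc_distC; apply: euclidean_le_poincare.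
- by have [_ ?] := hphi _ al1; exact: functional_le1.
- by have [_ ?] := hphi _ z1; exact: functional_le1.
- by rewrite normc_ge0.
- apply: H.
    by move=> x /hphi[dx _]; exact: differentiable_functional.
  by move=> x /hphi[_ Gx]; exact: functional_le1.
Qed.

Lemma kobayashi_functional_ge w : symm_polydisc n w ->
  ((nc (F w))%:E <= kobayashi (symm_polydisc n) 0 w)%E.
Proof.
move=> Gw; apply: ereal_sup_ubound; exists (fun x y => nc (F x - F y)); last first.
  by rewrite functional0 sub0r ncN.
split; last exact: functional_distance_le_lempert.
split.
- by move=> x y _ _; exact: normc_ge0.
- by move=> x _; rewrite subrr Normc.normc0.
- by move=> x y _ _; rewrite nc_distC.
- move=> x y t _ _ _; apply: le_trans (ncD _ _).
  by rewrite addrA subrK.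
Qed.

Lemma functional_basis (t : C) : nc (F (t *: basis_vec n k)) = k%:R * nc t / M.
Proof.
have /andP[k0 kn'] := kn.
have kn1 : (k.-1 < n)%N by rewrite prednK.
set s := t *: basis_vec n k.
have sE (j : 'I_n) : s 0 j = (j.+1 == k)%:R * t by rewrite !mxE mulrC.
have low j : (0 < j < k)%N -> elsym s j = 0.
  case: j => // j /andP[_ jk]; have jn : (j < n)%N by apply: leq_trans kn'; exact: ltnW.
  by rewrite (elsym_lt _ jn) sE/= (ltn_eqF jk) mul0r.
have [H1 H2] := pws_lowest low.
rewrite /F H2// /pairing big1 => [|j _]; last first.
  by rewrite H1 ?mul0r//= -ltn_predRL ltn_ord.
rewrite mulr0 subr0 -(prednK k0) (elsym_lt _ kn1) sE/= prednK// eqxx mul1r.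
by rewrite !ncM Normc.normcV nc_real gtr0_norm// nc_nat ncX ncN Normc.normc1 expr1n mul1r.
Qed.

End Functional.

Theorem kobayashi_buseman_nondivisor (k : nat) : (1 <= k <= n)%N -> ~~ (k %| n)%N ->
  (rho (basis_vec n k : 'rV[C]_n) < kobayashi_buseman (symm_polydisc n) 0 (basis_vec n k))%E.
Proof.
move=> kn kdvd; have /andP[k0 kn'] := kn.
have n0 : (0 < n)%N by exact: leq_trans kn'.
have [a a0 [M /andP[M0 Mn] FM]] := @nondivisor_function R n k kn kdvd.
have B := kobayashi_buseman_ge kn M0 FM.
apply: lt_le_trans B.
rewrite -[basis_vec n k]scale1r rho_basis// Normc.normc1 mul1r lte_fin.
by rewrite ltr_pM2l ?ltr0n// ltf_pV2// posrE ltr0n.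
Qed.

(* With [v = weighted_norm z], [p_map] maps [v] to at most [v / (1 - v)], hence all
   the [f_map] are at most [v / (1 - (m - 1) v)] at [z]. *)
Definition weighted_norm (m : nat) (z : 'rV[C]_m) : R := (\sum_(j < m) j.+1%:R * nc (z 0 j)) / m%:R.

Lemma weighted_norm_ge0 m (z : 'rV[C]_m) : 0 <= weighted_norm z.
Proof. by rewrite divr_ge0// sumr_ge0// => j _; rewrite mulr_ge0// normc_ge0. Qed.

Lemma weighted_norm_p_map (m : nat) (lam : C) (z : 'rV[C]_m.+2) : nc lam = 1 -> weighted_norm z < 1 ->
  weighted_norm (p_map lam z) <= weighted_norm z / (1 - weighted_norm z).
Proof.
move=> l1 z1.
have mR : 0 < m.+2%:R :> R by rewrite ltr0n.
have mR1 : 0 < m.+1%:R :> R by rewrite ltr0n.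
pose S := \sum_(j < m.+2) j.+1%:R * nc (z 0 j).
have zS : weighted_norm z = S / m.+2%:R by [].
have z0 : nc (z 0 ord0) <= S.
  rewrite /S (bigD1 ord0)//= mul1r lerDl sumr_ge0// => j _.
  by rewrite mulr_ge0// normc_ge0.
have Sm : S < m.+2%:R by move: z1; rewrite zS ltr_pdivrMr// mul1r.
have D : m.+2%:R - S <= nc (m.+2%:R + lam * z 0 ord0).
  have := nc_le_sub m.+2%:R (- (lam * z 0 ord0)); rewrite opprK ncN ncM l1 mul1r nc_nat; lra.
have D0 : 0 < m.+2%:R - S by rewrite subr_gt0.
have T (i : 'I_m.+1) : nc (p_map lam z 0 i) <=
   ((m.+1 - i)%:R * nc (z 0 (widen_ord (leqnSn m.+1) i)) + i.+2%:R * nc (z 0 (lift ord0 i))) /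
   (m.+2%:R - S).
  rewrite mxE ncM Normc.normcV; apply: ler_pM; rewrite ?invr_ge0 ?normc_ge0//.
    apply: (le_trans (ncD _ _)); rewrite !ncM l1 mul1r !nc_nat//.
  by rewrite lef_pV2// posrE; exact: lt_le_trans D.
(* The coordinate with index j, of weight j + 1, occurs with factor m + 1 - j as the first term and
   with factor j as the second, in total m + 1. *)
have Z : \sum_(i < m.+1) i.+1%:R * ((m.+1 - i)%:R * nc (z 0 (widen_ord (leqnSn m.+1) i)) +
    i.+2%:R * nc (z 0 (lift ord0 i))) = m.+1%:R * S.
  under eq_bigr do rewrite mulrDr.
  rewrite big_split/=.
  have -> : \sum_(i < m.+1) i.+1%:R * ((m.+1 - i)%:R * nc (z 0 (widen_ord (leqnSn m.+1) i))) =
      \sum_(j < m.+2) (m.+1%:R - j%:R) * (j.+1%:R * nc (z 0 j)).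
    rewrite [RHS]big_ord_recr/= subrr mul0r addr0; apply: eq_bigr => i _.
    set x := nc _; rewrite (natrB _ (ltnW (ltn_ord i))) mulrCA.
    by [].
  have -> : \sum_(i < m.+1) i.+1%:R * (i.+2%:R * nc (z 0 (lift ord0 i))) =
      \sum_(j < m.+2) j%:R * (j.+1%:R * nc (z 0 j)).
    by rewrite [RHS]big_ord_recl/= mul0r add0r; apply: eq_bigr.
  rewrite -big_split/= /S mulr_sumr; apply: eq_bigr => j _; ring.
have : weighted_norm (p_map lam z) <= (m.+1%:R * S / (m.+2%:R - S)) / m.+1%:R.
  rewrite /weighted_norm ler_pM2r ?invr_gt0// -Z mulr_suml; apply: ler_sum => i _.
  by rewrite -mulrA ler_wpM2l.
move=> H; apply: (le_trans H); rewrite zS le_eqVlt; apply/orP; left; apply/eqP.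
move: mR mR1 D0; rewrite -/S; move: (m.+2%:R) (m.+1%:R) (S) => a b t a0 b0 d0.
have := lt0r_neq0 a0; have := lt0r_neq0 b0; have := lt0r_neq0 d0 => d1 b1 a1.
by field; rewrite ?d1 ?b1 ?a1.
Qed.

Lemma nc_f_map (m : nat) (lam : nat -> C) (z : 'rV[C]_m.+1) :
  (forall i, (1 <= i < m.+1)%N -> nc (lam i) = 1) -> m%:R * weighted_norm z < 1 ->
  nc (f_map lam z) <= weighted_norm z / (1 - m%:R * weighted_norm z).
Proof.
elim: m z => [|m IH] z l1 z1.
  by rewrite /weighted_norm /= big_ord_recl big_ord0 mul0r subr0 !divr1 addr0 mul1r.
have v0 := weighted_norm_ge0 z; set v := weighted_norm z in z1 v0 *.
have vm : 0 <= m%:R * v by rewrite mulr_ge0.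
have mS : m.+1%:R = m%:R + 1 :> R by rewrite -natr1.
rewrite mS mulrDl mul1r in z1 *.
have v1 : v < 1 by lra.
have d0 : 0 < 1 - v by lra.
have d1 : 0 < 1 - (m%:R * v + v) by lra.
have P := @weighted_norm_p_map m (lam m.+1) z; rewrite -/v in P.
have {}P := P (l1 m.+1 (ltnSn _)) v1.
have Q : m%:R * weighted_norm (p_map (lam m.+1) z) <= m%:R * (v / (1 - v)) by rewrite ler_wpM2l.
have Q1 : m%:R * (v / (1 - v)) < 1 by rewrite mulrA ltr_pdivrMr// mul1r; lra.
apply: (le_trans (IH (p_map (lam m.+1) z) _ _)).
- by move=> i /andP[i1 im]; apply: l1; rewrite i1 ltnW.
- exact: le_lt_trans Q1.
have -> : v / (1 - (m%:R * v + v)) = (v / (1 - v)) / (1 - m%:R * (v / (1 - v))).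
  have e0 : 1 - v - m%:R * v != 0 by apply: lt0r_neq0; lra.
  by field; rewrite e0 ?lt0r_neq0//; lra.
apply: ler_pM => //; first exact: weighted_norm_ge0.
  by rewrite invr_ge0 subr_ge0 ltW// (le_lt_trans Q).
by rewrite lef_pV2 ?posrE ?subr_gt0 ?(le_lt_trans Q)// lerD2l lerN2.
Qed.

Lemma f_map0 (m : nat) (lam : nat -> C) : f_map lam (0 : 'rV[C]_m) = 0.
Proof.
elim: m => // m IH /=; case: m IH => [|m] IH; first by rewrite mxE.
suff -> : p_map (lam m.+1) (0 : 'rV[C]_m.+2) = 0 by exact: IH.
by apply/rowP => j; rewrite !mxE !mulr0 addr0 mul0r.
Qed.

Lemma p_symm_le (m : nat) (z : 'rV[C]_m.+1) : m.+1%:R * weighted_norm z < 1 ->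
  (p_symm 0 z <= (weighted_norm z / (1 - m.+1%:R * weighted_norm z))%:E)%E.
Proof.
move=> z1; apply: ge_ereal_sup => _ [lam l1 <-]; rewrite lee_fin.
have mS : m.+1%:R = m%:R + 1 :> R by rewrite -natr1.
have v0 := weighted_norm_ge0 z; set v := weighted_norm z in z1 v0 *.
rewrite mS mulrDl mul1r in z1 *.
have H := @nc_f_map m lam z l1; rewrite -/v in H.
have {}H : nc (f_map lam z) <= v / (1 - m%:R * v) by apply: H; lra.
rewrite /poincare f_map0 conjc0 mul0r subr0 divr1 sub0r ncN.
have d0 : 0 < 1 - m%:R * v by lra.
have y1 : v / (1 - m%:R * v) < 1 by rewrite ltr_pdivrMr// mul1r; lra.
have y0 : 0 <= v / (1 - m%:R * v) by rewrite divr_ge0// ltW.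
apply: (le_trans (artanh_mono (normc_ge0 _) H y1)).
have y01 : 0 <= v / (1 - m%:R * v) < 1 by rewrite y0.
apply: (le_trans (artanh_le y01)); rewrite le_eqVlt; apply/orP; left; apply/eqP.
have -> : 1 - (m%:R * v + v) = (1 - m%:R * v) - v by ring.
have : 0 < 1 - m%:R * v - v by lra.
move: d0; move: (1 - m%:R * v) => d d0 dv0.
by field; rewrite !lt0r_neq0.
Qed.

Lemma basis_vec_in_symm (k : nat) (t : C) : (0 < k <= n)%N -> nc t < 1 ->
  symm_polydisc n (t *: basis_vec n k).
Proof.
move=> /andP[k0 kn] t1; have kn1 : (k.-1 < n)%N by rewrite prednK.
apply: symm_polydiscP => x x1.
have -> : (gpoly (t *: basis_vec n k)).[x] = 1 + t * x ^+ k.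
  rewrite /gpoly hornerD hornerC horner_sum (bigD1 (Ordinal kn1))//=.
  rewrite hornerZ hornerXn !mxE /= prednK// eqxx mulr1 big1 ?addr0// => j jk.
  rewrite hornerZ !mxE; have := jk; rewrite -val_eqE/= -eqSS prednK// => /negbTE ->.
  by rewrite mulr0 mul0r.
rewrite addrC addr_eq0; apply/eqP => /(congr1 nc); rewrite ncN Normc.normc1 ncM ncX => E.
have : nc t * nc x ^+ k <= nc t * 1.
  by rewrite ler_wpM2l ?normc_ge0// exprn_ile1 ?normc_ge0.
by rewrite E mulr1 leNgt t1.
Qed.

(** At t e_k with k = n - 1, which does not divide n, the functional gives at least k t / M, while
    [p_symm] is at most k t / n up to terms of second order. As M < n, a small t separates the
    two. *)
Theorem kobayashi_neq_p_symm : (3 <= n)%N ->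
  exists2 z : 'rV[C]_n, symm_polydisc n z & kobayashi (symm_polydisc n) 0 z <> p_symm 0 z.
Proof.
move=> n3; pose k := n.-1.
have n0 : (0 < n)%N by exact: leq_trans n3.
have nE : n = k.+1 by rewrite /k prednK.
have k2 : (2 <= k)%N by rewrite -ltnS -nE.
have kn : (0 < k <= n)%N by rewrite nE leqnSn (leq_trans _ k2).
have kdvd : ~~ (k %| n)%N.
  rewrite nE -addn1 dvdn_addr// dvdn1; apply/eqP => E; by rewrite E in k2.
have [a a0 [M /andP[M0 Mn] FM]] := @nondivisor_function R n k kn kdvd.
have kR : 0 < k%:R :> R by rewrite ltr0n (leq_trans _ k2).
have nR : 0 < n%:R :> R by rewrite ltr0n.
have kn1R : k%:R <= n%:R :> R by rewrite ler_nat nE.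
(* Chosen such that n (1 - k t) = (n + M) / 2, which is still larger than M. *)
pose t : R := (n%:R - M) / (2 * n%:R * k%:R).
have t0 : 0 < t by rewrite divr_gt0 ?subr_gt0// !mulr_gt0.
have ktE : k%:R * t = (n%:R - M) / (2 * n%:R) by rewrite /t; field; rewrite !lt0r_neq0.
have kt1 : k%:R * t < 1.
  by rewrite ktE ltr_pdivrMr ?mulr_gt0// mul1r; lra.
have t1 : t < 1.
  apply: le_lt_trans kt1; rewrite ler_peMl ?(ltW t0)//.
  by rewrite ler1n (leq_trans _ k2).
have nt : nc t%:C = t by rewrite nc_real gtr0_norm.
have tG : symm_polydisc n (t%:C *: basis_vec n k) by apply: basis_vec_in_symm; rewrite ?nt.
exists (t%:C *: basis_vec n k) => // E.
have := kobayashi_functional_ge kn M0 FM tG.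
rewrite (functional_basis a kn M0) nt E.
apply/negP; rewrite -ltNge.
have FE : weighted_norm (t%:C *: basis_vec n k) = k%:R * t / n%:R.
  have kn1 : (k.-1 < n)%N by rewrite nE; case: (k) k2 => // k' _; rewrite ltnS leqnSn.
  have kp : k.-1.+1 = k by rewrite prednK// (leq_trans _ k2).
  rewrite /weighted_norm (bigD1 (Ordinal kn1))//= !mxE /= kp eqxx mulr1 nt big1 ?addr0// => j jk.
  rewrite !mxE; have := jk; rewrite -val_eqE/= -eqSS kp => /negbTE ->.
  by rewrite mulr0 Normc.normc0 mulr0.
apply: (@le_lt_trans _ _ (k%:R * t / n%:R / (1 - k%:R * t))%:E); last first.
  have -> : k%:R * t / n%:R / (1 - k%:R * t) = k%:R * t / (n%:R * (1 - k%:R * t)).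
    by rewrite invfM [RHS]mulrA.
  have q0 : 0 < n%:R * (1 - k%:R * t) by rewrite mulr_gt0// subr_gt0.
  have kt0 : 0 < k%:R * t by rewrite mulr_gt0.
  rewrite lte_fin (ltr_pM2l kt0) ltf_pV2 ?posrE//.
  have -> : n%:R * (1 - k%:R * t) = (n%:R + M) / 2.
    by rewrite ktE; field; rewrite lt0r_neq0.
  lra.
have nk : n%:R * (k%:R * t / n%:R) = k%:R * t by field; exact: lt0r_neq0.
have main (m : nat) (z : 'rV[C]_m) : (0 < m)%N -> m%:R * weighted_norm z < 1 ->
  (p_symm 0 z <= (weighted_norm z / (1 - m%:R * weighted_norm z))%:E)%E.
  by case: m z => // m z _; exact: p_symm_le.
have := main n (t%:C *: basis_vec n k) n0.
by rewrite FE nk; apply.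
Qed.

End Nondivisor.

(** * Rigidity of discs that are nearly extremal at the roots of unity *)

Section Rigidity.
Context {R : realType}.
Local Notation C := R[i].
Local Notation Re := (@complex.Re R).
Local Notation Im := (@complex.Im R).
Local Notation nc := (@Normc.normc R).
Local Open Scope complex_scope.

Lemma cexpX (w : C) (m : nat) : cexp w ^+ m = cexp (w *+ m).
Proof.
elim: m => [|m IH]; first by rewrite expr0 mulr0n cexp0.
by rewrite exprS IH mulrS cexpD.
Qed.

(* [1 + tau] is [cos g * exp (i g)] with [g = 3 pi / (4 m)]. *)
Lemma exists_negative_power (m : nat) : (2 <= m)%N ->
  exists2 tau : C, 0 < nc tau < 1 & Re ((1 + tau) ^+ m) < 0.
Proof.
move=> m2; have m0 : 0 < m%:R :> R by rewrite ltr0n (leq_trans _ m2).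
have pi0 := pi_gt0 R.
(* The angle m g = 3 pi / 4 has negative cosine; g < pi / 2, that is cos g > 0, is where m >= 2 is
   needed. *)
pose g : R := 3 / 4 * pi / m%:R.
have g0 : 0 < g by rewrite divr_gt0// mulr_gt0// divr_gt0.
have gpi : g < pi / 2.
  rewrite ltr_pdivrMr//; apply: (@lt_le_trans _ _ (pi / 2 * 2)); first lra.
  by rewrite ler_pM2l ?ler_nat//; lra.
have c0 : 0 < cos g by apply: cos_gt0_pihalf; apply/andP; split; lra.
have s0 : 0 < sin g by apply: sin_gt0_pihalf; rewrite g0.
have cs := cos2Dsin2 g.
have e1 : cexp (0 +i* g) = cos g +i* sin g by rewrite /cexp/= expR0 !mul1r.
pose tau : C := (cos g)%:C * cexp (0 +i* g) - 1.
have ntau : nc tau = sin g.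
  apply/eqP; rewrite -(eqrXn2 (n := 2))// ?normc_ge0 ?ltW//.
  rewrite nc_sqr /tau e1 /=; apply/eqP.
  rewrite !mul0r subr0 addr0 oppr0 addr0.
  have -> : (cos g * cos g - 1) = - sin g ^+ 2 by rewrite -cs; ring.
  have -> : (cos g * sin g) ^+ 2 = (1 - sin g ^+ 2) * sin g ^+ 2 by rewrite -cs; ring.
  by ring.
exists tau.
  rewrite ntau s0/= -(ltr_pXn2r (n := 2)) ?nnegrE ?ltW// expr1n -cs ltrDr.
  by rewrite exprn_gt0.
have -> : 1 + tau = (cos g)%:C * cexp (0 +i* g) by rewrite /tau addrC subrK.
rewrite exprMn cexpX -(rmorphXn (real_complex R)) Re_mul /= mul0r subr0.
have -> : Im ((0 +i* g) *+ m) = g * m%:R.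
  elim: (m) => [|k IH]; first by rewrite mulr0n mulr0.
  by rewrite mulrSr Im_add IH /= mulrSr mulrDr mulr1.
have -> : Re ((0 +i* g) *+ m) = 0.
  by elim: (m) => [//|k IH]; rewrite mulrSr Re_add IH /= addr0.
rewrite expR0 mul1r pmulr_rlt0 ?exprn_gt0// /g divfK ?lt0r_neq0//.
have -> : 3 / 4 * pi = pi / 4 + pi / 2 :> R by field.
by rewrite cosDpihalf oppr_lt0; apply: sin_gt0_pihalf; apply/andP; split; lra.
Qed.

Lemma exists_primitive_root (m : nat) : (0 < m)%N -> exists w : C, m.-primitive_root w.
Proof.
move=> m0; pose p : {poly C} := 'X^m - 1.
have [rs Dp] := closed_field_poly_normal p.
rewrite (monicP _) ?monicXnsubC // scale1r in Dp.
have rn1 : all m.-unity_root rs.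
  by apply/allP => z; rewrite -root_prod_XsubC -Dp.
have sz : (m < (size rs).+1)%N by rewrite -(size_prod_XsubC rs id) -Dp size_XnsubC.
have [|z] := hasP (has_prim_root m0 rn1 _ sz); last by exists z.
by rewrite -separable_prod_XsubC -Dp separable_Xn_sub_1 // pnatr_eq0 -lt0n.
Qed.

Lemma nc_unity_root (m : nat) (w : C) : (0 < m)%N -> w ^+ m = 1 -> nc w = 1.
Proof.
move=> m0 wm; apply/eqP; rewrite -(pexpr_eq1 m0) ?normc_ge0// -ncX wm.
by rewrite Normc.normc1.
Qed.

(** Discrete Fourier inversion over the m-th roots of unity: averaging with weights lam^(m - i)
    extracts the coefficients whose index is congruent to [i] modulo m. The exponent m - i stands
    for - i. *)
Lemma coefficient_bound (m : nat) (c : nat -> C) (d : R) (i : nat) : (0 < m)%N ->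
  (forall lam, lam ^+ m = 1 -> nc (\sum_(j < m.+1) c j * lam ^+ j) <= d) ->
  (i < m)%N -> nc (\sum_(j < m.+1 | (m %| m - i + j)%N) c j) <= d.
Proof.
move=> m0 H im; have [w wp] := exists_primitive_root m0.
have mC : m%:R != 0 :> C by rewrite pnatr_eq0 -lt0n.
have mR : 0 < m%:R :> R by rewrite ltr0n.
have w1 := nc_unity_root m0 (prim_expr_order wp).
have E : m%:R * (\sum_(j < m.+1 | (m %| m - i + j)%N) c j) =
   \sum_(l < m) w ^+ ((m - i) * l) * (\sum_(j < m.+1) c j * (w ^+ l) ^+ j).
  under [RHS]eq_bigr do rewrite mulr_sumr.
  rewrite exchange_big/= mulr_sumr big_mkcond/=; apply: eq_bigr => j _.
  have -> : \sum_(l < m) w ^+ ((m - i) * l) * (c j * (w ^+ l) ^+ j) =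
    c j * \sum_(l < m) (w ^+ (m - i + j)) ^+ l.
    rewrite mulr_sumr; apply: eq_bigr => l _.
    by rewrite mulrCA -!exprM -exprD mulnDl [(l * j)%N]mulnC.
  rewrite sum_geometric_unity//; last first.
    by rewrite -exprM mulnC exprM (prim_expr_order wp) expr1n.
  by rewrite -(prim_order_dvd wp); case: ifP => _; rewrite ?mulr0// mulrC.
rewrite -(ler_pM2l mR) -{1}nc_nat -ncM E; apply: (le_trans (nc_sum _ _ _)).
apply: (@le_trans _ _ (\sum_(l < m) d)); last by rewrite sumr_const card_ord mulr_natl.
apply: ler_sum => l _; rewrite ncM ncX w1 expr1n mul1r.
by apply: H; rewrite -exprM mulnC exprM (prim_expr_order wp) expr1n.
Qed.

(** The indices 0 and m are congruent modulo m, so only the sum of their coefficients is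
    controlled. *)
Lemma coefficient_bounds (m : nat) (c : nat -> C) (d : R) : (0 < m)%N ->
  (forall lam, lam ^+ m = 1 -> nc (\sum_(j < m.+1) c j * lam ^+ j) <= d) ->
  (forall i, (0 < i < m)%N -> nc (c i) <= d) /\ nc (c 0%N + c m) <= d.
Proof.
move=> m0 H; split.
  move=> i /andP[i0 im]; have := coefficient_bound m0 H im.
  have im1 : (i < m.+1)%N by exact: ltnW.
  rewrite (big_pred1 (Ordinal im1)) => // j; apply/idP/eqP => [|->]; last first.
    by rewrite /= subnK// ltnW.
  move=> /dvdnP[q E]; apply: val_inj => /=.
  have jm : (j < m.+1)%N by exact: ltn_ord.
  have q1 : q = 1%N.
    case: q E => [|[|q]] E //; first by rewrite mul0n in E; lia.
    by rewrite !mulSn in E; lia.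
  by rewrite q1 mul1n in E; lia.
have := coefficient_bound m0 H m0.
rewrite subn0 big_mkcond big_ord_recr/= dvdn_addr// dvdnn.
case: m m0 H => // m m0 H; rewrite big_ord_recl/= dvdn_addr// dvdn0.
rewrite big1 ?addr0// => j _; rewrite /bump/= add1n dvdn_addr// gtnNdvd//.
by rewrite ltnS ltn_ord.
Qed.

Lemma sum_binomial (m : nat) (t : C) :
  \sum_(j < m.+1) (m.+1 - j)%:R * 'C(m.+1, j)%:R * t ^+ j = m.+1%:R * (1 + t) ^+ m.
Proof.
rewrite exprDn mulr_sumr; apply: eq_bigr => j _.
rewrite expr1n mul1r -[t ^+ j *+ _]mulr_natl mulrA; congr (_ * _).
by rewrite -!natrM mul_bin_down.
Qed.

(* If [dnum s lam = zeta * dden s lam] holds approximately at all the [m]-th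
   roots of unity, then [elsym s j] is close to ['C(m+1, j) * zeta ^+ j * v] for
   [j <= m]; the bound on [dnum] at [lam = tau / zeta] then becomes a condition
   on [v] alone. *)
Section Pointwise.
Variables (m : nat) (s : 'rV[C]_m.+1) (zeta v tau : C) (d : R).
Hypotheses (m2 : (2 <= m)%N) (r0 : 0 < nc zeta) (r1 : nc zeta <= 1)
  (tauz : nc tau = nc zeta) (d0 : 0 <= d).
Hypothesis s1 : elsym s 1 = m.+1%:R * zeta * v.
Hypothesis approx : forall lam, lam ^+ m = 1 -> nc (dnum s lam - zeta * dden s lam) <= d.
Hypothesis bound : forall lam, nc lam = 1 -> nc (dnum s lam) <= nc zeta * nc (dden s lam).

Let m0 : (0 < m)%N. Proof. exact: leq_trans m2. Qed.
Let zeta0 : zeta != 0. Proof. by rewrite -nc_gt0. Qed.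
Let c (j : nat) : C := j.+1%:R * elsym s j.+1 - zeta * ((m.+1 - j)%:R * elsym s j).

Let cE lam : dnum s lam - zeta * dden s lam = \sum_(j < m.+1) c j * lam ^+ j.
Proof.
rewrite /dnum /dden mulr_sumr -sumrB; apply: eq_bigr => j _.
by rewrite /c; ring.
Qed.

Let c_bounds : (forall i, (0 < i < m)%N -> nc (c i) <= d) /\ nc (c 0%N + c m) <= d.
Proof. by apply: coefficient_bounds => // lam lm; rewrite -cE; exact: approx. Qed.

Let K : R := (m.+2%:R) ^+ m * d.

Let K0 : 0 <= K. Proof. by rewrite mulr_ge0// exprn_ge0. Qed.

Let e j := elsym s j - 'C(m.+1, j)%:R * zeta ^+ j * v.

(** The coefficients [c] turn into the recurrence (j+1) e_{j+1} = zeta (m+1-j) e_j + c_j, started at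
    e_1 = 0; each step costs at most a factor m + 2. The index 0 is excluded, since e_0 = 1 - v need
    not be small. *)
Let e_bound j : (0 < j <= m)%N -> nc (e j) <= (m.+2%:R) ^+ j * d.
Proof.
elim: j => // j IH /andP[_ jm].
have M1 : 1 <= m.+2%:R :> R by rewrite ler1n.
case: j IH jm => [|j] IH jm.
  by rewrite /e s1 bin1 expr1 subrr Normc.normc0 mulr_ge0// exprn_ge0.
have IHj : nc (e j.+1) <= m.+2%:R ^+ j.+1 * d by apply: IH; exact: ltnW jm.
have cj : nc (c j.+1) <= d by apply: c_bounds.1; rewrite jm.
have E : j.+2%:R * e j.+2 = zeta * ((m.+1 - j.+1)%:R * e j.+1) + c j.+1.
  have B : j.+2%:R * 'C(m.+1, j.+2)%:R = (m.+1 - j.+1)%:R * 'C(m.+1, j.+1)%:R :> C.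
    by rewrite -!natrM mul_bin_left.
  rewrite /e /c exprSr; move: B.
  move: (j.+2%:R : C) ('C(m.+1, j.+2)%:R : C) ((m.+1 - j.+1)%:R : C) ('C(m.+1, j.+1)%:R : C).
  move=> p q p' q' B.
  have -> : p * (elsym s j.+2 - q * (zeta ^+ j.+1 * zeta) * v) =
    p * elsym s j.+2 - p * q * (zeta ^+ j.+1 * zeta) * v by ring.
  by rewrite B; ring.
have n2 : 1 <= j.+2%:R :> R by rewrite ler1n.
apply: (@le_trans _ _ (j.+2%:R * nc (e j.+2))).
  by rewrite ler_peMl// normc_ge0.
rewrite -[in X in X * _]nc_nat -ncM E.
apply: (le_trans (ncD _ _)); rewrite !ncM nc_nat.
have A1 : nc zeta * ((m.+1 - j.+1)%:R * nc (e j.+1)) <= 1 * (m.+1%:R * (m.+2%:R ^+ j.+1 * d)).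
  apply: ler_pM => //; rewrite ?normc_ge0 ?mulr_ge0 ?normc_ge0//.
  by apply: ler_pM => //; rewrite ?normc_ge0// ler_nat leq_subr.
apply: (le_trans (lerD A1 cj)); rewrite mul1r [in leRHS]exprS -[leRHS]mulrA.
have P1 : d <= m.+2%:R ^+ j.+1 * d by rewrite ler_peMl// exprn_ege1.
have M2 : m.+2%:R = m.+1%:R + 1 :> R by rewrite natr1.
move: P1; move: (m.+2%:R ^+ j.+1 * d) => Y P1; rewrite M2.
by rewrite mulrDl mul1r lerD2l.
Qed.

Let e_le j : (0 < j <= m)%N -> nc (e j) <= K.
Proof.
move=> jm; apply: (le_trans (e_bound jm)); rewrite ler_wpM2r//.
by rewrite ler_weXn2l ?ler1n//; case/andP: jm.
Qed.

Let lam := tau / zeta.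
Let w := lam ^+ m.
Let b := (1 + tau) ^+ m.

Let lam1 : nc lam = 1.
Proof. by rewrite /lam ncM Normc.normcV tauz divff// lt0r_neq0. Qed.

(** As lam * zeta = tau, the approximate values sum to the binomial expansion of v (1 + tau)^m. The
    term j = 0 is exactly 1 instead of v, whence the summand 1 - v. *)
Let dden_approx : nc (dden s lam - m.+1%:R * ((1 - v) + v * b)) <= m.+1%:R * m.+1%:R * K.
Proof.
have E : dden s lam - m.+1%:R * ((1 - v) + v * b) =
    \sum_(j < m.+1) (if j == 0 :> nat then 0 else (m.+1 - j)%:R * e j * lam ^+ j).
  have -> : m.+1%:R * ((1 - v) + v * b) =
     \sum_(j < m.+1) (if j == 0 :> nat then m.+1%:R else (m.+1 - j)%:R * 'C(m.+1, j)%:R * tau ^+ j * v).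
    have := sum_binomial m tau; rewrite -/b big_ord_recl/= subn0 bin0 expr0 !mulr1 => B.
    rewrite [RHS]big_ord_recl/= -mulr_suml.
    transitivity (m.+1%:R + (m.+1%:R * b - m.+1%:R) * v); first by ring.
    by rewrite -B; congr (_ + _ * _); rewrite addrAC subrr add0r.
  rewrite /dden -sumrB; apply: eq_bigr => j _; case: eqP => [->|_].
    by rewrite elsym0 subn0 expr0 !mulr1 subrr.
  rewrite /e /lam expr_div_n; field.
  by rewrite expf_neq0.
rewrite E; apply: (le_trans (nc_sum _ _ _)).
apply: (@le_trans _ _ (\sum_(j < m.+1) (m.+1%:R * K))); last first.
  by rewrite sumr_const card_ord -[leLHS]mulr_natl mulrA.
apply: ler_sum => j _; case: eqP => [_|/eqP j0]; first by rewrite Normc.normc0 mulr_ge0.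
rewrite !ncM ncX lam1 expr1n mulr1 nc_nat; apply: ler_pM; rewrite ?normc_ge0//.
  by rewrite ler_nat leq_subr.
by apply: e_le; rewrite lt0n j0 -ltnS ltn_ord.
Qed.

(** The coefficient c_0 = - (m+1) zeta (1 - v) is exact, c_m is close to - c_0 and the others are
    small, so dnum - zeta * dden is close to c_0 (1 - w). *)
Let defect_approx :
  nc (dnum s lam - zeta * dden s lam + m.+1%:R * zeta * (1 - v) * (1 - w)) <= m.+1%:R * d.
Proof.
have c0E : c 0%N = - (m.+1%:R * zeta * (1 - v)).
  by rewrite /c s1 subn0 elsym0; ring.
have -> : dnum s lam - zeta * dden s lam + m.+1%:R * zeta * (1 - v) * (1 - w) =
   (c 0%N + c m) * w + \sum_(j < m) (if j == 0 :> nat then 0 else c j * lam ^+ j).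
  rewrite cE big_ord_recr/= -/w.
  have -> : \sum_(j < m) c j * lam ^+ j = c 0%N + \sum_(j < m) (if j == 0 :> nat then 0 else c j * lam ^+ j).
    case: (m) m0 => // k _; rewrite !big_ord_recl/= expr0 mulr1 add0r.
    by [].
  by rewrite c0E; ring.
have [cb cm] := c_bounds.
apply: (le_trans (ncD _ _)); rewrite ncM ncX lam1 expr1n mulr1.
have -> : m.+1%:R * d = d + \sum_(j < m) d by rewrite sumr_const card_ord -mulr_natl -[m.+1%:R]natr1; ring.
apply: lerD => //; apply: (le_trans (nc_sum _ _ _)); apply: ler_sum => j _.
case: eqP => [_|/eqP j0]; first by rewrite Normc.normc0.
by rewrite ncM ncX lam1 expr1n mulr1; apply: cb; rewrite lt0n j0 ltn_ord.
Qed.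

(** By the two approximations [dnum] is close to (m+1) zeta (v b + (1 - v) w), and [dden] to (m+1)
    (v b + (1 - v)); both are inserted into [bound]. *)
Lemma pointwise_condition :
  nc zeta * nc (v * b + (1 - v) * w) <= nc zeta * nc (v * b + (1 - v)) + (2 * m.+1%:R * K + d).
Proof.
have nR : 0 < m.+1%:R :> R by rewrite ltr0n.
rewrite -(ler_pM2l nR).
set N := dden s lam; set A := dnum s lam.
have B := bound lam1; rewrite -/A -/N in B.
have DN := dden_approx; rewrite -/N in DN.
have DE := defect_approx; rewrite -/A -/N in DE.
have -> : m.+1%:R * (nc zeta * nc (v * b + (1 - v) * w)) =
    nc (m.+1%:R * (zeta * (v * b + (1 - v) * w))) by rewrite !ncM nc_nat.
have -> : m.+1%:R * (zeta * (v * b + (1 - v) * w)) = A -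
   (A - zeta * N + m.+1%:R * zeta * (1 - v) * (1 - w)) -
   zeta * (N - m.+1%:R * ((1 - v) + v * b)) by ring.
apply: (le_trans (ncB _ _)).
apply: (le_trans (lerD (ncB _ _) (lexx _))).
rewrite [nc (zeta * (N - _))]ncM.
have N1 : nc N <= m.+1%:R * nc (v * b + (1 - v)) + m.+1%:R * m.+1%:R * K.
  have -> : N = m.+1%:R * (v * b + (1 - v)) + (N - m.+1%:R * ((1 - v) + v * b)) by ring.
  by apply: (le_trans (ncD _ _)); rewrite ncM nc_nat lerD2l.
set X := nc (v * b + (1 - v)) in N1 *.
have P : 0 <= m.+1%:R * m.+1%:R * K by rewrite mulr_ge0// mulr_ge0// ltW.
have N2 : nc zeta * nc N <= nc zeta * (m.+1%:R * X) + m.+1%:R * m.+1%:R * K.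
  apply: (@le_trans _ _ (nc zeta * (m.+1%:R * X + m.+1%:R * m.+1%:R * K))).
    by rewrite ler_wpM2l ?normc_ge0.
  by rewrite mulrDr lerD2l ler_piMl.
have N3 : nc zeta * nc (N - m.+1%:R * ((1 - v) + v * b)) <= m.+1%:R * m.+1%:R * K.
  apply: (@le_trans _ _ (1 * (m.+1%:R * m.+1%:R * K))); last by rewrite mul1r.
  by apply: ler_pM; rewrite ?normc_ge0.
have -> : m.+1%:R * (nc zeta * X + (2 * m.+1%:R * K + d)) =
  nc zeta * (m.+1%:R * X) + 2 * (m.+1%:R * m.+1%:R * K) + m.+1%:R * d by ring.
lra.
Qed.

(** After squaring, |v b|^2 cancels, and so does |1 - v|^2 because |w| = 1. Only the cross terms
    remain. *)
Lemma pointwise_Re (Z : R) : nc (v * b + (1 - v)) <= Z ->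
  - ((2 * m.+1%:R * K + d) / nc zeta * (2 * Z + (2 * m.+1%:R * K + d) / nc zeta)) <=
  2 * Re (v * b * conjc (1 - v) * (1 - conjc w)).
Proof.
set k := _ / nc zeta => XZ.
have k0 : 0 <= k by rewrite divr_ge0 ?normc_ge0 ?addr_ge0 ?mulr_ge0.
have H : nc (v * b + (1 - v) * w) <= nc (v * b + (1 - v)) + k.
  by rewrite -(ler_pM2l r0) mulrDr /k [nc zeta * (_ / _)]mulrC divfK ?lt0r_neq0// pointwise_condition.
have w1 : nc w = 1 by rewrite /w ncX lam1 expr1n.
have H2 : nc (v * b + (1 - v) * w) ^+ 2 <= (nc (v * b + (1 - v)) + k) ^+ 2.
  by apply: lerXn2r => //; rewrite nnegrE ?addr_ge0 ?normc_ge0.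
have X0 : 0 <= nc (v * b + (1 - v)) by exact: normc_ge0.
have H3 : (nc (v * b + (1 - v)) + k) ^+ 2 <= nc (v * b + (1 - v)) ^+ 2 + k * (2 * Z + k).
  have : k * nc (v * b + (1 - v)) <= k * Z by rewrite ler_wpM2l.
  set X := nc _; rewrite sqrrD expr2; lra.
have w2 : nc w ^+ 2 = 1 by rewrite w1 expr1n.
have := le_trans H2 H3; move: w2; rewrite !nc_sqr.
rewrite !(Re_add, Im_add) !(Re_mul, Im_mul) !(Re_sub, Im_sub) !Re_conjc !Im_conjc.
have R1 : Re (1 : C) = 1 by []. have I1 : Im (1 : C) = 0 by [].
rewrite !(Re_add, Im_add, Re_opp, Im_opp, R1, I1).
move: (Re v * Re b - Im v * Im b) (Re v * Im b + Im v * Re b) => p q.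
move: (Re v) (Im v) (Re w) (Im w) => x y a bb.
move=> w2 H4.
have W : ((1 - x) ^+ 2 + y ^+ 2) * (a ^+ 2 + bb ^+ 2 - 1) = 0 by rewrite w2 subrr mulr0.
lra.
Qed.

End Pointwise.


Lemma Re_realM (c : R) (z : C) : Re (c%:C * z) = c * Re z.
Proof. by case: z => a b; rewrite /= mul0r subr0. Qed.

Lemma elsym1_bound (n : nat) (s : 'rV[C]_n) : symm_polydisc n s -> nc (elsym s 1) <= n%:R.
Proof.
move=> [z z1 <-].
have := newton z 0; rewrite big_ord_recl big_ord0 mul1r addr0 expr0 elsym0 !mul1r => ->.
apply: (le_trans (nc_sum _ _ _)).
apply: (@le_trans _ _ (\sum_(j < n) 1)); last by rewrite sumr_const card_ord.
by apply: ler_sum => j _; rewrite expr1; exact/ltW/z1.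
Qed.

Lemma dden_bound (n : nat) (s : 'rV[C]_n) (lam : C) : symm_polydisc n s -> nc lam = 1 ->
  nc (dden s lam) <= n%:R * (n%:R * 2 ^+ n).
Proof.
move=> Gs l1; apply: (le_trans (nc_sum _ _ _)).
apply: (@le_trans _ _ (\sum_(j < n) (n%:R * 2 ^+ n))).
  apply: ler_sum => j _; rewrite !ncM ncX l1 expr1n mulr1 nc_nat.
  by apply: ler_pM; rewrite ?normc_ge0// ?ler_nat ?leq_subr//; exact: elsym_bound.
by rewrite sumr_const card_ord -[leLHS]mulr_natl.
Qed.

(** * From one point of a disc to a circle and back *)

Section RigidDisc.
Variables (m : nat) (phi : C -> 'rV[C]_m.+1) (tau zeta0 : C) (r0 x theta eps : R).
Hypothesis m2 : (2 <= m)%N.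
Hypotheses (hphi : holomorphic disc (symm_polydisc m.+1) phi) (phi0 : phi 0 = 0).
Hypotheses (tau01 : 0 < nc tau < 1) (r01 : 0 < r0 < 1) (z0r : nc zeta0 <= r0)
  (r0tau : r0 <= nc tau).
Hypothesis eps0 : 0 <= eps.
Hypothesis qclose : forall lam, lam ^+ m = 1 -> nc (slope (cquot phi lam) 0 zeta0 - 1) <= eps.
Let v := slope (fun zeta => elsym (phi zeta) 1 / m.+1%:R) 0.
Hypotheses (theta0 : 0 < theta) (xtheta : x <= 1 - theta) (x0 : 0 <= x).
Hypothesis vx : v zeta0 = x%:C.

Let m0 : (0 < m)%N. Proof. exact: leq_trans m2. Qed.
Let r := nc tau.
Let r_0 : 0 < r. Proof. by case/andP: tau01. Qed.
Let r1 : r < 1. Proof. by case/andP: tau01. Qed.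
Let k := (1 - r0 ^+ 2) * (1 - r ^+ 2) / 4.
Let k0 : 0 < k.
Proof.
case/andP: r01 => a0 a1.
by rewrite /k divr_gt0 ?mulr_gt0// subr_gt0 expr_lt1// ltW.
Qed.
Let b := (1 + tau) ^+ m.
Let B : R := m.+1%:R * (m.+1%:R * 2 ^+ m.+1).
Let d1 : R := (4 / k + 1) * B.
Let K1 : R := 2 * m.+1%:R * (m.+2%:R ^+ m * d1) + d1.
Let Z : R := 2 + 2 ^+ m.

Let B0 : 0 <= B. Proof. by rewrite !mulr_ge0// exprn_ge0. Qed.
Let d10 : 0 <= d1. Proof. by rewrite mulr_ge0// addr_ge0// divr_ge0// ltW. Qed.
Let K10 : 0 <= K1.
Proof.
apply: addr_ge0 => //; apply: mulr_ge0; first exact: mulr_ge0.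
by apply: mulr_ge0 => //; exact: exprn_ge0.
Qed.

Let diff_v z : nc z < 1 -> differentiable v z.
Proof.
apply: differentiable_slope0 => w w1; have [dw _] := hphi w1.
by apply: differentiableM; [exact: differentiable_elsym|exact: differentiable_cst].
Qed.

Let v_le1 z : nc z < 1 -> nc (v z) <= 1.
Proof.
move=> z1; apply: schwarz z1.
- move=> w w1; have [dw _] := hphi w1.
  by apply: differentiableM; [exact: differentiable_elsym|exact: differentiable_cst].
- move=> w w1; have [_ Gw] := hphi w1.
  rewrite ncM Normc.normcV nc_nat ler_pdivrMr ?ltr0n// mul1r.
  exact: elsym1_bound.
- by rewrite phi0 (elsym_lt _ (ltn0Sn m)) mxE mul0r.
Qed.

Let b_le : nc b <= 2 ^+ m.
Proof.
rewrite ncX; apply: lerXn2r; rewrite ?nnegrE ?normc_ge0//.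
apply: (le_trans (ncD _ _)); rewrite Normc.normc1.
by rewrite -/r; have := r1; lra.
Qed.

(** The quotient [slope (cquot phi lam) 0] is bounded by 1 and within [eps] of 1 at [zeta0], so
    [schwarz_pick_close] keeps it within (4 / k + 1) eps of 1 on the circle. Multiplied by the bound
    [B] of [dden] this gives the deviation eps * d1 for [pointwise_Re]. *)
Let on_circle z : nc z = r ->
  - (eps * (K1 / r) * (2 * Z + eps * (K1 / r))) <=
    2 * Re (v z * b * conjc (1 - v z) * (1 - (z / tau) ^+ m)).
Proof.
move=> zr; have z1 : nc z < 1 by rewrite zr.
have zn0 : z != 0 by rewrite -nc_gt0 zr.
have tn0 : tau != 0 by rewrite -nc_gt0.
have [dz Gz] := hphi z1.
have E : eps * (K1 / r) = (2 * m.+1%:R * (m.+2%:R ^+ m * (eps * d1)) + eps * d1) / nc z.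
  by rewrite zr /K1; ring.
have cw : (z / tau) ^+ m = conjc ((tau / z) ^+ m).
  rewrite rmorphXn/=; congr (_ ^+ m).
  apply: (mulIf (x := tau * conjc z)); first by rewrite mulf_neq0// conjc_eq0.
  rewrite rmorphM/= fmorphV/=.
  have -> : z / tau * (tau * conjc z) = (z * conjc z) * (tau / tau) by ring.
  have -> : conjc tau / conjc z * (tau * conjc z) = (tau * conjc tau) * (conjc z / conjc z) by ring.
  by rewrite !divff ?conjc_eq0// !mulcJ zr.
rewrite E cw; apply: pointwise_Re => //.
- by rewrite zr.
- by rewrite zr ltW.
- exact: mulr_ge0.
- have S : elsym (phi z) 1 / m.+1%:R = z * v z.
    by apply: (@slope0 _ (fun w => elsym (phi w) 1 / m.+1%:R)); rewrite phi0 (elsym_lt _ (ltn0Sn m)) mxE mul0r.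
  by rewrite -mulrA -S mulrC divfK// pnatr_eq0.
- move=> lam lm; have l1 := nc_unity_root m0 lm.
  pose q := slope (cquot phi lam) 0.
  have qle w : nc w < 1 -> nc (q w) <= 1 by exact: slope_cquot_le1.
  have dq w : nc w < 1 -> differentiable q w.
    by move=> w1; apply: differentiable_slope0 w1; exact: differentiable_cquot.
  have /andP[r00 r0l] := r01.
  have zr' : nc z <= r by rewrite zr.
  have P := schwarz_pick_close dq qle z0r zr' r0l r1.
  have Q := qclose lm; rewrite -/q in Q.
  have Q2 : 1 - nc (q zeta0) <= eps.
    apply: le_trans Q; have := ncD (q zeta0) (1 - q zeta0).
    by rewrite subrKC Normc.normc1 nc_distC -lerBlDl.
  have Q3 : nc (q z - 1) <= (4 / k + 1) * eps.
    have -> : q z - 1 = (q z - q zeta0) + (q zeta0 - 1) by ring.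
    apply: (le_trans (ncD _ _)); rewrite mulrDl mul1r; apply: lerD => //.
    by apply: (le_trans P); rewrite ler_wpM2l// divr_ge0// ltW.
  have -> : dnum (phi z) lam - z * dden (phi z) lam = z * (q z - 1) * dden (phi z) lam.
    have D0 : dden (phi z) lam != 0 by exact: (@dden_neq0 _ _ _ phi).
    have S : cquot phi lam z = z * q z by apply: slope0; exact: cquot0.
    have -> : dnum (phi z) lam = z * q z * dden (phi z) lam by rewrite -S /cquot divfK.
    by ring.
  rewrite !ncM zr.
  have -> : eps * d1 = 1 * ((4 / k + 1) * eps) * B by rewrite /d1; ring.
  apply: ler_pM; rewrite ?mulr_ge0 ?normc_ge0 ?(ltW r_0)//; last exact: dden_bound.
  by apply: ler_pM; rewrite ?normc_ge0 ?(ltW r_0) ?(ltW r1).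
- by move=> lam l1; exact: dnum_schwarz.
- have va := v_le1 z1.
  apply: (le_trans (ncD _ _)); rewrite ncM addrC /Z; apply: lerD.
    by apply: (le_trans (ncB _ _)); rewrite Normc.normc1; lra.
  by apply: (@le_trans _ _ (1 * 2 ^+ m)); [apply: ler_pM; rewrite ?normc_ge0|rewrite mul1r].
Qed.

Let delta := k * theta / 4.
Let delta0 : 0 < delta. Proof. by rewrite /delta divr_gt0// mulr_gt0. Qed.

(** Since |v zeta0| = x <= 1 - theta, [v] cannot come near 1 on this disc; hence v / (1 - v) is
    holomorphic and bounded there. *)
Let away z : nc z <= r -> delta <= nc (1 - v z).
Proof.
move=> zr; have z1 : nc z < 1 by exact: le_lt_trans zr r1.
have /andP[r00 r0l] := r01.
have P := schwarz_pick_away diff_v v_le1 z0r zr r0l r1.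
have vz := v_le1 z1; have v0 := normc_ge0 (v z).
have T : 1 - nc (v z) <= nc (1 - v z).
  by have := ncD (v z) (1 - v z); rewrite subrKC Normc.normc1 -lerBlDl.
have X : nc (v zeta0) = x by rewrite vx nc_real ger0_norm.
rewrite X -/k in P.
have P2 : k * theta / 2 <= 1 - nc (v z) ^+ 2.
  have : k * theta <= k * (1 - x) by rewrite ler_wpM2l ?(ltW k0)// lerBrDl addrC -lerBrDl.
  by move: P; set u := k * _; lra.
rewrite /delta; nra.
Qed.

(* On [nc z = r] the conclusion of [pointwise_Re] is a lower bound for the real
   part of the holomorphic function [v / (1 - v) * b * (1 - (z / tau) ^+ m)],
   because there [conjc (tau / z) = z / tau]; the minimum principle carries it
   over to [zeta0], where [Re b < 0] makes the real part negative. *)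
Lemma rigid_disc (beta : R) : Re b = - beta -> 0 <= beta ->
  eps * (K1 / r) * (2 * Z + eps * (K1 / r)) < theta * beta * delta ^+ 2 ->
  2 * 2 ^+ m * r0 <= beta * r -> theta <= x -> False.
Proof.
move=> Rb b0 small r0b tx.
set e := _ * _ in small.
pose J z := v z / (1 - v z) * b * (1 - (z / tau) ^+ m).
have x1 : x < 1 by move: xtheta theta0; lra.
have nz z : nc z <= r -> 1 - v z != 0.
  by move=> zr; rewrite -nc_gt0; apply: lt_le_trans (away zr).
have J1 z : nc z <= r -> differentiable J z.
  move=> zr; have z1 : nc z < 1 by exact: le_lt_trans zr r1.
  apply: differentiableM.
    apply: differentiableM; last exact: differentiable_cst.
    apply: differentiable_quot; [exact: diff_v| |exact: nz].
    by apply: differentiableB; [exact: differentiable_cst|exact: diff_v].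
  apply: differentiableB; first exact: differentiable_cst.
  apply: differentiable_exp; apply: differentiableM; last exact: differentiable_cst.
  exact: differentiable_id.
have J2 z : nc z = r -> nc (J z) <= 1 / delta * 2 ^+ m * 2.
  move=> zr; have zr' : nc z <= r by rewrite zr.
  have z1 : nc z < 1 by rewrite zr.
  rewrite /J !ncM Normc.normcV.
  apply: ler_pM; rewrite ?mulr_ge0 ?invr_ge0 ?normc_ge0//.
    apply: ler_pM; rewrite ?mulr_ge0 ?invr_ge0 ?normc_ge0//.
    apply: ler_pM; rewrite ?mulr_ge0 ?invr_ge0 ?normc_ge0//; first exact: v_le1.
    by rewrite lef_pV2 ?posrE ?away// (lt_le_trans _ (away zr')).
  apply: (le_trans (ncB _ _)); rewrite Normc.normc1 ncX ncM Normc.normcV zr divff ?lt0r_neq0//.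
  by rewrite expr1n.
have JE z : nc z <= r ->
    Re (J z) = Re (v z * b * conjc (1 - v z) * (1 - (z / tau) ^+ m)) / nc (1 - v z) ^+ 2.
  move=> zr; have nzz := nz z zr.
  have -> : J z = ((nc (1 - v z) ^+ 2)^-1)%:C *
     (v z * b * conjc (1 - v z) * (1 - (z / tau) ^+ m)).
    rewrite fmorphV/= -mulcJ /J.
    have cz : conjc (1 - v z) != 0 by rewrite conjc_eq0.
    rewrite invfM; move: nzz cz; move: (1 - v z) (conjc (1 - v z)) => a a' a0 a0'.
    by field; rewrite a0 a0'.
  by rewrite Re_realM mulrC.
have e0 : 0 <= e.
  have eK : 0 <= eps * (K1 / r) by rewrite mulr_ge0// divr_ge0// ltW.
  by rewrite /e mulr_ge0// addr_ge0// mulr_ge0// addr_ge0// exprn_ge0.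
have J3 z : nc z = r -> - (e / (2 * delta ^+ 2)) <= Re (J z).
  move=> zr; have zr' : nc z <= r by rewrite zr.
  have A := away zr'; have A0 := lt_le_trans delta0 A.
  have O := on_circle zr; rewrite -/e in O.
  rewrite JE// lerNl -mulNr.
  have D2 : delta ^+ 2 <= nc (1 - v z) ^+ 2.
    by apply: lerXn2r; rewrite ?nnegrE ?normc_ge0// ltW.
  have A2 : 0 < nc (1 - v z) ^+ 2 by rewrite exprn_gt0.
  rewrite ler_pdivrMr//.
  apply: (@le_trans _ _ (e / 2)); first by lra.
  move: D2 A2; move: (nc (1 - v z) ^+ 2) => N D2 A2.
  have -> : e / (2 * delta ^+ 2) * N = e / 2 * (N / delta ^+ 2) by rewrite invfM; ring.
  by rewrite ler_peMr ?divr_ge0// ler_pdivlMr ?exprn_gt0// mul1r.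
have z0r' : nc zeta0 <= r by exact: le_trans z0r r0tau.
have := minimum_Re J1 J2 J3 z0r'.
rewrite /J vx.
set t := (zeta0 / tau) ^+ m.
have -> : x%:C / (1 - x%:C) * b * (1 - t) = (x / (1 - x))%:C * (b - b * t).
  by rewrite rmorphM/= fmorphV/= rmorphB/= rmorph1; ring.
rewrite Re_realM Re_sub Rb => H.
(* At [zeta0] the factor 1 - (zeta0 / tau)^m is nearly 1; the hypothesis on [r0] lets the correction
   b t cost at most half of [beta]. *)
have tb : nc t <= r0 / r.
  rewrite /t ncX ncM Normc.normcV -/r.
  have y1 : nc zeta0 / r <= 1 by rewrite ler_pdivrMr// mul1r.
  have y0 : 0 <= nc zeta0 / r by rewrite divr_ge0 ?normc_ge0// ltW.
  apply: (@le_trans _ _ (nc zeta0 / r)); last by rewrite ler_pM2r ?invr_gt0.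
  by case: (m) m0 => // k' _; rewrite exprS ler_piMr// exprn_ile1.
have bt : nc (b * t) <= beta / 2.
  rewrite ncM; apply: (@le_trans _ _ (2 ^+ m * (r0 / r))).
    by apply: ler_pM; rewrite ?normc_ge0.
  rewrite mulrA ler_pdivrMr//; lra.
have Rbt : - (beta / 2) <= Re (b * t).
  have := Re_le_nc (- (b * t)); rewrite Re_opp ncN; lra.
have xx : theta <= x / (1 - x).
  by rewrite ler_pdivlMr; nra.
have xx0 : 0 <= x / (1 - x) by apply: le_trans xx; exact: ltW.
have U : x / (1 - x) * (- beta - Re (b * t)) <= theta * (- (beta / 2)).
  have : x / (1 - x) * (- beta - Re (b * t)) <= x / (1 - x) * (- (beta / 2)).
    by rewrite ler_wpM2l//; lra.
  have : theta * (beta / 2) <= x / (1 - x) * (beta / 2) by rewrite ler_wpM2r// divr_ge0.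
  lra.
have F : theta * (beta / 2) <= e / (2 * delta ^+ 2) by lra.
have D0 : 0 < 2 * delta ^+ 2 by rewrite mulr_gt0// exprn_gt0.
move: F; rewrite ler_pdivlMr//.
have -> : theta * (beta / 2) * (2 * delta ^+ 2) = theta * beta * delta ^+ 2.
  by move: delta => dl; field.
by move=> /(lt_le_trans small); rewrite ltxx.
Qed.

End RigidDisc.

Lemma exists_small (K Z T : R) : 0 <= K -> 0 <= Z -> 0 < T ->
  exists2 e : R, 0 < e & e * K * (2 * Z + e * K) < T.
Proof.
move=> K0 Z0 T0; set D := K * (2 * Z + K) + 1.
have D0 : 0 < D by rewrite /D ltr_wpDl// mulr_ge0// addr_ge0// mulr_ge0.
exists (Num.min 1 (T / D)); first by rewrite lt_min ltr01 divr_gt0.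
set e := Num.min _ _.
have e1 : e <= 1 by rewrite ge_min lexx.
have eT : e * D <= T by rewrite -ler_pdivlMr// ge_min lexx orbT.
have e0 : 0 < e by rewrite lt_min ltr01 divr_gt0.
apply: lt_le_trans eT; rewrite -mulrA ltr_pM2l// /D.
have : K * (2 * Z + e * K) <= K * (2 * Z + K).
  by rewrite ler_wpM2l// lerD2l ler_piMl.
lra.
Qed.

(** [r0] depends on m only and [eps] also on theta, but neither on the disc nor on [zeta0]. The
    point 0 serves for the metric, a nonzero point for the Lempert function. The margin theta
    separates v from the values 0 and 1 that do occur. *)
Theorem rigidity (m : nat) : (2 <= m)%N ->
  exists2 r0 : R, 0 < r0 < 1 & forall theta : R, 0 < theta -> exists2 eps : R, 0 < eps &
  forall (phi : C -> 'rV[C]_m.+1) (zeta0 : C) (x : R),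
    holomorphic disc (symm_polydisc m.+1) phi -> phi 0 = 0 -> nc zeta0 <= r0 ->
    (forall lam, lam ^+ m = 1 -> nc (slope (cquot phi lam) 0 zeta0 - 1) <= eps) ->
    theta <= x <= 1 - theta ->
    slope (fun zeta => elsym (phi zeta) 1 / m.+1%:R) 0 zeta0 = x%:C -> False.
Proof.
move=> m2; have [tau tau01 Rb] := exists_negative_power m2.
have /andP[t0 t1] := tau01.
set b := (1 + tau) ^+ m in Rb.
have b2 : nc b <= 2 ^+ m.
  rewrite ncX; apply: lerXn2r; rewrite ?nnegrE ?normc_ge0//.
  by apply: (le_trans (ncD _ _)); rewrite Normc.normc1; move: t1; lra.
pose beta := - Re b.
have beta0 : 0 < beta by rewrite oppr_gt0.
have betab : beta <= 2 ^+ m.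
  by apply: le_trans b2; rewrite -ncN /beta -Re_opp Re_le_nc.
have P0 : 0 < 2 ^+ m :> R by rewrite exprn_gt0.
(* The largest radius permitted by [rigid_disc]; it is below |tau| because beta <= |1 + tau|^m <=
   2^m. *)
pose r0 := beta * nc tau / (2 * 2 ^+ m).
have r00 : 0 < r0 by rewrite divr_gt0 ?mulr_gt0.
have r0E : 2 * 2 ^+ m * r0 = beta * nc tau by rewrite /r0 mulrC divfK// mulf_neq0// lt0r_neq0.
have r0t : r0 <= nc tau.
  rewrite /r0 ler_pdivrMr ?mulr_gt0// [nc tau * _]mulrC ler_pM2r//.
  by apply: (le_trans betab); rewrite ler_peMl ?(ltW P0)// ler1n.
have r01 : 0 < r0 < 1 by rewrite r00 (le_lt_trans r0t).
exists r0 => // theta theta0.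
pose k := (1 - r0 ^+ 2) * (1 - nc tau ^+ 2) / 4.
have k0 : 0 < k.
  case/andP: r01 => _ a1.
  by rewrite /k divr_gt0 ?mulr_gt0// subr_gt0 expr_lt1// ltW.
pose d1 : R := (4 / k + 1) * (m.+1%:R * (m.+1%:R * 2 ^+ m.+1)).
have d10 : 0 <= d1.
  by apply: mulr_ge0; [rewrite addr_ge0// divr_ge0// ltW|rewrite !mulr_ge0// exprn_ge0].
pose K1 : R := 2 * m.+1%:R * (m.+2%:R ^+ m * d1) + d1.
have K10 : 0 <= K1.
  apply: addr_ge0 => //; apply: mulr_ge0; first exact: mulr_ge0.
  by apply: mulr_ge0 => //; exact: exprn_ge0.
have Kr : 0 <= K1 / nc tau by rewrite divr_ge0// ltW.
have Z0 : 0 <= 2 + 2 ^+ m :> R by rewrite addr_ge0// ltW.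
have T0 : 0 < theta * beta * (k * theta / 4) ^+ 2.
  apply: mulr_gt0; first exact: mulr_gt0.
  by apply: exprn_gt0; apply: divr_gt0 => //; exact: mulr_gt0.
have [eps eps0 small] := exists_small Kr Z0 T0.
exists eps => // phi zeta0 x hphi phi0 z0r qclose /andP[tx xt] vx.
have x0 : 0 <= x by apply: le_trans tx; exact: ltW.
apply: (@rigid_disc m phi tau zeta0 r0 x theta eps m2 hphi phi0 tau01 r01 z0r r0t (ltW eps0)
  qclose theta0 xt x0 vx beta) => //.
- by rewrite /beta opprK.
- exact: ltW.
- by rewrite r0E.
Qed.

End Rigidity.

(** * Strict inequality between rho and kappa on L_{1,n} *)

Section Mixed.
Context {R : realType}.
Local Notation C := R[i].
Local Notation Re := (@complex.Re R).
Local Notation Im := (@complex.Im R).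
Local Notation nc := (@Normc.normc R).
Local Open Scope complex_scope.

Section Rotation.
Variables (n : nat) (phi : C -> 'rV[C]_n) (u w : C).
Hypotheses (hphi : holomorphic disc (symm_polydisc n) phi) (u1 : nc u = 1) (w1 : nc w = 1).

(** Multiplying all roots by [u] multiplies the k-th symmetric function by u^k. Together with the
    rotation [w] of the parameter this gives two free arguments, enough to make both coefficients of
    a e_1 + b e_n positive. *)
Definition rotate_disc (z : C) : 'rV[C]_n := \row_(k < n) (u ^+ k.+1 * phi (w * z) 0 k).

Lemma differentiable_rescale (V : normedModType C) (f : C -> V) (a z : C) :
  differentiable f (a * z) -> differentiable (fun x => f (a * x)) z.
Proof.
move=> df; have da : differentiable (fun x => a * x) z.
  by apply: differentiableM; [exact: differentiable_cst|exact: differentiable_id].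
exact: (@differentiable_comp _ _ _ _ (fun x => a * x) f z da df).
Qed.

Lemma derive1_rescale (V : normedModType C) (f : C -> V) (a z : C) :
  differentiable f (a * z) -> derive1 (fun x => f (a * x)) z = a *: derive1 f (a * z).
Proof.
move=> df; have da : is_derive z 1 (fun x => a * x) a.
  have := is_deriveZ a (is_derive_id z (1 : C)).
  by rewrite scaleC mulr1.
have dda : differentiable (fun x => a * x) z.
  by apply: differentiableM; [exact: differentiable_cst|exact: differentiable_id].
rewrite (derive1_comp_diff dda df) (derive1_eq da) (derive1E' df).
move: ('d f (a * z)) => L.
transitivity (L (a *: (1 : C))); first by congr (L _); rewrite scaleC mulr1.
exact: linearZ.
Qed.

Lemma rotate_disc_holomorphic : holomorphic disc (symm_polydisc n) rotate_disc.
Proof.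
move=> z z1; have wz : nc (w * z) < 1 by rewrite ncM w1 mul1r.
have [dphi [s s1 sE]] := hphi wz; split.
  apply: differentiable_row => k; under eq_fun do rewrite mxE.
  apply: differentiableM; first exact: differentiable_cst.
  apply: (@differentiable_rescale _ (fun x => phi x 0 k)).
  exact: differentiable_coordinate.
exists (u *: s); first by move=> j; rewrite /disc/= mxE ncM u1 mul1r; exact: s1.
by rewrite symm_scale; apply/rowP => k; rewrite !mxE -sE mxE.
Qed.

Lemma rotate_disc0 : phi 0 = 0 -> rotate_disc 0 = 0.
Proof. by move=> phi0; apply/rowP => k; rewrite !mxE mulr0 phi0 mxE mulr0. Qed.

Lemma derive1_rotate_disc (k : 'I_n) :
  derive1 rotate_disc 0 0 k = u ^+ k.+1 * w * derive1 phi 0 0 k.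
Proof.
have z1 : nc (0 : C) < 1 by rewrite Normc.normc0.
have [dphi _] := hphi z1; have [drot _] := rotate_disc_holomorphic z1.
suff H : derive1 (fun x => rotate_disc x 0 k) 0 = u ^+ k.+1 * w * derive1 (fun x => phi x 0 k) 0.
  apply: (etrans (derive1_coordinate k drot)); apply: (etrans H); congr (_ * _).
  exact/esym/derive1_coordinate.
have -> : (fun x => rotate_disc x 0 k) = (fun x => u ^+ k.+1 *: phi (w * x) 0 k).
  by apply/funext => x; rewrite mxE.
have d0 : differentiable (fun x => phi x 0 k) (w * 0).
  by rewrite mulr0; exact: differentiable_coordinate.
have dd : differentiable (fun x => phi (w * x) 0 k) 0.
  exact: (@differentiable_rescale _ (fun x => phi x 0 k) _ _ d0).
apply: derive1_eq.
have := is_deriveZ (u ^+ k.+1) (derive1_is_derive dd).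
by rewrite (@derive1_rescale _ (fun x => phi x 0 k) _ _ d0) mulr0 !scaleC mulrA.
Qed.

End Rotation.


(** For positive a, b the slope at 0 equals rho / alpha at every m-th root of unity, and v(0) = a /
    ((m+1) alpha) lies strictly between 0 and 1. If alpha were too close to rho, this would
    contradict rigidity at zeta0 = 0. *)
Lemma mixed_disc_lower_bound (m : nat) (a b : R) : (2 <= m)%N -> 0 < a -> 0 < b ->
  exists2 eta : R, 0 < eta & forall (alpha : R) (phi : C -> 'rV[C]_m.+1),
    0 <= alpha -> holomorphic disc (symm_polydisc m.+1) phi -> phi 0 = 0 ->
    alpha%:C *: derive1 phi 0 = a%:C *: basis_vec m.+1 1 + b%:C *: basis_vec m.+1 m.+1 ->
    a / m.+1%:R + b + eta <= alpha.
Proof.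
move=> m2 a0 b0; have [r0 /andP[r00 _] H] := @rigidity R m m2.
have nR : 0 < m.+1%:R :> R by rewrite ltr0n.
have nC : m.+1%:R != 0 :> C by rewrite pnatr_eq0.
set rh := a / m.+1%:R + b.
have rh0 : 0 < rh by rewrite addr_gt0// divr_gt0.
(* Lower bounds for v(0) and for 1 - v(0) >= b / alpha, valid as soon as alpha <= 2 rh. *)
pose theta := Num.min (a / m.+1%:R / (2 * rh)) (b / (2 * rh)).
have theta0 : 0 < theta by rewrite lt_min !divr_gt0// mulr_gt0.
have [eps eps0 {}H] := H theta theta0.
(* The first term makes rh / alpha lie within [eps] of 1, the second ensures alpha <= 2 rh. *)
exists (Num.min (eps * rh) rh); first by rewrite lt_min mulr_gt0.
set eta := Num.min _ _ => alpha phi alpha0 hphi phi0 phiX.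
rewrite leNgt; apply/negP => lt.
have eta1 : eta <= eps * rh by rewrite ge_min lexx.
have eta2 : eta <= rh by rewrite ge_min lexx orbT.
have z1 : nc (0 : C) < 1 by rewrite Normc.normc0.
pose D := derive1 phi 0.
have DX k : alpha%:C * D 0 k = a%:C * (k.+1 == 1)%:R + b%:C * (k.+1 == m.+1)%:R.
  by have := congr1 (fun M : 'rV[C]_m.+1 => M 0 k) phiX; rewrite !mxE.
have m_neq0 : (1 == m.+1)%N = false by case: (m) m2.
have D0 : alpha%:C * D 0 ord0 = a%:C.
  by rewrite DX /= m_neq0 mulr1 mulr0 addr0.
have alC : alpha%:C != 0 :> C.
  apply/eqP => E; move: D0; rewrite E mul0r => /esym/complexI E'.
  by rewrite E' ltxx in a0.
have al0 : 0 < alpha.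
  rewrite lt_def alpha0 andbT; apply/eqP => E.
  by rewrite E eqxx in alC.
have qE lam : nc lam = 1 -> lam ^+ m = 1 -> slope (cquot phi lam) 0 0 = (rh / alpha)%:C.
  move=> l1 lm; rewrite /slope eqxx derive1_cquot// -/D.
  apply: (mulfI alC); rewrite mulrCA mulr_sumr.
  have -> : \sum_(j < m.+1) alpha%:C * (j.+1%:R * D 0 j * lam ^+ j) = a%:C + m.+1%:R * b%:C.
    under eq_bigr => j _.
      have -> : alpha%:C * (j.+1%:R * D 0 j * lam ^+ j) =
         j.+1%:R * (a%:C *: basis_vec m.+1 1) 0 j * lam ^+ j +
         j.+1%:R * (b%:C *: basis_vec m.+1 m.+1) 0 j * lam ^+ j.
        by rewrite !mxE -mulrDl -mulrDr -DX; ring.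
      over.
    have S1 := @rho_sum_basis R m.+1 1 a%:C lam isT.
    have S2 := @rho_sum_basis R m.+1 m.+1 b%:C lam (leqnn _).
    rewrite big_split; apply: (etrans (congr2 +%R S1 S2)).
    by rewrite lm expr0 !mulr1 mul1r.
  rewrite -(rmorphM (real_complex R)) [alpha * _]mulrC divfK ?lt0r_neq0// /rh.
  by rewrite rmorphD/= rmorphM/= fmorphV rmorph_nat; field.
have nc1 : nc (1 : C) = 1 by exact: Normc.normc1.
have rha : rh <= alpha.
  have := slope_cquot_le1 (ltn0Sn m) hphi phi0 nc1 z1.
  by rewrite qE// ?expr1n// nc_real ger0_norm ?divr_ge0 ?(ltW rh0)// ler_pdivrMr// mul1r.
have al2 : alpha <= 2 * rh by move: lt eta2; lra.
pose x := a / (m.+1%:R * alpha).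
apply: (H phi 0 x) => //.
- by rewrite Normc.normc0 ltW.
- move=> lam lm; have l1 := nc_unity_root (leq_trans (leqnSn 1) m2) lm.
  rewrite qE//; have -> : (rh / alpha)%:C - 1 = (rh / alpha - 1)%:C by rewrite rmorphB rmorph1.
  rewrite nc_real.
  rewrite ler0_norm; last by rewrite subr_le0 ler_pdivrMr// mul1r.
  rewrite opprB lerBlDr -lerBlDl ler_pdivlMr//.
  have : eps * rh <= eps * alpha by rewrite ler_wpM2l// ltW.
  by move: lt eta1; lra.
- have th1 : theta <= a / m.+1%:R / (2 * rh) by rewrite ge_min lexx.
  have th2 : theta <= b / (2 * rh) by rewrite ge_min lexx orbT.
  have -> : x = (a / m.+1%:R) / alpha by rewrite /x invfM mulrA.
  apply/andP; split.
    apply: (le_trans th1).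
    by rewrite ler_pM2l ?divr_gt0// lef_pV2 ?posrE// mulr_gt0.
  have B1 : b / (2 * rh) <= b / alpha.
    by rewrite ler_pM2l// lef_pV2 ?posrE// mulr_gt0.
  rewrite ler_pdivrMr//; have : theta * alpha <= b.
    by rewrite -ler_pdivlMr//; exact: le_trans B1.
  by move=> tb; rewrite mulrBl mul1r lerBrDr; apply: le_trans rha; rewrite lerD2l.
- rewrite /slope eqxx.
  have [dphi _] := hphi 0 z1.
  have -> : (fun zeta => elsym (phi zeta) 1 / m.+1%:R) = (fun zeta => m.+1%:R^-1 *: phi zeta 0 ord0).
    apply/funext => z; rewrite scaleC mulrC (elsym_lt _ (ltn0Sn m)).
    by have -> : Ordinal (ltn0Sn m) = ord0 by exact: val_inj.
  apply: (etrans (derive1_eq (is_deriveZ m.+1%:R^-1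
    (derive1_is_derive (differentiable_coordinate ord0 dphi))))).
  rewrite scaleC -[X in _ * X](derive1_coordinate ord0 dphi) -/D.
  apply: (mulfI alC); rewrite mulrCA D0 /x rmorphM/= fmorphV rmorphM rmorph_nat/=.
  by move: nC alC; move: (m.+1%:R : C) (alpha%:C) => p q p0 q0; field; rewrite p0 q0.
Qed.

Theorem rho_lt_kobayashi_royden (n : nat) (a b : C) : (3 <= n)%N -> a != 0 -> b != 0 ->
  (rho (a *: basis_vec n 1 + b *: basis_vec n n) <
   kobayashi_royden (symm_polydisc n) 0 (a *: basis_vec n 1 + b *: basis_vec n n))%E.
Proof.
case: n => // m m2 a0 b0.
have [p p1 aE] := phase a; have [q q1 bE] := phase b.
have p0 : p != 0 by rewrite -nc_gt0 p1.
have q0 : q != 0 by rewrite -nc_gt0 q1.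
have m0 : (0 < m)%N by case: (m) m2.
(* The arguments are removed when u w p = 1 and u^(m+1) w q = 1; the first equation gives [w], and
   then the second reads u^m = p / q. *)
have [u u1 uE] : exists2 u : C, nc u = 1 & u ^+ m = p / q.
  by apply: unimodular_root; rewrite // ncM Normc.normcV p1 q1 divr1.
have u0 : u != 0 by rewrite -nc_gt0 u1.
pose w := (u * p)^-1.
have w1 : nc w = 1 by rewrite Normc.normcV ncM u1 p1 mulr1 invr1.
have na0 : 0 < nc a by rewrite nc_gt0.
have nb0 : 0 < nc b by rewrite nc_gt0.
have [eta eta0 H] := mixed_disc_lower_bound m2 na0 nb0.
rewrite rho_coordinate_span ?leqnn//.
rewrite mulr1 mulfK ?pnatr_eq0//.
apply: (@lt_le_trans _ _ (nc a / m.+1%:R + nc b + eta)%:E); first by rewrite lte_fin ltrDl.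
apply: le_ereal_inf_tmp => _ [alpha [alpha0 [phi [hphi phi0 phiX]]] <-]; rewrite lee_fin.
apply: (H alpha (rotate_disc phi u w)) => //.
- exact: rotate_disc_holomorphic.
- exact: rotate_disc0.
apply/rowP => k; rewrite mxE derive1_rotate_disc//.
have E : alpha%:C * derive1 phi 0 0 k = a * (k.+1 == 1)%:R + b * (k.+1 == m.+1)%:R.
  by have := congr1 (fun M : 'rV[C]_m.+1 => M 0 k) phiX; rewrite !mxE.
rewrite mulrCA E !mxE mulrDr; congr (_ + _).
  case: (eqVneq (k : nat) 0%N) => [k0|k0]; last by rewrite eqSS (negbTE k0) !mulr0.
  rewrite k0 eqxx !mulr1 expr1 [in LHS]aE /w.
  by move: (_%:C) => A; field; rewrite u0 p0.
rewrite eqSS; case: (eqVneq (k : nat) m) => [km|km]; last by rewrite !mulr0.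
rewrite km !mulr1 exprS uE [in LHS]bE /w.
by move: (_%:C) => A; field; rewrite u0 p0 q0.
Qed.

End Mixed.

(** * A chain of two discs that no single disc can replace *)

Section ChainOfDiscs.
Context {R : realType}.
Local Notation C := R[i].
Local Notation Re := (@complex.Re R).
Local Notation Im := (@complex.Im R).
Local Notation nc := (@Normc.normc R).
Local Open Scope complex_scope.

Lemma nc_exp1D (x : C) (m : nat) : nc x <= 1 -> nc ((1 + x) ^+ m - 1) <= (2 ^+ m - 1) * nc x.
Proof.
move=> x1; elim: m => [|m IH]; first by rewrite !expr0 !subrr mul0r Normc.normc0.
have -> : (1 + x) ^+ m.+1 - 1 = ((1 + x) ^+ m - 1) * (1 + x) + x by rewrite exprSr; ring.
apply: (le_trans (ncD _ _)); rewrite ncM.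
have x2 : nc (1 + x) <= 2 by apply: (le_trans (ncD _ _)); rewrite Normc.normc1; lra.
have : nc ((1 + x) ^+ m - 1) * nc (1 + x) <= (2 ^+ m - 1) * nc x * 2.
  by apply: ler_pM; rewrite ?normc_ge0.
by rewrite exprSr; lra.
Qed.

Section Chain.
Variables (m : nat) (c : R).
Hypothesis c01 : 0 < c < 1.
Local Notation n := m.+1.
Let k : C := c%:C.

Let nk : nc k = c. Proof. by rewrite nc_real gtr0_norm//; case/andP: c01. Qed.
Let k1 : nc k < 1. Proof. by rewrite nk; case/andP: c01. Qed.

(** The Moebius map (k + t) / (1 + k t) preserves the closed disc. Hence for |z| < 1 the term z (k +
    t)^n cannot cancel (1 + k t)^n, and [chain_poly] has no zero there. *)
Let near_le t : nc t <= 1 -> nc (k + t) <= nc (1 + k * t).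
Proof.
move=> t1; rewrite -(ler_pXn2r (n := 2))// ?nnegrE ?normc_ge0//.
have := moebius_identity (- k) t.
have -> : conjc (- k) = - k by rewrite /k/=; congr (_ +i* _); rewrite !oppr0.
rewrite mulNr !opprK ncN nk addrC => ->; rewrite addrC lerDl mulr_ge0// subr_ge0.
  by rewrite expr_le1//; case/andP: c01 => /ltW ? /ltW.
by rewrite expr_le1// normc_ge0.
Qed.

Let far_neq0 t : nc t <= 1 -> 1 + k * t != 0.
Proof.
move=> t1; rewrite addrC addr_eq0; apply/eqP => /(congr1 nc).
rewrite ncN Normc.normc1 ncM nk => E.
have : c * nc t <= c * 1 by rewrite ler_wpM2l//; case/andP: c01 => /ltW.
by rewrite E mulr1 leNgt; case/andP: c01 => _ ->.
Qed.

Let scale_neq0 z : nc z < 1 -> 1 + z * k ^+ n != 0.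
Proof.
move=> z1; rewrite addrC addr_eq0; apply/eqP => /(congr1 nc).
rewrite ncN Normc.normc1 ncM ncX nk => E.
have : nc z * c ^+ n <= nc z * 1.
  by rewrite ler_wpM2l ?normc_ge0// exprn_ile1//; case/andP: c01 => /ltW ? /ltW.
by rewrite E mulr1 leNgt z1.
Qed.

(* The second of two discs joining 0 to the polynomial at [z = k] through
   [(1 + k 'X) ^+ n]; the first one is [(1 + z 'X) ^+ n]. *)
Definition chain_poly (z : C) : {poly C} :=
  (1 + z * k ^+ n)^-1 *: ((1 + k *: 'X) ^+ n + z *: (k%:P + 'X) ^+ n).

Lemma horner_chain_poly z t :
  (chain_poly z).[t] = (1 + z * k ^+ n)^-1 * ((1 + k * t) ^+ n + z * (k + t) ^+ n).
Proof. by rewrite /chain_poly !hornerE. Qed.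

Lemma chain_disc : exists2 psi : C -> 'rV[C]_n, holomorphic disc (symm_polydisc n) psi &
  forall z, nc z < 1 -> gpoly (psi z) = chain_poly z.
Proof.
have sq (p : {poly C}) : (size p <= 2)%N -> (size (p ^+ n) <= n.+1)%N.
  move=> p2; apply: (leq_trans (size_poly_exp_leq _ _)).
  by rewrite ltnS -[leqRHS]mul1n leq_mul2r -subn1 leq_subLR addn1 p2 orbT.
have psize z : (size (chain_poly z) <= n.+1)%N.
  apply: (leq_trans (size_scale_leq _ _)).
  apply: (leq_trans (size_polyD _ _)); rewrite geq_max; apply/andP; split.
    apply: sq; apply: (leq_trans (size_polyD _ _)); rewrite geq_max size_poly1/=.
    by apply: (leq_trans (size_scale_leq _ _)); rewrite size_polyX.
  apply: (leq_trans (size_scale_leq _ _)); apply: sq.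
  apply: (leq_trans (size_polyD _ _)); rewrite geq_max size_polyX andbT.
  by apply: leq_trans (size_polyC_leq1 _) _.
have p0 z : nc z < 1 -> (chain_poly z)`_0 = 1.
  move=> z1; rewrite -horner_coef0 horner_chain_poly mulr0 !addr0.
  by rewrite expr1n mulVf// scale_neq0.
have pnz z t : nc z < 1 -> nc t <= 1 -> (chain_poly z).[t] != 0.
  move=> z1 t1; rewrite horner_chain_poly.
  rewrite mulf_neq0 ?invr_neq0 ?scale_neq0// addr_eq0; apply/eqP => /(congr1 nc).
  rewrite ncN ncM !ncX => E.
  have f0 : 0 < nc (1 + k * t) ^+ n by rewrite exprn_gt0// nc_gt0 far_neq0.
  have le : nc (k + t) ^+ n <= nc (1 + k * t) ^+ n.
    by apply: lerXn2r; rewrite ?nnegrE ?normc_ge0// near_le.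
  have : nc z * nc (k + t) ^+ n <= nc z * nc (1 + k * t) ^+ n by rewrite ler_wpM2l ?normc_ge0.
  by rewrite -E; apply/negP; rewrite -ltNge gtr_pMl.
have pdiff z j : nc z < 1 -> differentiable (fun x => (chain_poly x)`_j) z.
  move=> z1.
  have -> : (fun x => (chain_poly x)`_j) = (fun x => (((1 + k *: 'X) ^+ n)`_j +
      x * ((k%:P + 'X) ^+ n)`_j) / (1 + x * k ^+ n)).
    by apply/funext => x; rewrite /chain_poly coefZ coefD coefZ mulrC.
  have dl (a b : C) : differentiable (fun x : C => a + x * b) z.
    apply: differentiableD; first exact: differentiable_cst.
    by apply: differentiableM; [exact: differentiable_id|exact: differentiable_cst].
  by apply: (@differentiable_quot _ (fun x => _ + x * _) (fun x => 1 + x * _)); [exact: dl|exact: dl|exact: scale_neq0].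
exists (poly_disc n chain_poly); first exact: holomorphic_poly_disc.
by move=> z z1; exact: gpoly_poly_disc.
Qed.

Lemma lempert2_chain : exists2 s : 'rV[C]_n, symm_polydisc n s &
  gpoly s = chain_poly k /\
  (lempert2 (symm_polydisc n) 0 s <= (artanh (2 * c / (1 + c ^+ 2)))%:E)%E.
Proof.
have [psi hpsi psiE] := chain_disc.
have [phi [hphi phi0 _ phiE]] := @divisor_disc R n (ltn0Sn m) 1 1 isT (dvd1n _) (Normc.normc1 R).
have z1 : nc (0 : C) < 1 by rewrite Normc.normc0.
exists (psi k); first by have [] := hpsi k k1.
split; first exact: psiE.
have E : psi 0 = phi k.
  apply: gpoly_inj; rewrite psiE// phiE// /chain_poly mul0r addr0 invr1 scale1r scale0r addr0.
  by rewrite mul1r divn1 expr1.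
have cc : 0 <= c < 1 by case/andP: c01 => /ltW -> ->.
rewrite artanh_double// mulr_natl mulr2n EFinD.
apply: ge_ereal_inf; exists (lempert (symm_polydisc n) 0 (phi k) +
  lempert (symm_polydisc n) (phi k) (psi k))%E.
  by exists (phi k) => //; have [] := hphi k k1.
apply: leeD; apply: ereal_inf_lbound; exists k; rewrite ?nk//; split => //.
  by exists phi.
by exists psi.
Qed.

Lemma chain_deriv (s : 'rV[C]_n) (lam : C) : gpoly s = chain_poly k ->
  dnum s lam = (1 + k * k ^+ n)^-1 * (n%:R * k * ((1 + k * lam) ^+ m + (k + lam) ^+ m)).
Proof.
have D (a b : C) : ((a%:P + b *: 'X) ^+ n)^`().[lam] = n%:R * b * (a + b * lam) ^+ m.
  rewrite deriv_exp derivD derivC derivZ derivX add0r hornerMn hornerM hornerZ hornerC.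
  by rewrite horner_exp hornerD hornerC hornerZ hornerX mulr1 -mulr_natl mulrA.
move=> sE; rewrite dnumE sE /chain_poly derivZ derivD derivZ hornerZ hornerD hornerZ.
have := D 1 k; rewrite polyC1 => ->; have := D k 1; rewrite scale1r => ->.
by rewrite !mul1r; ring.
Qed.

Lemma chain_elsym1 (s : 'rV[C]_n) : gpoly s = chain_poly k ->
  elsym s 1 = (n%:R * (c * (1 + c ^+ m) / (1 + c ^+ n.+1)))%:C.
Proof.
move=> sE; have <- : dnum s 0 = elsym s 1.
  by rewrite dnumE horner_coef0 coef_deriv.
rewrite chain_deriv// mulr0 !addr0 expr1n -exprS.
have -> : k ^+ m = (c ^+ m)%:C by rewrite rmorphXn.
have -> : k ^+ n.+1 = (c ^+ n.+1)%:C by rewrite rmorphXn.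
move: (c ^+ m) (c ^+ n.+1) => p q.
by rewrite !(rmorphM, fmorphV, rmorphD, rmorph1, rmorph_nat)/=; ring.
Qed.

(** Put U = (1 + k lam)^m. As lam^m = 1 and |lam| = 1, the factor (k + lam)^m is the conjugate of U,
    and the quotient is k (U + conjc U) / (U + k^2 conjc U). For real U this is exactly 2 k / (1 +
    k^2), and U - 1 is at most c 2^m in modulus. *)
Lemma chain_quot_close (s : 'rV[C]_n) (lam : C) : gpoly s = chain_poly k ->
  nc lam = 1 -> lam ^+ m = 1 -> 2 * (c * 2 ^+ m) <= 1 -> dden s lam != 0 ->
  nc (dnum s lam / dden s lam - (2 * c / (1 + c ^+ 2))%:C) <=
  2 * (c * 2 ^+ m) * (2 * c / (1 + c ^+ 2)).
Proof.
move=> sE l1 lm small D0; have /andP[c0 c1] := c01.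
set delta := c * 2 ^+ m in small *; set al := 2 * c / (1 + c ^+ 2).
have nE := chain_deriv lam sE.
set U := (1 + k * lam) ^+ m in nE.
have lamJ : lam * conjc lam = 1 by rewrite mulcJ l1 expr1n.
have VE : (k + lam) ^+ m = conjc U.
  have -> : k + lam = lam * (1 + k * conjc lam) by rewrite mulrDr mulr1 mulrCA lamJ; ring.
  rewrite exprMn lm mul1r /U rmorphXn rmorphD rmorph1 rmorphM; congr ((_ + _ * _) ^+ _).
  by rewrite /k/= oppr0.
rewrite VE in nE.
set W := (1 + k * k ^+ n)^-1 in nE.
have dE : dden s lam = W * (n%:R * (U + k ^+ 2 * conjc U)).
  have := nE; rewrite dnumE => nE'; rewrite ddenE nE' sE horner_chain_poly -/W.
  rewrite [_ ^+ n]exprS [in X in _ * (_ * (_ + _ * X))]exprS -/U VE; ring.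
have U1 : nc (U - 1) <= delta.
  have kl : nc (k * lam) = c by rewrite ncM l1 nk mulr1.
  have := @nc_exp1D (k * lam) m; rewrite kl => /(_ (ltW c1)) H; apply: (le_trans H).
  by rewrite /delta mulrC; rewrite ler_pM2l// gerBl.
have Uge : 1 / 2 <= nc U.
  have := ncD U (1 - U); rewrite subrKC Normc.normc1 nc_distC; lra.
have UJ : nc (conjc U - U) <= 2 * delta.
  have -> : conjc U - U = conjc (U - 1) - (U - 1) by rewrite conjcB rmorph1; ring.
  by apply: (le_trans (ncB _ _)); rewrite ncJ; lra.
have c2 : 0 <= c ^+ 2 < 1 by rewrite sqr_ge0 expr_lt1// ltW.
have Dge : (1 - c ^+ 2) / 2 <= nc (U + k ^+ 2 * conjc U).
  have := ncD (U + k ^+ 2 * conjc U) (- (k ^+ 2 * conjc U)).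
  rewrite addrK ncN ncM ncX ncJ nk => H.
  have : (1 - c ^+ 2) * (1 / 2) <= (1 - c ^+ 2) * nc U by rewrite ler_wpM2l//; lra.
  lra.
have k20 : 1 + k ^+ 2 != 0.
  have -> : 1 + k ^+ 2 = (1 + c ^+ 2)%:C by rewrite rmorphD rmorphXn rmorph1.
  by apply/eqP => /complexI/eqP; rewrite gt_eqF//; lra.
have alE : al%:C = 2 * k / (1 + k ^+ 2).
  have -> : k ^+ 2 = (c ^+ 2)%:C by rewrite rmorphXn.
  by rewrite /al !(rmorphM, fmorphV, rmorphD, rmorph1, rmorph_nat).
have nD : nc (dden s lam) != 0 by rewrite lt0r_neq0// nc_gt0.
have nD0 : 0 < nc (dden s lam) by rewrite nc_gt0.
have -> : dnum s lam / dden s lam - al%:C = (dnum s lam - al%:C * dden s lam) / dden s lam.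
  by field.
rewrite ncM Normc.normcV ler_pdivrMr//.
have -> : dnum s lam - al%:C * dden s lam =
    W * n%:R * (k * (1 - k ^+ 2) / (1 + k ^+ 2) * (conjc U - U)).
  by rewrite nE dE alE; field.
rewrite dE [W * (_ * _)]mulrA ncM [nc (W * _ * _)]ncM mulrCA ler_wpM2l ?normc_ge0//.
rewrite !ncM Normc.normcV nk.
have -> : nc (1 - k ^+ 2) = 1 - c ^+ 2.
  have -> : 1 - k ^+ 2 = (1 - c ^+ 2)%:C by rewrite rmorphB rmorphXn rmorph1.
  by rewrite nc_real ger0_norm//; lra.
have -> : nc (1 + k ^+ 2) = 1 + c ^+ 2.
  have -> : 1 + k ^+ 2 = (1 + c ^+ 2)%:C by rewrite rmorphD rmorphXn rmorph1.
  by rewrite nc_real ger0_norm//; lra.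
have cm : 0 <= 1 - c ^+ 2 by rewrite subr_ge0; case/andP: c2 => _ /ltW.
have cp : 0 < 1 + c ^+ 2 by rewrite ltr_pwDl//; case/andP: c2.
have q0 : 0 <= (1 - c ^+ 2) / (1 + c ^+ 2) by rewrite divr_ge0// ltW.
apply: (@le_trans _ _ (c * (1 - c ^+ 2) / (1 + c ^+ 2) * (2 * delta))).
  by rewrite ler_wpM2l// -mulrA mulr_ge0// ltW.
have dl0 : 0 <= delta by rewrite mulr_ge0 ?exprn_ge0// ltW.
have -> : c * (1 - c ^+ 2) / (1 + c ^+ 2) * (2 * delta) = 2 * delta * al * ((1 - c ^+ 2) / 2).
  by rewrite /al; field; exact: lt0r_neq0.
have al0 : 0 <= al by rewrite divr_ge0 ?mulr_ge0 ?(ltW c0) ?(ltW cp).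
by rewrite ler_wpM2l//; apply: mulr_ge0 => //; exact: mulr_ge0.
Qed.

End Chain.

(** Were the two equal, a disc through 0 would reach the point of the chain at a parameter [a] close
    to al = 2 c / (1 + c^2). There all the quotients at roots of unity are close to [al], so their
    slopes are close to 1, while v is about c / (2 c) = 1/2. Rigidity at zeta0 = a with theta = 1/4
    excludes this. *)
Theorem lempert_neq_lempert2 (n : nat) : (3 <= n)%N ->
  exists2 z : 'rV[C]_n, symm_polydisc n z &
    lempert (symm_polydisc n) 0 z <> lempert2 (symm_polydisc n) 0 z.
Proof.
case: n => // m m2; rewrite ltnS in m2; have [r0 /andP[r00 _] H] := @rigidity R m m2.
have [|eps eps0 {}H] := H (1 / 4); first by lra.
have m0 : (0 < m)%N by exact: (leq_trans _ m2).
have T1 : 1 <= 2 ^+ m :> R by rewrite exprn_ege1// ler1n.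
set T := 2 ^+ m in T1.
(* The first bound keeps c 2^m small, the second gives a <= 3 c <= r0, and the third makes the
   deviation of the slopes from 1 at most [eps]. *)
pose c := Num.min (1 / (16 * T)) (Num.min (r0 / 3) (eps / (8 * T + 2))).
have c0 : 0 < c by rewrite !lt_min !divr_gt0//; lra.
have cT : c * T <= 1 / 16.
  have : c <= 1 / (16 * T) by rewrite ge_min lexx.
  by rewrite ler_pdivlMr; lra.
have cr : 3 * c <= r0.
  have : c <= r0 / 3 by rewrite !ge_min lexx orbT.
  lra.
have ce : 8 * (c * T) + 2 * c <= eps.
  have : c <= eps / (8 * T + 2) by rewrite !ge_min lexx !orbT.
  by rewrite ler_pdivlMr; lra.
clearbody c.
have c16 : c <= 1 / 16 by apply: le_trans cT; rewrite ler_peMr// ltW.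
have c01 : 0 < c < 1 by rewrite c0; lra.
have [s Gs [sE sL]] := @lempert2_chain m c c01.
exists s => // E.
pose al := 2 * c / (1 + c ^+ 2); rewrite -/al in sL.
have cc0 : 0 <= c ^+ 2 by exact: sqr_ge0.
have cc : c ^+ 2 <= c / 16 by rewrite expr2; have := ler_wpM2l (ltW c0) c16; lra.
have alE : al * (1 + c ^+ 2) = 2 * c by rewrite /al divfK// gt_eqF//; lra.
have al0 : 0 < al by rewrite divr_gt0//; lra.
have al2 : al <= 2 * c by rewrite -alE ler_peMr ?(ltW al0)//; lra.
have al1 : 19 / 10 * c <= al.
  by have := ler_wpM2l (ltW al0) cc; have := ler_wpM2l (ltW al0) c16; lra.
(* The infimum need not be attained, so a slack is allowed; c^2 is negligible against [al], which is
   about 2 c. *)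
have [alpha a1 [phi [hphi phi0 phia]]] : exists2 alpha : C, nc alpha < al + c ^+ 2 &
    exists phi : C -> 'rV[C]_m.+1,
    [/\ holomorphic disc (symm_polydisc m.+1) phi, phi 0 = 0 & phi alpha = s].
  have : (lempert (symm_polydisc m.+1) 0 s < (artanh (al + c ^+ 2))%:E)%E.
    rewrite E; apply: (le_lt_trans sL); rewrite lte_fin ltNge; apply/negP => le.
    have : al + c ^+ 2 <= al.
      by apply: artanh_inj_le le; apply/andP; split; lra.
    by rewrite gerDl leNgt exprn_gt0.
  move=> /ereal_inf_lt[_ [alpha [alpha1 [phi hphi]] <-]]; rewrite lte_fin => lt.
  exists alpha; last by exists phi.
  rewrite ltNge; apply/negP => le; move: lt; apply/negP; rewrite -leNgt.
  by apply: artanh_mono => //; lra.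
set a := nc alpha in a1.
have [w w1 aw] := phase alpha; rewrite -/a in aw.
have aR : a%:C * w = alpha by rewrite -aw.
have a_ge0 : 0 <= a by exact: normc_ge0.
have na : nc (a%:C : C) = a by rewrite nc_real ger0_norm.
have a3 : a <= 3 * c by have := cc; lra.
have a_lt1 : nc (a%:C : C) < 1 by rewrite na; lra.
(* Only the parameter is rotated, which makes it real and positive and leaves the end point
   unchanged; v is then real there. *)
pose rot := rotate_disc phi 1 w.
have hrot : holomorphic disc (symm_polydisc m.+1) rot.
  by apply: rotate_disc_holomorphic; rewrite ?Normc.normc1.
have rot0 : rot 0 = 0 by exact: rotate_disc0.
have rota : rot a%:C = s.
  by apply/rowP => j; rewrite mxE expr1n mul1r mulrC aR phia.
have D0 lam : nc lam = 1 -> dden s lam != 0.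
  by move=> l1; rewrite -rota; exact: (dden_neq0 (ltn0Sn m) hrot).
have close lam : lam ^+ m = 1 -> nc (dnum s lam / dden s lam - al%:C) <= 2 * (c * T) * al.
  move=> lm; have l1 := nc_unity_root m0 lm.
  by apply: (chain_quot_close c01 sE l1 lm _ (D0 _ l1)); rewrite -/T; lra.
have cT0 : 0 <= c * T by rewrite mulr_ge0 ?(ltW c0)//; lra.
have al8 : 2 * (c * T) * al <= al / 8 by have := ler_wpM2r (ltW al0) cT; lra.
have a_ge : al - 2 * (c * T) * al <= a.
  have n1 : nc (1 : C) = 1 by exact: Normc.normc1.
  have := close 1 (expr1n _ _); have D1 := D0 1 n1.
  have := dnum_schwarz (ltn0Sn m) hrot rot0 n1 a_lt1.
  rewrite rota na -ler_pdivrMr ?nc_gt0// -Normc.normcV -ncM.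
  move: (dnum s 1 / dden s 1) => f fa fal.
  have := ncD f (al%:C - f); rewrite subrKC nc_real gtr0_norm// nc_distC; lra.
have a0 : 0 < a by apply: lt_le_trans a_ge; lra.
have aC : a%:C != 0 :> C by rewrite -nc_gt0 na.
pose x := c * (1 + c ^+ m) / (1 + c ^+ m.+2) / a.
have cm : c ^+ m <= c by case: (m) m0 => // k _; rewrite exprS ler_piMr ?(ltW c0)// exprn_ile1 ?(ltW c0)//; lra.
have cm2 : c ^+ m.+2 <= c ^+ m.
  by rewrite !exprS mulrA ler_piMl ?exprn_ge0 ?(ltW c0)// mulr_ile1 ?(ltW c0)//; lra.
have cm0 : 0 <= c ^+ m.+2 by rewrite exprn_ge0// ltW.
have p0 : 0 < 1 + c ^+ m.+2 by rewrite ltr_pwDl.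
apply: (H rot a%:C x) => //.
- by rewrite na; lra.
- move=> lam lm; have l1 := nc_unity_root m0 lm.
  have S : dnum s lam / dden s lam = a%:C * slope (cquot rot lam) 0 a%:C.
    have q0 : cquot rot lam 0 = 0 by exact: cquot0.
    by rewrite -(slope0 a%:C q0) /cquot rota.
  have := close lam lm; rewrite S; set q := slope _ _ _ => C1.
  have C2 : nc (a%:C * (q - 1)) <= 2 * (c * T) * al + nc ((al - a)%:C).
    have -> : a%:C * (q - 1) = (a%:C * q - al%:C) + (al - a)%:C by rewrite rmorphB/=; ring.
    by apply: (le_trans (ncD _ _)); rewrite lerD2r.
  have C3 : nc ((al - a)%:C) <= 2 * (c * T) * al + c ^+ 2.
    have P0 : 0 <= 2 * (c * T) * al by rewrite mulr_ge0 ?(ltW al0)// mulr_ge0.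
    by rewrite nc_real ler_norml; apply/andP; split; lra.
  rewrite ncM na in C2; rewrite -(ler_pM2l a0); apply: (le_trans C2).
  have A2 : al / 2 <= a by lra.
  have : (8 * (c * T) + 2 * c) * (al / 2) <= eps * a.
    by apply: ler_pM => //; [rewrite addr_ge0// mulr_ge0// ltW|rewrite divr_ge0// ltW].
  have : c * c <= c * al by rewrite ler_wpM2l ?(ltW c0)//; lra.
  by rewrite [a * eps]mulrC; rewrite expr2 in C3 *; lra.
- have y1 : c <= c * (1 + c ^+ m) / (1 + c ^+ m.+2).
    by rewrite ler_pdivlMr// ler_pM2l// lerD2l.
  have y2 : c * (1 + c ^+ m) / (1 + c ^+ m.+2) <= 9 / 8 * c.
    rewrite ler_pdivrMr//.
    have : c * c ^+ m <= c * (1 / 8) by rewrite ler_wpM2l ?(ltW c0)//; lra.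
    have : 0 <= c * c ^+ m.+2 by rewrite mulr_ge0// ltW.
    lra.
  by rewrite /x; apply/andP; split; [rewrite ler_pdivlMr|rewrite ler_pdivrMr]; lra.
- have S := @slope0 _ (fun zeta => elsym (rot zeta) 1 / m.+1%:R) a%:C.
  apply: (mulfI aC); rewrite -S; last by rewrite rot0 (elsym_lt _ (ltn0Sn m)) mxE mul0r.
  rewrite rota (chain_elsym1 sE) -(rmorphM (real_complex R)) /x [a * _]mulrC divfK ?lt0r_neq0//.
  set y := c * (1 + c ^+ m) / (1 + c ^+ m.+2); have -> : (m.+1%:R * y)%:C = m.+1%:R * y%:C.
    by rewrite (rmorphM (real_complex R)) rmorph_nat.
  by rewrite mulrC mulKf// pnatr_eq0.
Qed.

End ChainOfDiscs.

(** * Failure of exhaustion by biholomorphic images of convex domains *)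

Section Convexity.
Context {R : realType}.
Local Notation C := R[i].
Local Notation Re := (@complex.Re R).
Local Notation Im := (@complex.Im R).
Local Notation nc := (@Normc.normc R).
Local Open Scope complex_scope.

Lemma convex_set_midpoint (V : normedModType C) (A : set V) (x y : V) :
  convex_set (A : set (convex_lmodType V)) -> A x -> A y -> A ((1 / 2 : C) *: x + (1 / 2 : C) *: y).
Proof.
move=> cA Ax Ay.
have half0 : (0 : C) <= 1 / 2 by rewrite divr_ge0.
have half1 : 1 / 2 <= (1 : C) by rewrite ler_pdivrMr// mul1r ler1n.
have h01 : Itv.spec (@Itv.num_sem C) (Itv.Real `[0%Z, 1%Z]) (1 / 2 : C).
  rewrite /Itv.spec/= /Itv.num_sem/= realE half0/= in_itv/=.
  by rewrite half0 half1.
have := cA x y (Itv.mk h01).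
rewrite !inE => /(_ Ax Ay).
have E : 1 - 1 / 2 = 1 / 2 :> C by field.
by rewrite -[X in _ -> A (_ + X *: y)]E.
Qed.

Lemma derive1_local (V : normedModType C) (f g : C -> V) (z : C) (d : R) : 0 < d ->
  (forall w, nc (w - z) < d -> f w = g w) -> derive1 f z = derive1 g z.
Proof.
move=> d0 fg; rewrite !derive1E; apply: near_eq_derive.
by apply/nbhs_nc; exists d.
Qed.

(** Restricted to |z| <= r the two discs have compact images, which lie in some D' biholomorphic to
    a convex set. The midpoint of the two image discs stays in the convex set, and its pullback is a
    disc with derivative (r / 2) (p' + q') at 0. *)
Lemma kobayashi_royden_convex_exhaustible (n : nat) (D : set 'rV[C]_n) (p q : C -> 'rV[C]_n)
    (r : R) : convex_exhaustible D -> 0 < r < 1 ->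
  holomorphic disc D p -> holomorphic disc D q -> p 0 = q 0 ->
  (kobayashi_royden D (p 0%R) (derive1 p 0 + derive1 q 0)%R <= (2 / r)%:E)%E.
Proof.
move=> cD /andP[r0 r1] hp hq pq.
have nr : nc (r%:C : C) = r by rewrite nc_real gtr0_norm.
have rC : r%:C != 0 :> C by rewrite -nc_gt0 nr.
have z1 : nc (0 : C) < 1 by rewrite Normc.normc0.
pose B := [set z : C | nc z <= r].
have compact_image (f : C -> 'rV[C]_n) : holomorphic disc D f -> compact (f @` B).
  move=> hf; apply: continuous_compact; last exact: (@compact_disc R r).
  apply: continuous_in_subspaceT => z; rewrite inE/= => zr.
  apply: differentiable_continuous.
  by have [] := hf z (le_lt_trans zr r1).
have image_sub (f : C -> 'rV[C]_n) : holomorphic disc D f -> f @` B `<=` D.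
  by move=> hf _ [z zr <-]; have [] := hf z (le_lt_trans zr r1).
have KD : (p @` B) `|` (q @` B) `<=` D.
  by rewrite subUset; split; exact: image_sub.
have cK := compactU (compact_image p hp) (compact_image q hq).
have [D' [A [[_ KD' D'D] [_ cA [f [g [hf hg gf fg]]]]]]] := cD _ cK KD.
have Br z : nc z <= 1 -> B (r%:C * z).
  by move=> z1'; rewrite /B/= ncM nr ler_piMr// ltW.
have pD' z : nc z <= 1 -> D' (p (r%:C * z)).
  by move=> /Br Bz; apply: KD'; left; exists (r%:C * z).
have qD' z : nc z <= 1 -> D' (q (r%:C * z)).
  by move=> /Br Bz; apply: KD'; right; exists (r%:C * z).
have rz z : nc z < 1 -> nc (r%:C * z) < 1.
  by move=> /ltW/Br; rewrite /B/= => /le_lt_trans; apply.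
have diff_comp (s : C -> 'rV[C]_n) z : holomorphic disc D s -> (forall z, nc z <= 1 -> D' (s (r%:C * z))) ->
    nc z < 1 -> differentiable (fun x => f (s (r%:C * x))) z.
  move=> hs sD' zz; have [ds _] := hs _ (rz z zz).
  have [df _] := hf _ (sD' _ (ltW zz)).
  exact: (@differentiable_comp _ _ _ _ (fun x => s (r%:C * x)) f z
    (differentiable_rescale ds) df).
pose h z := (1 / 2 : C) *: f (p (r%:C * z)) + (1 / 2 : C) *: f (q (r%:C * z)).
have dh z : nc z < 1 -> differentiable h z.
  move=> zz; apply: differentiableD.
    exact: (differentiableZ (1 / 2 : C) (diff_comp p z hp pD' zz)).
  exact: (differentiableZ (1 / 2 : C) (diff_comp q z hq qD' zz)).
have Ah z : nc z < 1 -> A (h z).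
  move=> zz; apply: convex_set_midpoint => //.
    by have [] := hf _ (pD' z (ltW zz)).
  by have [] := hf _ (qD' z (ltW zz)).
have h0 : h 0 = f (p 0).
  rewrite /h mulr0 -pq -scalerDl.
  have -> : 1 / 2 + 1 / 2 = 1 :> C by field.
  exact: scale1r.
have [dg Dg] := hg _ (Ah 0 z1).
(* The chain rule for g o f o s = s, which holds on the whole unit disc after rescaling by [r]. Both
   discs have the same centre, so the same differential of [g] serves for [p] and [q]. *)
have derive1_lift (s : C -> 'rV[C]_n) : holomorphic disc D s -> s 0 = p 0 ->
    (forall z, nc z <= 1 -> D' (s (r%:C * z))) ->
    'd g (h 0) (derive1 (fun x => f (s (r%:C * x))) 0) = r%:C *: derive1 s 0.
  move=> hs sp sD'; have dfs := diff_comp s 0 hs sD' z1.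
  have E0 : f (s (r%:C * 0)) = h 0 by rewrite mulr0 sp h0.
  have dg' : differentiable g (f (s (r%:C * 0))) by rewrite E0.
  have := derive1_comp_diff dfs dg'; rewrite E0 => <-.
  have ds : differentiable s (r%:C * 0) by have [] := hs _ (rz 0 z1).
  have <- : derive1 (fun x => s (r%:C * x)) 0 = r%:C *: derive1 s 0.
    by rewrite (derive1_rescale ds) mulr0.
  apply: (@derive1_local _ _ _ _ 1) => // w; rewrite subr0 => /ltW w1.
  by rewrite /= gf//; exact: sD'.
have dpsi : derive1 (g \o h) 0 = (r / 2)%:C *: (derive1 p 0 + derive1 q 0).
  rewrite (derive1_comp_diff (dh 0 z1) dg).
  have -> : derive1 h 0 = (1 / 2 : C) *: derive1 (fun x => f (p (r%:C * x))) 0 +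
      (1 / 2 : C) *: derive1 (fun x => f (q (r%:C * x))) 0.
    have dp : derivable (fun x => f (p (r%:C * x))) 0 1.
      exact/diff_derivable/(diff_comp p 0 hp pD' z1).
    have dq : derivable (fun x => f (q (r%:C * x))) 0 1.
      exact/diff_derivable/(diff_comp q 0 hq qD' z1).
    rewrite !derive1E.
    have [_ E] := is_deriveD (is_deriveZ (1 / 2 : C) (derivableP dp))
      (is_deriveZ (1 / 2 : C) (derivableP dq)).
    exact: E.
  have := derive1_lift p hp erefl pD'; have := derive1_lift q hq (esym pq) qD'.
  move: (derive1 (fun x => f (p (r%:C * x))) 0) (derive1 (fun x => f (q (r%:C * x))) 0) => u v.
  move: ('d g (h 0)) => L Lv Lu.
  transitivity ((1 / 2 : C) *: L u + (1 / 2 : C) *: L v).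
    by rewrite linearD !linearZ.
  rewrite Lu Lv -scalerDr -scalerDr scalerA; congr (_ *: _).
  by rewrite rmorphM fmorphV rmorph_nat; ring.
apply: ereal_inf_lbound; exists (2 / r) => //; split; first by rewrite divr_ge0// ltW.
exists (g \o h); split.
- move=> z zz; have [dgz Dgz] := hg _ (Ah z zz); split; last exact: D'D.
  exact: (differentiable_comp (dh z zz) dgz).
- by rewrite /= h0 gf// -[0](mulr0 r%:C); apply: pD'; rewrite Normc.normc0.
- rewrite dpsi scalerA -(rmorphM (real_complex R)).
  have -> : 2 / r * (r / 2) = 1 by field; exact: lt0r_neq0.
  by rewrite scale1r.
Qed.

Theorem not_convex_exhaustible (n : nat) : (3 <= n)%N ->
  ~ convex_exhaustible (symm_polydisc n : set 'rV[C]_n).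
Proof.
move=> n3 cG; have n0 : (0 < n)%N by exact: (leq_trans _ n3).
have nC : n%:R != 0 :> C by rewrite pnatr_eq0 -lt0n.
have [p [hp p0 dp _]] := @divisor_disc R n n0 1 1 n0 (dvd1n _) (Normc.normc1 R).
have nn : (0 < n <= n)%N by rewrite n0 leqnn.
have [q [hq q0 dq _]] := @divisor_disc R n n0 n 1 nn (dvdnn _) (Normc.normc1 R).
have pq : p 0 = q 0 by rewrite p0 q0.
have K (r : R) : 0 < r < 1 -> (kobayashi_royden (symm_polydisc n) 0
    ((n%:R : C) *: basis_vec n 1 + (1 : C) *: basis_vec n n)%R <= (2 / r)%:E)%E.
  move=> r01; have := kobayashi_royden_convex_exhaustible cG r01 hp hq pq.
  by rewrite p0 dp dq divn1 divnn n0 !mulr1.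
have := rho_lt_kobayashi_royden n3 nC (oner_neq0 C).
have n1 : (1 < n)%N by exact: (leq_trans _ n3).
rewrite rho_coordinate_span// nc_nat Normc.normc1 mulr1 mul1r divff ?pnatr_eq0 -?lt0n//.
have := K (1 / 2); have := kobayashi_royden_ge0 (symm_polydisc n) 0
  (n%:R *: basis_vec n 1 + 1 *: basis_vec n n : 'rV[C]_n).
move: K; case: (kobayashi_royden _ _ _) => [a|//|//] K.
- move=> _ _; rewrite lte_fin => a2.
  have a0 : 0 < a + 2 by lra.
  (* If kappa had a finite value a > 2, this radius would give a <= 2 / r = (a + 2) / 2 < a. The
     infinite value is excluded by r = 1/2. *)
  have r01 : 0 < 4 / (a + 2) < 1.
    by apply/andP; split; [rewrite divr_gt0//|rewrite ltr_pdivrMr//; lra].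
  have := K _ r01; rewrite lee_fin.
  have -> : 2 / (4 / (a + 2)) = (a + 2) / 2 by field; exact: lt0r_neq0.
  lra.
- have h01 : 0 < (1 / 2 : R) < 1 by apply/andP; split; lra.
  by move=> _ /(_ h01).
Qed.

End Convexity.

Theorem theorem1 (R : realType) (n : nat) (hn : (3 <= n)%N) :
  let G : set 'rV[R[i]]_n := symm_polydisc n in
  (forall k : nat, (1 <= k <= n)%N -> (k %| n)%N ->
     kobayashi_royden G 0 (basis_vec n k) = rho (basis_vec n k)) /\
  (forall k l : nat, (1 <= k <= n)%N -> (1 <= l <= n)%N -> (k <= l)%N ->
     (k %| n)%N -> (l %| n)%N ->
     forall X, coordinate_span n k l X -> kobayashi_royden2 G 0 X = rho X) /\
  (forall k : nat, (1 <= k <= n)%N -> ~~ (k %| n)%N ->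
     (rho (basis_vec n k) < kobayashi_buseman G 0 (basis_vec n k))%E) /\
  (forall X,
     (coordinate_span n 1 n `\` (coordinate_span n 1 1 `|` coordinate_span n n n)) X ->
     (rho X < kobayashi_royden G 0 X)%E) /\
  (exists2 z, G z & kobayashi G 0 z <> p_symm 0 z) /\
  (exists2 z, G z & lempert G 0 z <> lempert2 G 0 z) /\
  ~ convex_exhaustible G.
Proof.
have n0 : (0 < n)%N by exact: (leq_trans _ hn).
split; first by move=> k; exact: kobayashi_royden_basis.
split; first by move=> k l; exact: kobayashi_royden2_span.
split; first by move=> k; exact: kobayashi_buseman_nondivisor.
split.
  move=> _ [[a [b ->]] /not_orP[nX1 nXn]]; apply: rho_lt_kobayashi_royden => //.
    by apply/eqP => a0; apply: nXn; exists b, 0; rewrite a0 !scale0r add0r addr0.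
  by apply/eqP => b0; apply: nX1; exists a, 0; rewrite b0 !scale0r.
split; first exact: kobayashi_neq_p_symm.
split; first exact: lempert_neq_lempert2.
exact: not_convex_exhaustible.
Qed.
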